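(* Let $[\boldsymbol D,\boldsymbol o]$ be a unimodular discrete metric space. Then, for all equivariant weight functions $\boldsymbol w$ such that $0<\mathbb E[\boldsymbol w(\boldsymbol o)]<\infty$, one has $$\operatorname{ess\,inf}\big(\underline{\mathrm{growth}}(\boldsymbol w(N_r(\boldsymbol o)))\big)\le\mathrm{udim}_H(\boldsymbol D)\le\operatorname{ess\,inf}\big(\overline{\mathrm{growth}}(\boldsymbol w(N_r(\boldsymbol o)))\big)\le\overline{\mathrm{growth}}\big(\mathbb E[\boldsymbol w(N_r(\boldsymbol o))]\big).$$
   Context: A discrete space is a metric space $D$ in which every closed ball $N_r(v)=\{u\in D:d(u,v)\le r\}$ is finite; by convention $N_0(v)=\emptyset$. $\mathcal D_*$ (resp. $\mathcal D_{**}$) is the set of discrete spaces with one (resp. two) distinguished points modulo isometries preserving the distinguished points, with its natural Borel structure (local Gromov–Hausdorff topology); $[D,o]$ denotes the class of $(D,o)$. If points (or pairs of points) carry marks in a complete separable metric space $\Xi$, one gets the analogous space $\mathcal D'_*$ of classes $[D,o;m]$ modulo mark-preserving pointed isometries. A random pointed (marked) discrete space $[\boldsymbol D,\boldsymbol o]$ is unimodular if the mass transport principle holds: for every measurable $g\ge0$ on doubly pointed (marked) spaces, $\mathbb E\big[\sum_{v\in\boldsymbol D}g(\boldsymbol D,\boldsymbol o,v)\big]=\mathbb E\big[\sum_{v\in\boldsymbol D}g(\boldsymbol D,v,\boldsymbol o)\big]$. An equivariant process $\boldsymbol Z$ with values in $\Xi$ assigns to each (deterministic) discrete space $D$ a random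 marking $\boldsymbol Z_D:D\to\Xi$ (extra randomness is allowed) such that (a) for every isometry $\rho:D_1\to D_2$, $\boldsymbol Z_{D_2}\circ\rho$ has the same law as $\boldsymbol Z_{D_1}$, and (b) for every measurable $A\subseteq\mathcal D'_*$, the map $[D,o]\mapsto\mathbb P([D,o;\boldsymbol Z_D]\in A)$ is measurable. When a random $[\boldsymbol D,\boldsymbol o]$ is fixed, it suffices to define $\boldsymbol Z$ on almost every realization, and $\boldsymbol Z_{\boldsymbol D}$ is sampled conditionally on $\boldsymbol D$. An equivariant weight function $\boldsymbol w$ is an equivariant process with values in $\mathbb R^{\ge0}$; $\boldsymbol w(v):=\boldsymbol w_D(v)$ and $\boldsymbol w(S):=\sum_{v\in S}\boldsymbol w(v)$ for $S\subseteq D$. For $f:(0,\infty)\to[0,\infty]$, $\overline{\mathrm{growth}}(f(r)):=\limsup_{r\to\infty}\log f(r)/\log r$ and $\underline{\mathrm{growth}}(f(r)):=\liminf_{r\to\infty}\log f(r)/\log r$. An equivariant covering is an equivariant process $\boldsymbol R$ with values in $\mathbb R^{\ge0}$ such that almost surely $\bigcup_{v\in\boldsymbol D}N_{\boldsymbol R(v)}(v)=\boldsymbol D$ ($\boldsymbol R(v)=0$ means no ball at $v$). Put $\mathcal H^{\alpha}_M(\boldsymbol D):=\inf\{\mathbb E[\boldsymbol R(\boldsymbol o)^{\alpha}]\}$, the infimum being over equivariant coverings with $\boldsymbol R(v)\in\{0\}\cup[M,\infty)$ for all $v$ a.s. (with $0^0:=0$). The unimodular Hausdorff dimension is $\mathrm{udim}_H(\boldsymbol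 D):=\sup\{\alpha\ge0:\mathcal H^{\alpha}_1(\boldsymbol D)=0\}$.
   Formalization: The second inequality is stated under the extra assumption that w(D) > 0 almost surely; otherwise w(N_r(o)) = 0 for all r with positive probability, its growth is −∞ there, and the inequality fails (e.g. D = Z, w ≡ 0 or 1 by a fair coin). *)

(* Defs.v *)
From HB Require Import structures.
From mathcomp Require Import all_boot all_order all_algebra generic_quotient.
From mathcomp Require Import all_classical all_reals all_analysis measurable_realfun.

Set Implicit Arguments.
Unset Strict Implicit.
Unset Printing Implicit Defensive.

Import Order.TTheory GRing.Theory Num.Theory.
Import numFieldNormedType.Exports.

Local Open Scope classical_set_scope.
Local Open Scope ring_scope.

(* The field [ds_class] makes [ds_carrier] a metricType. Bundling a metricType
   instead would put [discrete_space R] in a universe too large for isometry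
   classes to form a measurable type. *)
Record discrete_space (R : realType) := DiscreteSpace {
  ds_carrier : Type ;
  ds_class : Metric.axioms_ R ds_carrier ;
  finite_closed_ball : forall (v : Metric.Pack ds_class) (r : R),
    finite_set [set u : Metric.Pack ds_class | mdist v u <= r] }.

Coercion ds_metric (R : realType) (D : discrete_space R) : metricType R :=
  Metric.Pack (ds_class D).

(* The guard [0 < r] implements the convention N_0(v) = set0. *)
Definition nball (R : realType) (D : discrete_space R) (r : R) (v : D) : set D :=
  [set u | 0 < r /\ mdist v u <= r].

Definition ds_isometry (R : realType) (D1 D2 : discrete_space R) (rho : D1 -> D2) :=
  bijective rho /\ forall x y, mdist (rho x) (rho y) = mdist x y.

(* Discrete spaces with n.+1 distinguished points, the first being the root,
   and k real marks at each point. The spaces D_*, D_** and D'_* are obtained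
   for (n, k) = (0, 0), (1, 0) and (0, 1). *)
Record pspace (R : realType) (n k : nat) := PSpace {
  ps_space : discrete_space R ;
  ps_point : 'I_n.+1 -> ps_space ;
  ps_mark : 'I_k -> ps_space -> R }.

Arguments PSpace {R n k} ps_space ps_point ps_mark.
Arguments ps_point {R n k} X i : rename.
Arguments ps_mark {R n k} X j x : rename.

Definition ps_root (R : realType) n k (X : pspace R n k) : ps_space X :=
  ps_point X ord0.

HB.instance Definition _ (R : realType) n k := gen_eqMixin (pspace R n k).
HB.instance Definition _ (R : realType) n k := gen_choiceMixin (pspace R n k).

Section isometry_classes.
Variables (R : realType) (n k : nat).
Implicit Types X Y Z : pspace R n k.

Definition ps_isometric X Y : Prop :=
  exists rho : ps_space X -> ps_space Y,
    [/\ ds_isometry rho,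
        forall i, rho (ps_point X i) = ps_point Y i &
        forall j x, ps_mark Y j (rho x) = ps_mark X j x].

Definition isob X Y : bool := `[< ps_isometric X Y >].

Lemma isob_refl : reflexive isob.
Proof.
by move=> X; apply/asboolP; exists id; split=> //; split=> //; exists id.
Qed.

Lemma isob_sym : symmetric isob.
Proof.
suff H X Y : isob X Y -> isob Y X by move=> X Y; apply/idP/idP; exact: H.
move=> /asboolP[rho [[[tau rhoK tauK] rhoD] rhoP rhoM]].
apply/asboolP; exists tau; split => [|i|j y].
- by split=> [|x y]; [exists rho|rewrite -rhoD !tauK].
- by rewrite -rhoP rhoK.
- by rewrite -rhoM tauK.
Qed.

Lemma isob_trans : transitive isob.
Proof.
move=> Y X Z /asboolP[f [[fbij fD] fP fM]] /asboolP[g [[gbij gD] gP gM]].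
apply/asboolP; exists (g \o f); split => [|i|j x] /=.
- by split=> [|x y /=]; [exact: bij_comp|rewrite gD fD].
- by rewrite fP gP.
- by rewrite gM fM.
Qed.

Canonical isob_equiv := EquivRel isob isob_refl isob_sym isob_trans.

Definition pclass : Type := {eq_quot isob}%qT.

HB.instance Definition _ := Choice.on pclass.
HB.instance Definition _ := EqQuotient.on pclass.

Definition to_class X : pclass := \pi_pclass%qT X.

(* [ps_close e] is the e-th entourage of the local Gromov-Hausdorff uniformity:
   some correspondence between parts of X and Y containing the balls of radius
   1/e around the roots relates the distinguished points and distorts distances
   and marks by at most e. *)
Definition ps_close (e : R) X Y : Prop :=
  exists C : ps_space X -> ps_space Y -> Prop,
    [/\ forall i, C (ps_point X i) (ps_point Y i),
        forall x x' y y', C x y -> C x' y' ->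
          `|mdist x x' - mdist y y'| <= e,
        forall j x y, C x y -> `|ps_mark X j x - ps_mark Y j y| <= e,
        forall x, mdist (ps_root X) x <= e^-1 -> exists y, C x y &
        forall y, mdist (ps_root Y) y <= e^-1 -> exists x, C x y].

(* [ps_close] is invariant under isometries, so the choice of the
   representatives is immaterial. *)
Definition GH_open : set (set pclass) :=
  [set U | forall x, U x -> exists2 e : R, 0 < e &
     forall y, ps_close e (repr x) (repr y) -> U y].

End isometry_classes.

(* A one-point space, needed only because measurable types are pointed. *)
Section one_point_space.
Variable R : realType.

Definition one_point (_ : realType) : Type := unit.
HB.instance Definition _ := Choice.on (one_point R).

Let dist (_ _ : one_point R) : R := 0.
Let distxx x : dist x x = 0. Proof. by []. Qed.
Let dist_eq0 x y : dist x y = 0 -> x = y. Proof. by case: x; case: y. Qed.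
Let dist_sym x y : dist x y = dist y x. Proof. by []. Qed.
Let dist_triangle y x z : dist x z <= dist x y + dist y z.
Proof. by rewrite /dist addr0. Qed.

HB.instance Definition _ :=
  @isMetric.Build R (one_point R) dist distxx dist_eq0 dist_sym dist_triangle.

Lemma one_point_finite (v : one_point R) (r : R) :
  finite_set [set u : one_point R | mdist v u <= r].
Proof.
by apply: (@sub_finite_set _ _ [set tt]); [case|exact: finite_set1].
Qed.

Definition one_point_space : discrete_space R :=
  @DiscreteSpace R (one_point R) (Metric.class (one_point R)) one_point_finite.

End one_point_space.

Section Borel.
Variables (R : realType) (n k : nat).

HB.instance Definition _ := isPointed.Build (pclass R n k)
  (to_class (PSpace (one_point_space R) (fun=> tt) (fun _ _ => 0))).

Let G := @GH_open R n k.

HB.instance Definition _ := @isMeasurable.Build (sigma_display G)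
  (pclass R n k) <<s G >>
  (@sigma_algebra0 _ setT G) (@sigma_algebraC _ G)
  (@sigma_algebra_bigcup _ setT G).

End Borel.

Section classes.
Variable R : realType.
Implicit Type D : discrete_space R.

(* [D, o], [D, u, v] and [D, o; m] *)
Definition pt1 D (o : D) : pclass R 0 0 :=
  to_class (PSpace D (fun=> o) (fun _ _ => 0)).

Definition pt2 D (u v : D) : pclass R 1 0 :=
  to_class (PSpace D (fun i => if i == ord0 then u else v)
                     (fun _ _ => 0)).

Definition pt1m D (o : D) (m : D -> R) : pclass R 0 1 :=
  to_class (PSpace D (fun=> o) (fun=> m)).

End classes.

(* Law of a random pointed discrete space satisfying the mass transport
   principle. *)
Definition unimodular (R : realType) (mu : probability (pclass R 0 0) R) : Prop :=
  forall g : pclass R 1 0 -> \bar R,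
    measurable_fun [set: pclass R 1 0] g -> (forall x, (0 <= g x)%E) ->
    (\int[mu]_x
       (\esum_(v in [set: ps_space (repr x)]) g (pt2 (ps_root (repr x)) v))
   = \int[mu]_x
       (\esum_(v in [set: ps_space (repr x)]) g (pt2 v (ps_root (repr x)))))%E.

Section equivariant_processes.
Variable R : realType.

(* Product sigma-algebra on the markings of D. *)
Definition marking_measurable (D : discrete_space R) : set (set (D -> R)) :=
  <<s \bigcup_(v in [set: D])
        preimage_set_system [set: D -> R] (fun m => m v) measurable >>.

Record equivariant_process := EquivariantProcess {
  ep_disp : discrete_space R -> measure_display ;
  ep_sample : forall D, measurableType (ep_disp D) ;
  ep_prob : forall D, probability (ep_sample D) R ;
  ep_val : forall D, ep_sample D -> D -> R ;
  ep_measurable : forall (D : discrete_space R) (v : D),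
    measurable_fun [set: ep_sample D] (fun s => ep_val s v) ;
  ep_equivariant : forall (D1 D2 : discrete_space R) (rho : D1 -> D2),
    ds_isometry rho -> forall B, marking_measurable B ->
    ep_prob D2 [set s | B (ep_val s \o rho)] =
    ep_prob D1 [set s | B (ep_val s)] ;
  ep_measurable_law : forall A, measurable A ->
    measurable_fun [set: pclass R 0 0] (fun x =>
      ep_prob (ps_space (repr x))
        [set s | A (pt1m (ps_root (repr x)) (@ep_val (ps_space (repr x)) s))]) }.

Implicit Types (mu : probability (pclass R 0 0) R) (Z : equivariant_process).

(* Expectation, almost sure validity and essential infimum for the random
   marked space obtained by sampling [D, o] from mu, then the marking
   conditionally on D. *)
Definition ep_expectation mu Z
    (f : forall D : discrete_space R, D -> (D -> R) -> \bar R) : \bar R :=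
  (\int[mu]_x \int[ep_prob Z (ps_space (repr x))]_s
     f (ps_space (repr x)) (ps_root (repr x)) (ep_val s))%E.

Definition ep_as mu Z
    (Q : forall D : discrete_space R, D -> (D -> R) -> Prop) : Prop :=
  \forall x \ae mu, \forall s \ae ep_prob Z (ps_space (repr x)),
     Q (ps_space (repr x)) (ps_root (repr x)) (ep_val s).

Definition ep_ess_inf mu Z
    (f : forall D : discrete_space R, D -> (D -> R) -> \bar R) : \bar R :=
  ereal_sup [set y | ep_as mu Z (fun D o m => (y <= f D o m)%E)].

Definition nonneg_process Z : Prop :=
  forall D (s : ep_sample Z D) v, 0 <= ep_val s v.

Definition total_weight (D : discrete_space R) (m : D -> R) (S : set D) : \bar R :=
  (\esum_(v in S) (m v)%:E)%E.

Definition upper_growth (f : R -> \bar R) : \bar R :=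
  limf_esup (fun r => lne (f r) * ((ln r)^-1)%:E)%E (pinfty_nbhs R).

Definition lower_growth (f : R -> \bar R) : \bar R :=
  limf_einf (fun r => lne (f r) * ((ln r)^-1)%:E)%E (pinfty_nbhs R).

Definition equivariant_covering mu Z : Prop :=
  nonneg_process Z /\
  ep_as mu Z (fun D _ m => \bigcup_(v in [set: D]) nball (m v) v = [set: D]).

(* [powR] has 0 `^ 0 = 1, whereas 0 ^ 0 = 0 is wanted here. *)
Definition powR00 (x a : R) : R := if x == 0 then 0 else x `^ a.

Definition hausdorff_content mu (M a : R) : \bar R :=
  ereal_inf [set y | exists Z,
    [/\ equivariant_covering mu Z,
        ep_as mu Z (fun D _ m => forall v, m v = 0 \/ M <= m v) &
        y = ep_expectation mu Z (fun D o m => (powR00 (m o) a)%:E)]].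

(* The supremum is taken in [0, +oo], so that the supremum of the empty set
   is 0. *)
Definition udimH mu : \bar R :=
  ereal_sup (0%E |` [set a%:E | a in [set a | 0 <= a /\
                                  hausdorff_content mu 1 a = 0%E]]).

End equivariant_processes.

(* Main.v *)
(* The first inequality is proved with random coverings: select points
   independently, v with probability 1 - exp(-a(v)) where a(v) is
   r^(-b') E[w(v) | D] truncated at r, put balls of radius r at the selected
   points and balls of radius 1 at the points which these leave uncovered. Then
     E[R(o)^b] <= r^(b - b') E[w(o)] + E[exp(- sum_(v in N_r(o)) a(v))],
   and both terms vanish as r tends to infinity when b < b' < c and w(N_r(o))
   almost surely dominates r^c.

   The second one is a mass distribution principle: keep only the weight of the
   points v such that w(N_j(v)) <= c j^a for all j >= 1, and let each point send
   its kept weight to the centers of the balls which cover it. By mass transport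
   the mean kept weight at o is at most c 6^a E[R(o)^a] for every covering R.
   Hence if the Hausdorff content vanishes then no weight is kept anywhere, for
   any c, and wherever the total weight is positive the upper growth is at least a.

   The third one follows from the finiteness of the expectation of
   sum_n 2^(-n a) w(N_(2^n)(o)) when a exceeds the upper growth of E[w(N_r(o))].

   As the Borel structure on isometry classes is generated by the local
   Gromov-Hausdorff topology only, the measurability of all the functionals
   involved (sums over the points, existence of points with a given property,
   laws of the random coverings) has to be derived from countable bases. *)

Require Import Defs.
From HB Require Import structures.
From mathcomp Require Import all_boot all_order all_algebra generic_quotient.
From mathcomp Require Import all_classical all_reals all_analysis measurable_realfun.
From mathcomp Require Import lra.

Set Implicit Arguments.
Unset Strict Implicit.
Unset Printing Implicit Defensive.

Import Order.TTheory GRing.Theory Num.Theory.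
Import numFieldNormedType.Exports.

Local Open Scope classical_set_scope.
Local Open Scope ring_scope.


(** * Measurable functions of pointed spaces *)

Section pointed_spaces.
Variable R : realType.
Implicit Types n k N : nat.

(** A process is sampled given [D] alone, so a covering and [w] have no joint law. Both of the first
    two inequalities therefore use [w] through conditional means given [D], which are functionals of
    the unmarked space. For the second one, the bound on the kept weight in a ball survives
    averaging because its right-hand side is deterministic. For the first one, almost sure growth of
    [w] becomes growth of the mean weight of balls, at the price of a factor equal to the
    probability of a suitable event. The truncation of a(v) keeps it real where the mean is
    infinite; since a sum of truncated terms is at least the truncated sum, it only adds a term of
    order exp(-r) to the probability of being uncovered. The constant 6 is 2 * 3: distances are
    rounded down to integers, so a ball of radius R reaches at most 2R, and a ball of radius s is
    compared with one of integer radius at most 3s about a kept point. On the measurable side,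
    points carry no labels: they are only summed or quantified over. The law of a covering is first
    computed on events seen from a finite ball, as a finite sum over the selections in a larger
    ball. *)

Lemma ps_isometric_sym n k (X Y : pspace R n k) :
  ps_isometric X Y -> ps_isometric Y X.
Proof.
by move=> XY; apply/asboolP; have := isob_sym X Y; rewrite /isob => <-; apply/asboolP.
Qed.

Lemma to_classP n k (X Y : pspace R n k) :
  to_class X = to_class Y <-> ps_isometric X Y.
Proof.
split=> [/eqquotP/asboolP //|XY]; first by apply/eqquotP/asboolP.
Qed.

Lemma repr_to_class n k (X : pspace R n k) : ps_isometric (repr (to_class X)) X.
Proof. by apply/to_classP; rewrite /to_class reprK. Qed.

Lemma to_class_repr n k (x : pclass R n k) : to_class (repr x) = x.
Proof. by rewrite /to_class reprK. Qed.

Lemma ps_close_iso n k e (X X' Y Y' : pspace R n k) :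
  ps_isometric X X' -> ps_isometric Y Y' -> ps_close e X Y -> ps_close e X' Y'.
Proof.
move=> [f [[[f' ff' f'f] fD] fP fM]] [g [[[g' gg' g'g] gD] gP gM]] [C [CP CD CM CX CY]].
exists (fun x y => C (f' x) (g' y)); split.
- by move=> i; rewrite -fP -gP ff' gg'.
- by move=> x x' y y' xy x'y'; rewrite -(f'f x) -(f'f x') -(g'g y) -(g'g y') fD gD; exact: CD.
- by move=> j x y xy; rewrite -{1}(f'f x) -{1}(g'g y) fM gM; exact: CM.
- move=> x; rewrite /ps_root -fP -(f'f x) fD => /CX[y xy].
  by exists (g y); rewrite gg' ff'.
- move=> y; rewrite /ps_root -gP -(g'g y) gD => /CY[x xy].
  by exists (f x); rewrite gg' ff'.
Qed.

Lemma ps_close_le n k e e' (X Y : pspace R n k) : 0 < e -> e <= e' ->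
  ps_close e X Y -> ps_close e' X Y.
Proof.
move=> e0 ee' [C [CP CD CM CX CY]].
have iv : e'^-1 <= e^-1 by rewrite lef_pV2 ?posrE //; exact: lt_le_trans ee'.
exists C; split => //.
- by move=> x x' y y' /CD h /h /le_trans; apply.
- by move=> j x y /(CM j) /le_trans; apply.
- by move=> x xr; apply: CX; exact: le_trans iv.
- by move=> x xr; apply: CY; exact: le_trans iv.
Qed.

(** [ps_close] does not distinguish isometric spaces, so openness may be tested on any
    representative in place of [repr]. *)
Lemma GH_openP n k (U : set (pclass R n k)) : GH_open U <->
  forall X : pspace R n k, U (to_class X) ->
    exists2 e : R, 0 < e & forall Y : pspace R n k, ps_close e X Y -> U (to_class Y).
Proof.
split=> oU x Ux.
  have [e e0 He] := oU _ Ux; exists e => // Y XY; apply: He.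
  by apply: ps_close_iso XY; apply: ps_isometric_sym; exact: repr_to_class.
rewrite -(to_class_repr x) in Ux.
have [e e0 He] := oU _ Ux; exists e => // y /He.
by rewrite to_class_repr.
Qed.

Lemma measurable_GH n k (U : set (pclass R n k)) : GH_open U -> measurable U.
Proof. exact: sub_gen_smallest. Qed.

Lemma GH_open_setI n k : setI_closed (@GH_open R n k).
Proof.
move=> U V oU oV x [/oU[e e0 He] /oV[d d0 Hd]].
have m0 : 0 < Num.min e d by rewrite lt_min e0.
exists (Num.min e d) => // y xy; split.
  by apply: He; apply: ps_close_le xy => //; rewrite ge_min lexx.
by apply: Hd; apply: ps_close_le xy => //; rewrite ge_min lexx orbT.
Qed.

Definition iso_invariant n k T (f : pspace R n k -> T) :=
  forall X Y, ps_isometric X Y -> f X = f Y.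

(** Functionals are written on concrete spaces, where points can be named; invariance makes them
    descend to classes and lets [repr] be exchanged for a convenient representative. *)
Definition ps_measurable n k d (T : measurableType d) (f : pspace R n k -> T) :=
  iso_invariant f /\
  measurable_fun [set: pclass R n k] (fun x : pclass R n k => f (repr x)).

Section ps_measurable_theory.
Context n k d (T : measurableType d).
Implicit Types f : pspace R n k -> T.

Lemma ps_measurable_repr f (X : pspace R n k) :
  ps_measurable f -> f (repr (to_class X)) = f X.
Proof. by move=> [fi _]; apply: fi; exact: repr_to_class. Qed.

Lemma ps_measurable_comp d' (T' : measurableType d') f (g : T -> T') :
  measurable_fun setT g -> ps_measurable f -> ps_measurable (fun X => g (f X)).
Proof.
move=> mg [fi mf]; split=> [X Y /fi -> //|].
exact: measurableT_comp mg mf.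
Qed.

Lemma ps_measurable_cst (c : T) : ps_measurable (fun _ : pspace R n k => c).
Proof. by split. Qed.

Lemma ps_measurable_eq f g : (forall X, f X = g X) -> ps_measurable f -> ps_measurable g.
Proof. by move=> /funext ->. Qed.

End ps_measurable_theory.

Lemma ps_measurable_map n k n' k' d (T : measurableType d)
    (Phi : pspace R n' k' -> pspace R n k) (f : pspace R n k -> T) :
  ps_measurable (fun X => to_class (Phi X)) -> ps_measurable f ->
  ps_measurable (fun X => f (Phi X)).
Proof.
move=> mPhi mf.
apply: (@ps_measurable_eq _ _ _ _ (fun X => f (repr (to_class (Phi X))))).
  by move=> X; exact: ps_measurable_repr.
exact: (@ps_measurable_comp n' k' _ _ _ T (fun X => to_class (Phi X)) (fun x => f (repr x)) mf.2 mPhi).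
Qed.

(** The hypothesis on [op] speaks of functions on classes, which keeps product sigma-algebras out of
    the picture. *)
Lemma ps_measurable_lift2 n k d1 d2 d3 (T1 : measurableType d1)
    (T2 : measurableType d2) (T3 : measurableType d3) (op : T1 -> T2 -> T3)
    (f : pspace R n k -> T1) (g : pspace R n k -> T2) :
  (forall (u : pclass R n k -> T1) (v : pclass R n k -> T2),
     measurable_fun setT u -> measurable_fun setT v ->
     measurable_fun setT (fun x => op (u x) (v x))) ->
  ps_measurable f -> ps_measurable g -> ps_measurable (fun X => op (f X) (g X)).
Proof.
move=> mop [fi mf] [gi mg]; split=> [X Y XY|]; last exact: mop.
by rewrite (fi _ _ XY) (gi _ _ XY).
Qed.

Lemma ps_measurable_and n k (P Q : pspace R n k -> bool) :
  ps_measurable P -> ps_measurable Q -> ps_measurable (fun X => P X && Q X).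
Proof. by apply: ps_measurable_lift2 => u v; exact: measurable_and. Qed.

Lemma ps_measurable_or n k (P Q : pspace R n k -> bool) :
  ps_measurable P -> ps_measurable Q -> ps_measurable (fun X => P X || Q X).
Proof. by apply: ps_measurable_lift2 => u v; exact: measurable_or. Qed.

Lemma ps_measurable_neg n k (P : pspace R n k -> bool) :
  ps_measurable P -> ps_measurable (fun X => ~~ P X).
Proof. by apply: ps_measurable_comp. Qed.

Lemma ps_measurable_le n k (f g : pspace R n k -> R) :
  ps_measurable f -> ps_measurable g -> ps_measurable (fun X => f X <= g X).
Proof. by apply: ps_measurable_lift2 => u v; exact: measurable_fun_ler. Qed.

Lemma ps_measurable_lt n k (f g : pspace R n k -> R) :
  ps_measurable f -> ps_measurable g -> ps_measurable (fun X => f X < g X).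
Proof. by apply: ps_measurable_lift2 => u v; exact: measurable_fun_ltr. Qed.

Lemma ps_measurable_if n k d (T : measurableType d)
    (b : pspace R n k -> bool) (f g : pspace R n k -> T) :
  ps_measurable b -> ps_measurable f -> ps_measurable g ->
  ps_measurable (fun X => if b X then f X else g X).
Proof.
move=> [bi mb] [fi mf] [gi mg]; split=> [X Y XY|].
  by rewrite (bi _ _ XY) (fi _ _ XY) (gi _ _ XY).
exact: measurable_fun_ifT.
Qed.

Lemma ps_measurable_boolP n k (P : pspace R n k -> bool) :
  ps_measurable P <->
  iso_invariant P /\ measurable [set x : pclass R n k | P (repr x)].
Proof.
split=> -[Pi mP]; split => //.
  by rewrite -[X in measurable X]setTI; exact: (mP measurableT [set true]).
by apply: (@measurable_fun_bool _ _ _ _ true); rewrite setTI.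
Qed.

Lemma ps_measurable_forallb n k (I : finType) (P : I -> pspace R n k -> bool) :
  (forall i, ps_measurable (P i)) ->
  ps_measurable (fun X => [forall i, P i X]).
Proof.
move=> mP; apply/ps_measurable_boolP; split.
  by move=> X Y XY; apply: eq_forallb => i; exact: (mP i).1.
rewrite (_ : mkset _ = \bigcap_(i in [set: I]) [set x | P i (repr x)]).
  apply: fin_bigcap_measurable => // i _.
  exact: ((ps_measurable_boolP (P i)).1 (mP i)).2.
by apply/seteqP; split=> x /= => [/forallP h i _|h]; [exact: h|apply/forallP => i; exact: h].
Qed.

Lemma ps_measurable_existsb n k (I : finType) (P : I -> pspace R n k -> bool) :
  (forall i, ps_measurable (P i)) ->
  ps_measurable (fun X => [exists i, P i X]).
Proof.
move=> mP; apply: (@ps_measurable_eq _ _ _ _ (fun X => ~~ [forall i, ~~ P i X])).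
  by move=> X; rewrite negb_forall; apply: eq_existsb => i; rewrite negbK.
by apply/ps_measurable_neg/ps_measurable_forallb => i; exact: ps_measurable_neg.
Qed.

Lemma ps_measurable_countable_exists n k (P : nat -> pspace R n k -> bool) :
  (forall i, ps_measurable (P i)) ->
  ps_measurable (fun X => `[< exists i, P i X >]).
Proof.
move=> mP; apply/ps_measurable_boolP; split.
  by move=> X Y XY; congr asbool; apply/propext; split=> -[i Pi]; exists i;
    rewrite ?((mP i).1 _ _ XY) // -((mP i).1 _ _ XY).
rewrite (_ : mkset _ = \bigcup_i [set x | P i (repr x)]).
  apply: bigcup_measurable => i _.
  exact: ((ps_measurable_boolP (P i)).1 (mP i)).2.
by apply/seteqP; split=> x /= => [/asboolP[i Pi]|[i _ Pi]]; [exists i|apply/asboolP; exists i].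
Qed.

Lemma ps_measurable_countable_forall n k (P : nat -> pspace R n k -> bool) :
  (forall i, ps_measurable (P i)) ->
  ps_measurable (fun X => `[< forall i, P i X >]).
Proof.
move=> mP; apply: (@ps_measurable_eq _ _ _ _ (fun X => ~~ `[< exists i, ~~ P i X >])).
  move=> X; rewrite -asbool_neg; apply: asbool_equiv_eq.
  by split=> [h i|h [i /negP]]; [apply: contrapT => /negP nP; apply: h; exists i|exact].
apply/ps_measurable_neg/ps_measurable_countable_exists => i.
exact: ps_measurable_neg.
Qed.

(** The sets where [f] exceeds a constant are open. Lower semicontinuity is the regularity that
    counts of points have, see [ps_sum_open]. *)
Lemma ps_measurable_lscE n k (f : pspace R n k -> \bar R) : iso_invariant f ->
  (forall (X : pspace R n k) (c : \bar R), (c < f X)%E ->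
     exists2 e : R, 0 < e & forall Y, ps_close e X Y -> (c < f Y)%E) ->
  ps_measurable f.
Proof.
move=> fi lsc; split => //; apply: measurability (ErealGenOInfty.measurableE R) _.
move=> _ [_ [c ->] <-]; rewrite setTI; apply: measurable_GH; apply/GH_openP => X /=.
rewrite in_itv/= andbT (fi _ _ (repr_to_class X)) => /lsc[e e0 He].
by exists e => // Y /He; rewrite in_itv/= andbT (fi _ _ (repr_to_class Y)).
Qed.

Lemma ps_measurable_continuous n k (f : pspace R n k -> R) : iso_invariant f ->
  (forall (X : pspace R n k) (r : R), 0 < r ->
     exists2 e : R, 0 < e & forall Y, ps_close e X Y -> `|f X - f Y| <= r) ->
  ps_measurable f.
Proof.
move=> fi fc.
have fE : ps_measurable (fun X => (f X)%:E).
  apply: ps_measurable_lscE => [X Y /fi -> //|X [c| |]]; rewrite ?ltNyr ?ltNge ?leey //.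
    rewrite -ltNge lte_fin -subr_gt0 => cf.
    have [|e e0 He] := fc X ((f X - c) / 2); first by rewrite divr_gt0.
    exists e => // Y /He; rewrite lte_fin ler_norml; lra.
  by move=> _; exists 1 => // Y _; rewrite ltNyr.
split => //; exact: (measurableT_comp (fine_measurable measurableT) fE.2).
Qed.

End pointed_spaces.

(** * Distances, marks and extensions by further points *)

Section atoms.
Variable R : realType.
Implicit Types n k N : nat.

Definition ps_dist n k (i j : 'I_n.+1) (X : pspace R n k) : R :=
  mdist (ps_point X i) (ps_point X j).

Definition ps_label n k (j : 'I_k) (i : 'I_n.+1) (X : pspace R n k) : R :=
  ps_mark X j (ps_point X i).

Lemma ps_measurable_dist n k (i j : 'I_n.+1) : ps_measurable (@ps_dist n k i j).
Proof.
apply: ps_measurable_continuous => [X Y [f [[_ fD] fP _]]|X r r0].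
  by rewrite /ps_dist -!fP fD.
by exists r => // Y [C [CP CD _ _ _]]; exact: CD.
Qed.

Lemma ps_measurable_label n k (j : 'I_k) (i : 'I_n.+1) :
  ps_measurable (@ps_label n k j i).
Proof.
apply: ps_measurable_continuous => [X Y [f [[_ fD] fP fM]]|X r r0].
  by rewrite /ps_label -!fP fM.
by exists r => // Y [C [CP _ CM _ _]]; exact: CM.
Qed.

Definition ps_select m n k (s : 'I_m.+1 -> 'I_n.+1) (X : pspace R n k) : pspace R m k :=
  PSpace (ps_space X) (fun i => ps_point X (s i)) (ps_mark X).

Lemma ps_measurable_select m n k (s : 'I_m.+1 -> 'I_n.+1) :
  ps_measurable (fun X : pspace R n k => to_class (ps_select s X)).
Proof.
split=> [X Y [f [fi fP fM]]|].
  by apply/to_classP; exists f; split => //= i; exact: fP.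
apply: measurability => // _ [U oU <-]; rewrite setTI.
apply: measurable_GH; apply/GH_openP => X /=.
have selE Z : to_class (ps_select s (repr (to_class Z))) = to_class (ps_select s Z).
  have [f [fi fP fM]] := repr_to_class Z.
  by apply/to_classP; exists f; split => //= i; exact: fP.
rewrite selE => UX.
have [e e0 He] := (GH_openP U).1 oU _ UX.
set d := mdist (ps_root X) (ps_point X (s ord0)).
have d0 : 0 <= d by exact: mdist_ge0.
have ei0 : 0 < e^-1 by rewrite invr_gt0.
(* The new root lies at distance [d] from the old one in [X], and at most [d + 1] in [Y]; balls of
   radius [e^-1] about the new roots are thus inside balls of radius [e^-1 + d + 1] about the old
   ones, where the correspondence is defined. *)
pose e' := Num.min (Num.min 1 e) (e^-1 + d + 1)^-1.
have q0 : 0 < e^-1 + d + 1 by lra.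
have e'0 : 0 < e' by rewrite /e' !lt_min ltr01 e0 invr_gt0.
have [e'1 e'e e'd] : [/\ e' <= 1, e' <= e & e^-1 + d + 1 <= e'^-1].
  split; rewrite ?/e' ?ge_min ?lexx ?orbT //.
  by rewrite -[leLHS]invrK lef_pV2 ?posrE ?invr_gt0 // ge_min lexx orbT.
exists e' => // Y [C [CP CD CM CX CY]]; rewrite selE; apply: He.
exists C; split => //=.
- by move=> x x' y y' h1 h2; apply: le_trans e'e; exact: CD.
- by move=> j x y h; apply: le_trans e'e; exact: CM.
- move=> x; rewrite /ps_root/= => hx; apply: CX.
  apply: le_trans e'd; apply: (le_trans (metric_triangle _ (ps_point X (s ord0)) _)).
  by rewrite -/d; lra.
- move=> y; rewrite /ps_root/= => hy; apply: CY.
  apply: le_trans e'd; apply: (le_trans (metric_triangle _ (ps_point Y (s ord0)) _)).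
  have := CD _ _ _ _ (CP ord0) (CP (s ord0)).
  rewrite ler_norml -/(ps_root X) -/(ps_root Y) -/d; lra.
Qed.

(** A sum or a quantifier over points of [X] is an operation on these extensions. As they are
    pointed spaces again, predicates about several points are functionals of the same kind and can
    be nested. *)
Definition ps_extend n k N (X : pspace R n k) (v : 'I_N -> ps_space X) :
    pspace R (n + N) k :=
  PSpace (ps_space X)
    (fun i : 'I_(n + N).+1 => match fintype.split (i : 'I_(n.+1 + N)) with
       | inl a => ps_point X a | inr b => v b end)
    (ps_mark X).

Definition oldpt n N (i : 'I_n.+1) : 'I_(n + N).+1 := lshift N i.
Definition newpt n N (i : 'I_N) : 'I_(n + N).+1 := rshift n.+1 i.

Lemma ps_extend_old n k N (X : pspace R n k) (v : 'I_N -> ps_space X) i :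
  ps_point (ps_extend v) (oldpt N i) = ps_point X i.
Proof. by rewrite /= /oldpt (unsplitK (inl i)). Qed.

Lemma ps_extend_new n k N (X : pspace R n k) (v : 'I_N -> ps_space X) i :
  ps_point (ps_extend v) (newpt n i) = v i.
Proof. by rewrite /= /newpt (unsplitK (inr i)). Qed.

Lemma ps_root_extend n k N (X : pspace R n k) (v : 'I_N -> ps_space X) :
  ps_root (ps_extend v) = ps_root X.
Proof.
rewrite /ps_root -(ps_extend_old v); congr (ps_point _ _).
exact/val_inj.
Qed.

Lemma extend_pointP n N (P : 'I_(n + N).+1 -> Prop) :
  (forall i, P (oldpt N i)) -> (forall i, P (newpt n i)) -> forall i, P i.
Proof.
move=> ho hn i; rewrite -(splitK (i : 'I_(n.+1 + N))).
by case: (fintype.split (i : 'I_(n.+1 + N))) => j; [exact: ho|exact: hn].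
Qed.

Lemma ps_extend_iso n k N (X Y : pspace R n k) (rho : ps_space X -> ps_space Y)
    (v : 'I_N -> ps_space X) :
  ds_isometry rho -> (forall i, rho (ps_point X i) = ps_point Y i) ->
  (forall j x, ps_mark Y j (rho x) = ps_mark X j x) ->
  ps_isometric (ps_extend v) (ps_extend (fun i => rho (v i))).
Proof.
move=> rhoi rhoP rhoM; exists rho; split => //; apply: extend_pointP => i.
  by rewrite !ps_extend_old.
by rewrite !ps_extend_new.
Qed.

Lemma countable_discrete_space (D : discrete_space R) : countable [set: D].
Proof.
have [D0|/set0P[x0 Dx0]] := eqVneq [set: D] set0; first by rewrite D0.
have -> : [set: D] = \bigcup_(m in [set: nat]) [set u | mdist x0 u <= m%:R].
  apply/seteqP; split=> // x _; exists (Num.truncn (mdist x0 x)).+1 => //=.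
  by rewrite ltW // truncnS_gt.
apply: bigcup_countable => // m _; apply: finite_set_countable.
exact: finite_closed_ball.
Qed.

Lemma finite_tuples (T : choiceType) (B : set T) N : finite_set B ->
  finite_set [set v : 'I_N -> T | forall i, B (v i)].
Proof.
move=> /finite_seqP[s ->].
have [s0|s_gt0] := posnP (size s).
  case: N => [|N].
    apply: (@sub_finite_set _ _ [set (fun i : 'I_0 => match notF (valP i) with end : T)]).
      by move=> v _ /=; apply/funext => -[].
    exact: finite_set1.
  rewrite (_ : mkset _ = set0); first exact: finite_set0.
  by rewrite (size0nil s0); apply/seteqP; split=> // v /(_ ord0).
have [x0 _] : exists x0, x0 \in s by case: s s_gt0 => // x0 s _; exists x0; exact: mem_head.
apply: (@sub_finite_set _ _ ((fun (f : {ffun 'I_N -> 'I_(size s)}) i => nth x0 s (f i)) @` setT)).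
  move=> v /= vs; have iv i : (index (v i) s < size s)%N by rewrite index_mem; exact: vs.
  exists [ffun i => Ordinal (iv i)] => //; apply/funext => i.
  by rewrite ffunE /= nth_index //; exact: vs.
by apply: finite_image; exact: finite_finset.
Qed.

Lemma countable_tuples (D : discrete_space R) N : countable [set: 'I_N -> D].
Proof.
have [D0|/set0P[x0 Dx0]] := eqVneq [set: D] set0.
  case: N => [|N].
    apply: finite_set_countable; apply: (@sub_finite_set _ _ [set v | forall i : 'I_0, (set0 : set D) (v i)]).
      by move=> v _ [].
    by apply: finite_tuples; exact: finite_set0.
  rewrite (_ : setT = set0); first exact: countable0.
  by apply/seteqP; split=> // v _; have : [set: D] (v ord0) by []; rewrite D0.
have -> : [set: 'I_N -> D] = \bigcup_(m in [set: nat])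
    [set v | forall i, [set u | mdist x0 u <= m%:R] (v i)].
  apply/seteqP; split=> // v _.
  exists (\max_i (Num.truncn (mdist x0 (v i))).+1)%N => //= i.
  apply: (@le_trans _ _ ((Num.truncn (mdist x0 (v i))).+1%:R)); first by rewrite ltW // truncnS_gt.
  by rewrite ler_nat (bigD1 i) //= leq_maxl.
apply: bigcup_countable => // m _; apply: finite_set_countable.
by apply: finite_tuples; exact: finite_closed_ball.
Qed.

End atoms.

(** * Sums over the points of a space *)

Section counting_image.
Context (R : realType) (T : choiceType) (cT : countable [set: T]).

Definition cnt_index : T -> nat := sval (cid (elimT (countable_injP _) cT)).

Lemma cnt_index_inj : injective cnt_index.
Proof.
move=> x y; rewrite /cnt_index; case: cid => /= f fi; apply: fi; exact: in_setT.
Qed.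

Definition cnt_unindex (i : nat) : option T :=
  if pselect (exists t, cnt_index t = i) is left h then Some (sval (cid h)) else None.

Lemma cnt_indexK t : cnt_unindex (cnt_index t) = Some t.
Proof.
rewrite /cnt_unindex; case: pselect => [h|[]]; last by exists t.
by case: cid => /= u /cnt_index_inj ->.
Qed.

Lemma cnt_unindexP i t : cnt_unindex i = Some t -> cnt_index t = i.
Proof. by rewrite /cnt_unindex; case: pselect => // h [<-]; case: cid. Qed.

Local Open Scope ereal_scope.

Lemma esum_cnt (G : T -> \bar R) : (forall t, 0 <= G t) ->
  \esum_(t in setT) G t =
  \sum_(0 <= i <oo) (if cnt_unindex i is Some t then G t else 0).
Proof.
move=> G0; rewrite nneseries_esumT; last by move=> i; case: cnt_unindex.
pose a i := if cnt_unindex i is Some t then G t else 0.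
transitivity (\esum_(i in range cnt_index) a i); last first.
  rewrite [LHS]esum_mkcond; apply: eq_esum => i _; case: ifPn => //.
  rewrite notin_setE => /= ni; rewrite /a; case E: cnt_unindex => [t|//].
  by case: ni; exists t => //; exact: cnt_unindexP.
rewrite esum_image; last by move=> x y _ _; exact: cnt_index_inj.
by apply: eq_esum => t _; rewrite /a cnt_indexK.
Qed.

Section measure.
Context d (Y : measurableType d) (h : T -> Y).

Let dirac_at (i : nat) : {measure set Y -> \bar R} :=
  if cnt_unindex i is Some t then \d_(h t) else mzero.

(** The image under [h] of the counting measure on [T]. Written as a measure, a sum over points
    becomes an integral, to which results on kernels apply. *)
Definition image_counting : {measure set Y -> \bar R} := mseries dirac_at 0.

Lemma integral_image_counting (G : Y -> \bar R) : (forall y, 0 <= G y) ->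
  measurable_fun setT G ->
  \int[image_counting]_y G y = \esum_(t in setT) G (h t).
Proof.
move=> G0 mG; rewrite ge0_integral_measure_series// esum_cnt//.
apply: eq_eseriesr => i _; rewrite /dirac_at; case: cnt_unindex => [t|].
  by rewrite integral_dirac// diracT mul1e.
by rewrite integral_measure_zero.
Qed.

Lemma image_countingE U : image_counting U = \esum_(t in setT) (\1_U (h t))%:E.
Proof.
rewrite esum_cnt; last by move=> t; rewrite lee_fin.
rewrite /image_counting/= /mseries; apply: eq_eseriesr => i _.
by rewrite /dirac_at; case: cnt_unindex.
Qed.

End measure.
End counting_image.

Section summation.
Variable R : realType.
Local Open Scope ereal_scope.

Definition ps_sum n k N (G : pspace R (n + N) k -> \bar R) (X : pspace R n k) :=
  \esum_(v in [set: 'I_N -> ps_space X]) G (ps_extend v).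

Lemma ps_sum_iso n k N (G : pspace R (n + N) k -> \bar R) :
  iso_invariant G -> iso_invariant (ps_sum G).
Proof.
move=> Gi X Y [rho [rhoi rhoP rhoM]]; rewrite /ps_sum.
have [tau rhoK tauK] := rhoi.1.
rewrite (@reindex_esum R _ _ [set: 'I_N -> ps_space X] _ (fun v i => rho (v i))).
  by apply: eq_esum => v _; apply: Gi; exact: ps_extend_iso.
split => [//|v v' _ _ vv'|v _].
  apply/funext => i; rewrite -(rhoK (v i)) -(rhoK (v' i)).
  by congr tau; exact: (congr1 (fun f => f i) vv').
by exists (fun i => tau (v i)) => //; apply/funext => i.
Qed.

Lemma exists_common_small (T : choiceType) (A : set T) (P : T -> R -> Prop) :
  finite_set A -> (forall a e e', P a e -> (0 < e')%R -> (e' <= e)%R -> P a e') ->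
  (forall a, A a -> exists2 e, (0 < e)%R & P a e) ->
  exists2 e, (0 < e)%R & forall a, A a -> P a e.
Proof.
move=> /finite_seqP[s ->] Pd; elim: s => [|a s IH] h; first by exists 1%R.
have [|e e0 He] := IH; first by move=> b bs; apply: h; rewrite /= inE bs orbT.
have [|d d0 Hd] := h a; first by rewrite /= mem_head.
have m0 : (0 < Num.min e d)%R by rewrite lt_min e0.
exists (Num.min e d) => // b; rewrite /= inE => /orP[/eqP ->|bs].
  by apply: Pd Hd _ _ => //; rewrite ge_min lexx orbT.
by apply: Pd (He _ bs) _ _ => //; rewrite ge_min lexx.
Qed.

(** Finitely many tuples already make the count exceed [c]. A correspondence with a close space
    carries them to tuples there: openness of [U] keeps them in [U], and a scale below their
    separation keeps them distinct. Counting is thus lower semicontinuous. *)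
Lemma ps_sum_open n k N (U : set (pclass R (n + N) k)) : GH_open U ->
  ps_measurable (ps_sum (fun Z => (\1_U (to_class Z))%:E)).
Proof.
move=> oU; apply: ps_measurable_lscE.
  by apply: ps_sum_iso => X Y /to_classP ->.
move=> X c /ereal_sup_gt[_ [A [Afin _] <-] cA].
pose P1 (v : 'I_N -> ps_space X) (e : R) := [/\ (0 < e)%R,
  U (to_class (ps_extend v)) ->
  forall Z, ps_close e (ps_extend v) Z -> U (to_class Z) &
  forall i, (mdist (ps_root X) (v i) <= e^-1)%R].
have P1d v e e' : P1 v e -> (0 < e')%R -> (e' <= e)%R -> P1 v e'.
  move=> [e0 H1 H2] e'0 e'e; split=> // [Uv Z|i].
    by move=> /(ps_close_le e'0 e'e); exact: H1.
  by apply: (le_trans (H2 i)); rewrite lef_pV2 ?posrE.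
have [e1 e10 He1] : exists2 e, (0 < e)%R & forall v, A v -> P1 v e.
  apply: exists_common_small => // v Av.
  have [e e0 He] : exists2 e, (0 < e)%R & (U (to_class (ps_extend v)) ->
     forall Z, ps_close e (ps_extend v) Z -> U (to_class Z)).
    have [Uv|nUv] := pselect (U (to_class (ps_extend v))); last by exists 1%R.
    by have [e e0 He] := (GH_openP U).1 oU _ Uv; exists e.
  pose M := (1 + \sum_(i < N) mdist (ps_root X) (v i))%R.
  have M0 : (0 < M)%R by rewrite ltr_pwDl // sumr_ge0 // => i _; exact: mdist_ge0.
  have m0 : (0 < Num.min e M^-1)%R by rewrite lt_min e0 invr_gt0.
  exists (Num.min e M^-1)%R => //; split=> // [Uv Z|i].
    by move=> /(ps_close_le (e' := e) m0) h; apply: He => //; apply: h; rewrite ge_min lexx.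
  apply: (@le_trans _ _ M); last by rewrite -[leLHS]invrK lef_pV2 ?posrE ?invr_gt0 // ge_min lexx orbT.
  rewrite /M (bigD1 i) //= addrCA lerDl addr_ge0 // sumr_ge0 // => j _; exact: mdist_ge0.
(* At a scale satisfying [P2], two distinct tuples have a coordinate that the distortion cannot
   collapse, so their images differ. *)
pose P2 (vv : ('I_N -> ps_space X) * ('I_N -> ps_space X)) (e : R) :=
  vv.1 <> vv.2 -> exists i, (e < mdist (vv.1 i) (vv.2 i))%R.
have P2d vv e e' : P2 vv e -> (e' <= e)%R -> P2 vv e'.
  by move=> H e'e /H [i Hi]; exists i; exact: le_lt_trans Hi.
have [e2 e20 He2] : exists2 e, (0 < e)%R & forall v, (A `*` A) v -> P2 v e.
  apply: exists_common_small => [|vv e e' H _|vv _]; [exact: finite_setX|exact: P2d|].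
  have [vv12|vv12] := pselect (vv.1 = vv.2); first by exists 1%R.
  have [i Hi] : exists i, vv.1 i != vv.2 i.
    apply: contrapT => /forallNP h; apply: vv12; apply/funext => i.
    by apply/eqP/negPn/negP; exact: h.
  exists (mdist (vv.1 i) (vv.2 i) / 2)%R; first by rewrite divr_gt0 // mdist_gt0.
  move=> _; exists i; rewrite ltr_pdivrMr // ltr_pMr ?mdist_gt0 //.
  by rewrite ltr1n.
pose e := Num.min e1 e2.
have e0 : (0 < e)%R by rewrite lt_min e10.
have {}He1 v : A v -> P1 v e by move=> /He1 /P1d; apply => //; rewrite ge_min lexx.
have {}He2 v w : A v -> A w -> P2 (v, w) e.
  by move=> Av Aw; apply: P2d (He2 (v, w) _) _; [|rewrite ge_min lexx orbT].
exists e => // Y [C [CP CD CM CX CY]].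
pose h x := xget (ps_root Y) (C x).
have Ch v i : A v -> C (v i) (h (v i)).
  by move=> /He1 [_ _ /(_ i) /CX [y xy]]; exact: xgetI xy.
apply: (lt_le_trans cA); apply: esum_ge.
pose hh (v : 'I_N -> ps_space X) i := h (v i).
have hinj : set_inj A hh.
  move=> v w /set_mem Av /set_mem Aw vw; apply: contrapT => /(He2 v w Av Aw)[i /= ei].
  have := CD _ _ _ _ (Ch v i Av) (Ch w i Aw).
  have -> : h (v i) = h (w i) by exact: (congr1 (fun f => f i) vw).
  by rewrite mdistxx subr0 ger0_norm ?mdist_ge0 // leNgt ei.
exists (hh @` A); first by split => //; exact: finite_image.
rewrite fsbig_image //; apply: lee_fsum => // v Av.
rewrite lee_fin !indicE; have [/set_mem Uv|] := boolP (_ \in _); last by rewrite ler0n.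
rewrite mem_set //; have [_ + _] := He1 _ Av; apply => //.
exists C; split => //.
- apply: extend_pointP => i; first by rewrite !ps_extend_old.
  by rewrite !ps_extend_new; exact: Ch.
- by move=> x; rewrite ps_root_extend => /CX.
- by move=> y; rewrite ps_root_extend => /CY.
Qed.

Lemma ps_measurable_lte n k (f g : pspace R n k -> \bar R) :
  ps_measurable f -> ps_measurable g -> ps_measurable (fun X => f X < g X).
Proof. by apply: ps_measurable_lift2 => u v; exact: measurable_fun_lte. Qed.

Lemma ps_measurable_lee n k (f g : pspace R n k -> \bar R) :
  ps_measurable f -> ps_measurable g -> ps_measurable (fun X => f X <= g X).
Proof. by apply: ps_measurable_lift2 => u v; exact: measurable_fun_lee. Qed.

Section kernel.
Context (n k N : nat).

(* The tuples v are counted with the classes of their extensions; only those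
   inside a ball around the root are finitely many. *)
Definition tuple_kernel (X : pspace R n k) : {measure set (pclass R (n + N) k) -> \bar R} :=
  image_counting R (@countable_tuples R (ps_space X) N) (fun v => to_class (ps_extend v)).

(** The inequality is strict so that the condition is open. *)
Definition new_within (r : R) (Z : pspace R (n + N) k) : bool :=
  [forall i : 'I_N, ps_dist (oldpt N ord0) (newpt n i) Z < r]%R.

Lemma tuple_kernelE X U : tuple_kernel X U = ps_sum (fun Z => (\1_U (to_class Z))%:E) X.
Proof. exact: image_countingE. Qed.

Lemma new_within_iso r : iso_invariant (new_within r).
Proof.
by move=> Y Z YZ; apply: eq_forallb => i; congr (_ < _)%R; exact: (@ps_measurable_dist R _ k _ _).1.
Qed.

Lemma open_new_within r : GH_open [set z | new_within r (repr z)].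
Proof.
apply/GH_openP => X /=.
have nwi := @new_within_iso r.
rewrite (nwi _ _ (repr_to_class X)) => /forallP XU.
have [e e0 He] : exists2 e, (0 < e)%R & forall i : 'I_N, [set: 'I_N] i ->
    (ps_dist (oldpt N ord0) (newpt n i) X + e < r)%R.
  apply: exists_common_small => [|i e e' h _ e'e|i _].
  - exact: finite_finset.
  - by apply: le_lt_trans h; rewrite lerD2l.
  - have := XU i; rewrite -subr_gt0 => h; exists ((r - ps_dist (oldpt N ord0) (newpt n i) X) / 2)%R.
      by rewrite divr_gt0.
    by move: h; lra.
exists e => // Y [C [CP CD _ _ _]].
rewrite (nwi _ _ (repr_to_class Y)); apply/forallP => i.
have := He i Logic.I; have := CD _ _ _ _ (CP (oldpt N ord0)) (CP (newpt n i)).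
rewrite -/(ps_dist _ _ X) -/(ps_dist _ _ Y) ler_norml; lra.
Qed.

Lemma tuple_kernel_within_fin r X : tuple_kernel X [set z | new_within r (repr z)] < +oo.
Proof.
rewrite tuple_kernelE /ps_sum.
pose S := [set v : 'I_N -> ps_space X | forall i, [set u | (mdist (ps_root X) u <= r)%R] (v i)].
have Sfin : finite_set S by apply: finite_tuples; exact: finite_closed_ball.
apply: (@le_lt_trans _ _ (\esum_(v in S) 1)).
  rewrite [leRHS]esum_mkcond; apply: le_esum => v _.
  rewrite indicE; case: ifPn => [_|vS]; first by case: (_ \in _).
  rewrite memNset // => /= vr; move/negP: vS; apply; rewrite mem_set // => i /=.
  move: vr; rewrite (@new_within_iso r _ _ (repr_to_class _)) => /forallP/(_ i).
  by rewrite /ps_dist ps_extend_new ps_extend_old => /ltW.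
rewrite esum_fset // fsbig_finite //=.
by rewrite lte_sum_pinfty // => i _; rewrite ltry.
Qed.

(** Dynkin induction from the open sets, where [ps_sum_open] applies. The complement step subtracts
    measures, hence needs them finite: the induction runs inside [B r], and [r] then tends to
    infinity along the integers. *)
Lemma measurable_tuple_kernel U : measurable U ->
  measurable_fun [set: pclass R n k] (fun x : pclass R n k => tuple_kernel (repr x) U).
Proof.
move=> mU.
pose B r : set (pclass R (n + N) k) := [set z | new_within r (repr z)].
have oB r : GH_open (B r) := @open_new_within r.
have mB r : measurable (B r) by exact: measurable_GH.
have mo V : GH_open V -> measurable_fun [set: pclass R n k]
    (fun x : pclass R n k => tuple_kernel (repr x) V).
  by move=> oV; under eq_fun do rewrite tuple_kernelE; exact: (ps_sum_open oV).2.
have mV r V : measurable V -> measurable_fun [set: pclass R n k]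
    (fun x : pclass R n k => tuple_kernel (repr x) (V `&` B r)).
  move: V; apply: (@dynkin_induction _ _ (@GH_open R (n + N) k)) => //.
  - exact: GH_open_setI.
  - by rewrite setTI; exact: mo.
  - by move=> V oV; apply: mo; exact: GH_open_setI.
  - move=> V mV mVB.
    under eq_fun => x.
      rewrite setIC -setDE measureD ?tuple_kernel_within_fin //.
      rewrite [X in _ - _ X](setIC (B r)); over.
    by apply: emeasurable_funB => //; exact: mo.
  - move=> F mF tF mFB.
    under eq_fun => x.
      rewrite setI_bigcupl measure_semi_bigcup; [|by move=> i; exact: measurableI|exact: trivIset_setIr|]; last first.
        by apply: bigcupT_measurable => i; exact: measurableI.
      over.
    by apply: ge0_emeasurable_sum => // i _; exact: mFB.
apply: (@emeasurable_fun_cvg _ _ _ _ (fun (j : nat) (x : pclass R n k) =>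
    tuple_kernel (repr x) (U `&` B j%:R))) => [j|x _].
  exact: mV.
have UE : U = \bigcup_j (U `&` B j%:R).
  apply/seteqP; split=> [z Uz|z [j _ []] //].
  pose M := (\max_(i < N) (Num.truncn (ps_dist (oldpt N ord0) (newpt n i) (repr z))).+1)%N.
  exists M => //; split => //; apply/forallP => i.
  apply: (@lt_le_trans _ _ ((Num.truncn (ps_dist (oldpt N ord0) (newpt n i) (repr z))).+1%:R)).
    exact: truncnS_gt.
  by rewrite ler_nat /M (bigD1 i) //= leq_maxl.
rewrite [X in _ --> tuple_kernel _ X]UE.
apply: nondecreasing_cvg_mu => [j||i j ij].
- exact: measurableI.
- by rewrite -UE.
- apply/subsetPset => z [Uz /forallP zi]; split => //; apply/forallP => l.
  by apply: lt_le_trans (zi l) _; rewrite ler_nat.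
Qed.

End kernel.

(** The sum is the integral of [G] against [tuple_kernel], which depends measurably on the space. *)
Lemma ps_measurable_sum n k N (G : pspace R (n + N) k -> \bar R) :
  (forall Z, 0 <= G Z) -> ps_measurable G -> ps_measurable (ps_sum G).
Proof.
move=> G0 mG; split; first exact: ps_sum_iso mG.1.
rewrite (_ : (fun x => _) =
    fun x : pclass R n k => \int[tuple_kernel N (repr x)]_z G (repr z)).
  apply: measurable_fun_integral_kernel => //; last exact: mG.2.
  by move=> U mU; exact: measurable_tuple_kernel.
apply/funext => x; rewrite integral_image_counting //; last exact: mG.2.
by apply: eq_esum => v _; rewrite ps_measurable_repr.
Qed.

(** Existence of a tuple means that the sum of an indicator is positive. *)
Lemma ps_measurable_exists n k N (P : pspace R (n + N) k -> bool) :
  ps_measurable P ->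
  ps_measurable (fun X : pspace R n k => `[< exists v : 'I_N -> ps_space X, P (ps_extend v) >]).
Proof.
move=> mP.
pose G Z : \bar R := if P Z then 1 else 0.
have G0 Z : 0 <= G Z by rewrite /G; case: ifP.
have mG : ps_measurable G by apply: ps_measurable_if => //; exact: ps_measurable_cst.
apply: (@ps_measurable_eq _ _ _ _ _ (fun X => 0 < ps_sum G X)); last first.
  by apply: ps_measurable_lte; [exact: ps_measurable_cst|exact: ps_measurable_sum].
move=> X; apply/idP/asboolP => [|[v Pv]].
  rewrite ltNge => /negP h; apply: contrapT => /forallNP nP; apply: h.
  by rewrite /ps_sum esum1 // => v _; rewrite /G; case: ifP => // /nP.
apply: (@lt_le_trans _ _ 1) => //; apply: esum_ge; exists [set v].
  by split => //; exact: finite_set1.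
by rewrite fsbig_set1 /G Pv.
Qed.

Lemma ps_measurable_forall n k N (P : pspace R (n + N) k -> bool) :
  ps_measurable P ->
  ps_measurable (fun X : pspace R n k => `[< forall v : 'I_N -> ps_space X, P (ps_extend v) >]).
Proof.
move=> mP.
apply: (@ps_measurable_eq _ _ _ _ _ (fun X =>
    ~~ `[< exists v : 'I_N -> ps_space X, ~~ P (ps_extend v) >])).
  move=> X; rewrite -asbool_neg; apply: asbool_equiv_eq.
  by split=> [h v|h [v /negP]]; [apply: contrapT => /negP nP; apply: h; exists v|exact].
apply/ps_measurable_neg/(@ps_measurable_exists _ _ _ (fun Z => ~~ P Z)).
exact: ps_measurable_neg.
Qed.

End summation.

(** * A countable base of the Gromov-Hausdorff topology *)

Section patterns.
Variable R : realType.
Implicit Types n k N : nat.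

(** All distances and marks are given up to [l.+1%:R^-1]. The last two clauses place the new points
    in the ball of radius [l.+1] about the root and make the listed points exhaust it, so that a
    match controls everything in that ball. *)
Definition ps_matches n k N (dq : {ffun 'I_(n + N).+1 * 'I_(n + N).+1 -> rat})
    (mq : {ffun 'I_k * 'I_(n + N).+1 -> rat}) (l : nat) (Z : pspace R (n + N) k) : bool :=
  [&& [forall i, [forall j, `|ps_dist i j Z - ratr (dq (i, j))| < l.+1%:R^-1]],
      [forall j, [forall i, `|ps_label j i Z - ratr (mq (j, i))| < l.+1%:R^-1]],
      [forall i : 'I_N, ps_dist (oldpt N ord0) (newpt n i) Z <= l.+1%:R] &
      `[< forall v : 'I_1 -> ps_space Z,
            mdist (ps_root Z) (v ord0) <= l.+1%:R -> exists i, v ord0 = ps_point Z i >] ].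

Definition ps_pattern n k := {N : nat &
  ({ffun 'I_(n + N).+1 * 'I_(n + N).+1 -> rat} *
   {ffun 'I_k * 'I_(n + N).+1 -> rat} * nat)%type}.

Definition has_pattern n k (q : ps_pattern n k) (X : pspace R n k) : bool :=
  `[< exists v : 'I_(projT1 q) -> ps_space X,
        ps_matches (projT2 q).1.1 (projT2 q).1.2 (projT2 q).2 (ps_extend v) >].

Lemma ratr_approx (x e : R) : 0 < e -> {q : rat | `|x - ratr q| < e}.
Proof.
move=> e0; apply/cid.
have [|q] := @rat_in_itvoo R (x - e) (x + e); first by lra.
by rewrite in_itv/= => /andP[h1 h2]; exists q; rewrite ltr_norml; lra.
Qed.

(** List the ball of radius [l.+1] of [X] and approximate its data by rationals. Any space with the
    same pattern is in correspondence with [X] by matching equal indices. *)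
Lemma GH_open_pattern n k (U : set (pclass R n k)) (X : pspace R n k) :
  GH_open U -> U (to_class X) -> exists2 q : ps_pattern n k, has_pattern q X &
    forall Y, has_pattern q Y -> U (to_class Y).
Proof.
move=> oU UX; have [e e0 He] := (GH_openP U).1 oU _ UX.
(* Two spaces close to the same rational data differ by at most [2 * l.+1%:R^-1], which must be
   below [e]; the choice also gives [e^-1 <= l.+1%:R], so the exhausted ball is large enough. *)
pose l := Num.truncn (2 / e).
have le : 2 / e < l.+1%:R by exact: truncnS_gt.
have l0 : 0 < l.+1%:R :> R by rewrite ltr0n.
have li0 : 0 < l.+1%:R^-1 :> R by rewrite invr_gt0.
have l2 : 2 * l.+1%:R^-1 <= e.
  by move: le; rewrite ltr_pdivrMr // => le; rewrite -ler_pdivlMr ?invr_gt0 // invrK mulrC ltW.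
have el : e^-1 <= l.+1%:R.
  have ei : 0 < e^-1 by rewrite invr_gt0.
  by lra.
have /finite_seqP[s sE] := @finite_closed_ball R (ps_space X) (ps_root X) l.+1%:R.
have sP x : (x \in s) = (mdist (ps_root X) x <= l.+1%:R).
  by apply/idP/idP => [xs|xs]; [have : [set` s] x by []; rewrite -sE|have : [set` s] x by rewrite -sE].
pose v (i : 'I_(size s)) := tnth (in_tuple s) i.
pose Z := ps_extend v.
pose dq := [ffun ij : 'I_(n + size s).+1 * 'I_(n + size s).+1 => sval (ratr_approx (ps_dist ij.1 ij.2 Z) li0)].
pose mq := [ffun ji : 'I_k * 'I_(n + size s).+1 => sval (ratr_approx (ps_label ji.1 ji.2 Z) li0)].
exists (existT _ (size s) (dq, mq, l)).
  apply/asboolP; exists v; change (ps_matches dq mq l Z); apply/and4P; split.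
  - apply/forallP => i; apply/forallP => j; rewrite /dq ffunE.
    by case: ratr_approx.
  - apply/forallP => i; apply/forallP => j; rewrite /mq ffunE.
    by case: ratr_approx.
  - apply/forallP => i; rewrite /ps_dist ps_extend_old ps_extend_new.
    by rewrite -[ps_point X ord0]/(ps_root X) -sP; exact: mem_tnth.
  - apply/asboolP => w; rewrite ps_root_extend -sP => /(nthP (w ord0))[i si wi].
    exists (newpt n (Ordinal si)); rewrite ps_extend_new /v (tnth_nth (w ord0)) /=.
    by [].
move=> Y /asboolP[/= u /and4P[/forallP dY /forallP mY bY /asboolP rY]]; apply: He.
exists (fun x y => exists i, x = ps_point Z i /\ y = ps_point (ps_extend u) i); split.
- by move=> i; exists (oldpt _ i); rewrite !ps_extend_old.
- move=> _ _ _ _ [i [-> ->]] [j [-> ->]].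
  have := (forallP (dY i)) j; rewrite /dq ffunE; case: ratr_approx => /= q.
  rewrite -/(ps_dist i j Z) -/(ps_dist i j (ps_extend u)) => h1 h2.
  have -> : ps_dist i j Z - ps_dist i j (ps_extend u) = (ps_dist i j Z - ratr q) - (ps_dist i j (ps_extend u) - ratr q) by lra.
  apply: (le_trans (ler_normB _ _)); apply: le_trans l2.
  by rewrite mulr_natl mulr2n; apply: lerD; exact: ltW.
- move=> j _ _ [i [-> ->]].
  have := (forallP (mY j)) i; rewrite /mq ffunE; case: ratr_approx => /= q.
  rewrite -/(ps_label j i Z) -/(ps_label j i (ps_extend u)) => h1 h2.
  have -> : ps_label j i Z - ps_label j i (ps_extend u) = (ps_label j i Z - ratr q) - (ps_label j i (ps_extend u) - ratr q) by lra.
  apply: (le_trans (ler_normB _ _)); apply: le_trans l2.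
  by rewrite mulr_natl mulr2n; apply: lerD; exact: ltW.
- move=> x /le_trans/(_ el); rewrite -sP => /(nthP x)[i si xi].
  exists (u (Ordinal si)), (newpt n (Ordinal si)); rewrite !ps_extend_new /v (tnth_nth x) /=.
  by [].
- move=> y /le_trans/(_ el) yl.
  have [|i yi] := rY (fun=> y); first by rewrite ps_root_extend.
  by exists (ps_point Z i), i.
Qed.

(** By [GH_open_pattern] an open set is the union of the pattern sets that it contains, and there
    are only countably many patterns. *)
Lemma measurable_fun_pattern n k d (T : measurableType d) (f : T -> pclass R n k) :
  (forall q, measurable [set t | has_pattern q (repr (f t))]) ->
  measurable_fun setT f.
Proof.
move=> mf; apply: measurability => // _ [U oU <-]; rewrite setTI.
pose Q := [set q : ps_pattern n k | forall Y, has_pattern q Y -> U (to_class Y)].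
rewrite (_ : f @^-1` U = \bigcup_(q in Q) [set t | has_pattern q (repr (f t))]).
  rewrite bigcup_mkcond; apply: countable_bigcupT_measurable => [|q]; first exact: countableP.
  by case: ifP.
apply/seteqP; split=> [t /= Ut|t [q Qq /= tq]]; last first.
  by rewrite -(to_class_repr (f t)); exact: Qq.
rewrite -(to_class_repr (f t)) in Ut.
by have [q qt qU] := GH_open_pattern oU Ut; exists q.
Qed.

Lemma measurable_dist_cst d (T : measurableType d) (f : T -> R) (q : R) :
  measurable_fun setT f -> measurable_fun setT (fun t => `|f t - q|).
Proof.
move=> mf; apply: (@measurableT_comp _ _ _ _ _ _ (fun x : R => `|x|)).
  exact: normr_measurable.
exact: measurable_funB.
Qed.

(** A pattern reads the marks at the listed points only, so arbitrary new marks [M] are allowed as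
    soon as these finitely many values are measurable. *)
Lemma ps_matches_map n k n' k' N (st : 'I_(n + N).+1 -> 'I_n'.+1)
    (M : forall Z : pspace R n' k', 'I_k -> ps_space Z -> R) dq mq l :
  (forall j i, ps_measurable (fun Z => M Z j (ps_point Z (st i)))) ->
  ps_measurable (fun Z => @ps_matches n k N dq mq l
    (PSpace (ps_space Z) (fun i => ps_point Z (st i)) (M Z))).
Proof.
move=> mM.
have md i j := @ps_measurable_dist R _ k' (i : 'I_n'.+1) j.
have mabs (f : pspace R n' k' -> R) (q c : R) : ps_measurable f ->
    ps_measurable (fun Z => `|f Z - q| < c).
  move=> mf; apply: ps_measurable_lt; last exact: ps_measurable_cst.
  apply: (ps_measurable_comp (g := fun x : R => `|x - q|)) mf.
  by apply: (@measurable_dist_cst _ _ (fun x : R => x)).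
apply: ps_measurable_and.
  apply: ps_measurable_forallb => i; apply: ps_measurable_forallb => j.
  by apply: mabs; exact: (md (st i) (st j)).
apply: ps_measurable_and.
  by apply: ps_measurable_forallb => j; apply: ps_measurable_forallb => i; apply: mabs; exact: mM.
apply: ps_measurable_and.
  apply: ps_measurable_forallb => i; apply: ps_measurable_le; first exact: (md (st _) (st _)).
  exact: ps_measurable_cst.
(* The exhaustion clause in terms of distances to one further point; a distance [<= 0] stands for
   equality of points. *)
pose P (Z : pspace R (n' + 1) k') :=
   (l.+1%:R < ps_dist (oldpt 1 (st ord0)) (newpt n' ord0) Z) ||
   [exists i, ps_dist (oldpt 1 (st i)) (newpt n' ord0) Z <= 0].
apply: (@ps_measurable_eq _ _ _ _ _ (fun Z => `[< forall v : 'I_1 -> ps_space Z, P (ps_extend v) >])).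
  move=> Z; apply: asbool_equiv_eq; split=> h v.
    move=> vl; have /orP[|/existsP[i]] := h v; rewrite /ps_dist ps_extend_new ps_extend_old.
      by rewrite ltNge => /negP[].
    by move=> h0; exists i; apply/esym/mdist_positivity/le_anti; rewrite h0 mdist_ge0.
  rewrite /P /ps_dist ps_extend_new ps_extend_old ltNge; case: (boolP (_ <= _)) => // vl.
  have [i vi] := h v vl; apply/existsP; exists i.
  by rewrite ps_extend_old vi mdistxx.
apply: ps_measurable_forall; apply: ps_measurable_or.
  by apply: ps_measurable_lt; [exact: ps_measurable_cst|exact: ps_measurable_dist].
apply: ps_measurable_existsb => i.
by apply: ps_measurable_le; [exact: ps_measurable_dist|exact: ps_measurable_cst].
Qed.

Lemma ps_matches_measurable n k N dq mq l : ps_measurable (@ps_matches n k N dq mq l).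
Proof.
have := @ps_matches_map n k (n + N) k N id (fun Z => ps_mark Z) dq mq l
  (fun j i => @ps_measurable_label R _ _ j i).
by apply: ps_measurable_eq => -[].
Qed.

Lemma has_pattern_measurable n k (q : ps_pattern n k) : ps_measurable (has_pattern q).
Proof. by apply: ps_measurable_exists; exact: ps_matches_measurable. Qed.

Definition ps_remark n k m k' (s : 'I_m.+1 -> 'I_n.+1)
    (rho : 'I_k' -> pspace R (n + 1) k -> R) (X : pspace R n k) : pspace R m k' :=
  PSpace (ps_space X) (fun i => ps_point X (s i))
    (fun j x => rho j (ps_extend (fun _ : 'I_1 => x))).

(** The new marks are merely measurable in the space, so preimages of open sets need not be open.
    Patterns reduce the question to the marks at finitely many points. *)
Lemma ps_measurable_remark n k m k' (s : 'I_m.+1 -> 'I_n.+1)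
    (rho : 'I_k' -> pspace R (n + 1) k -> R) :
  (forall j, ps_measurable (rho j)) ->
  ps_measurable (fun X => to_class (ps_remark s rho X)).
Proof.
move=> mrho; have rmi X Y : ps_isometric X Y -> ps_isometric (ps_remark s rho X) (ps_remark s rho Y).
  move=> [f [fi fP fM]]; exists f; split => //= j x.
  by apply: (mrho j).1; apply: ps_isometric_sym; exact: ps_extend_iso.
split=> [X Y XY|]; first by apply/to_classP; exact: rmi.
apply: measurable_fun_pattern => q.
suff mq : ps_measurable (fun X => has_pattern q (ps_remark s rho X)).
  have [qi mq'] := (ps_measurable_boolP _).1 mq.
  rewrite (_ : mkset _ = [set x | has_pattern q (ps_remark s rho (repr x))]) //.
  apply/seteqP; split=> x /=; rewrite ((has_pattern_measurable q).1 _ _ (repr_to_class _)) //.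
case: q => N [[dq mq] l]; rewrite /has_pattern /=.
pose st (i : 'I_(m + N).+1) : 'I_(n + N).+1 :=
  match fintype.split (i : 'I_(m.+1 + N)) with inl a => oldpt N (s a) | inr b => newpt n b end.
(* [tau] forgets the [N] auxiliary points: the new mark of [x] depends on the original points and on
   [x] alone. *)
pose tau (i : 'I_(n + 1).+1) : 'I_(n + N + 1).+1 :=
  match fintype.split (i : 'I_(n.+1 + 1)) with inl a => oldpt 1 (oldpt N a) | inr b => newpt (n + N) b end.
pose P (Z : pspace R (n + N) k) : bool :=
  ps_matches dq mq l (PSpace (ps_space Z) (fun i => ps_point Z (st i))
    (fun j x => rho j (ps_select tau (ps_extend (fun _ : 'I_1 => x))))).
have PE X v : ps_matches dq mq l (ps_extend (v : 'I_N -> ps_space (ps_remark s rho X)))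
   = P (@ps_extend R n k N X v).
  rewrite /P; congr (ps_matches dq mq l); rewrite {1}/ps_extend /ps_remark /=; congr PSpace.
    apply/funext => i; rewrite /st; case: (fintype.split (i : 'I_(m.+1 + N))) => a.
      by rewrite (unsplitK (inl (s a))).
    by rewrite (unsplitK (inr a)).
  apply/funext => j; apply/funext => x; congr (rho j).
  rewrite /ps_select /ps_extend /=; congr PSpace.
  apply/funext => i; rewrite /tau; case: (fintype.split (i : 'I_(n.+1 + 1))) => a.
    by rewrite (unsplitK (inl (oldpt N a))) (unsplitK (inl a)).
  by rewrite (unsplitK (inr a)).
have mP : ps_measurable P.
  apply: (@ps_matches_map _ _ _ _ N st (fun Z j x => rho j (ps_select tau (ps_extend (fun _ : 'I_1 => x))))).
  move=> j i.
  pose tau' (a : 'I_(n + 1).+1) : 'I_(n + N).+1 :=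
    match fintype.split (a : 'I_(n.+1 + 1)) with inl a => oldpt N a | inr b => st i end.
  apply: (@ps_measurable_eq _ _ _ _ _ (fun Z => rho j (ps_select tau' Z))).
    move=> Z; congr (rho j); rewrite /ps_select /=; congr PSpace; apply/funext => a.
    rewrite /tau /tau'; case: (fintype.split (a : 'I_(n.+1 + 1))) => b.
      by rewrite (unsplitK (inl (oldpt N b))).
    by rewrite (unsplitK (inr b)).
  apply: ps_measurable_map => //; exact: ps_measurable_select.
apply: (@ps_measurable_eq _ _ _ _ _ (fun X => `[< exists v : 'I_N -> ps_space X, P (ps_extend v) >])).
  move=> X; apply: asbool_equiv_eq.
  by split=> -[v Pv]; exists v; [rewrite PE|rewrite -PE].
exact: ps_measurable_exists.
Qed.

(** With the space fixed, a pattern depends on [t] through the marks of a finite tuple, and the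
    candidate tuples are countably many. *)
Lemma measurable_random_marks n k (D : discrete_space R) (p : 'I_n.+1 -> D)
    d (T : measurableType d) (m : T -> 'I_k -> D -> R) :
  (forall j v, measurable_fun setT (fun t => m t j v)) ->
  measurable_fun setT (fun t => to_class (PSpace D p (m t))).
Proof.
move=> mm; apply: measurable_fun_pattern => q.
rewrite (_ : mkset _ = [set t | has_pattern q (PSpace D p (m t))]); last first.
  by apply/seteqP; split=> t /=; rewrite ((has_pattern_measurable q).1 _ _ (repr_to_class _)).
case: q => N [[dq mq] l]; rewrite /has_pattern /=.
rewrite (_ : mkset _ = \bigcup_(v : 'I_N -> D)
    [set t | ps_matches dq mq l (@ps_extend R n k N (PSpace D p (m t)) v)]); last first.
  by apply/seteqP; split=> t /= => [/asboolP[v Pv]|[v _ Pv]]; [exists v|apply/asboolP; exists v].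
apply: countable_bigcupT_measurable => [|v]; first exact: countable_tuples.
pose X0 := @ps_extend R n k N (PSpace D p (fun _ _ => 0)) v.
pose b := [&& [forall i, [forall j, `|ps_dist i j X0 - ratr (dq (i, j))| < l.+1%:R^-1]],
      [forall i : 'I_N, ps_dist (oldpt N ord0) (newpt n i) X0 <= l.+1%:R] &
      `[< forall v : 'I_1 -> ps_space X0,
            mdist (ps_root X0) (v ord0) <= l.+1%:R -> exists i, v ord0 = ps_point X0 i >] ].
rewrite (_ : mkset _ = [set t | b] `&` \bigcap_(j in [set: 'I_k]) \bigcap_(i in [set: 'I_(n + N).+1])
    [set t | `|m t j (ps_point X0 i) - ratr (mq (j, i))| < l.+1%:R^-1]).
  apply: measurableI.
    case: b; first by rewrite (_ : mkset _ = setT) //; apply/seteqP; split.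
    by rewrite (_ : mkset _ = set0) //; apply/seteqP; split.
  apply: fin_bigcap_measurable => // j _; apply: fin_bigcap_measurable => // i _.
  rewrite -[X in measurable X]setTI.
  have mlt : measurable_fun setT (fun t => `|m t j (ps_point X0 i) - ratr (mq (j, i))| < l.+1%:R^-1).
    by apply: measurable_fun_ltr => //; apply: measurable_dist_cst; exact: mm.
  exact: (mlt measurableT [set true]).
apply/seteqP; split=> t /=.
  move=> /and4P[h1 /forallP h2 h3 h4]; split; first by apply/and3P.
  by move=> j _ i _; exact: (forallP (h2 j) i).
move=> [/and3P[h1 h3 h4] h2]; apply/and4P; split => //.
by apply/forallP => j; apply/forallP => i; exact: h2.
Qed.

End patterns.

(** * Laws of equivariant processes and mass transport *)

Section laws.
Variable R : realType.
Implicit Types (Z : equivariant_process R).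
Local Open Scope ereal_scope.

Lemma measurable_pt1m Z (D : discrete_space R) (v : D) :
  measurable_fun [set: ep_sample Z D] (fun s => pt1m v (ep_val s)).
Proof.
apply: (@measurable_random_marks _ _ _ D (fun=> v) _ _ (fun s _ => ep_val s)) => _ u.
exact: ep_measurable.
Qed.

Definition ep_law Z (X : pspace R 0 0) : {measure set (pclass R 0 1) -> \bar R} :=
  measure_function_pushforward__canonical__measure_function_Measure
    (ep_prob Z (ps_space X)) (@measurable_pt1m Z (ps_space X) (ps_root X)).

(** Equivariance is assumed for events of the product sigma-algebra on markings.
    [measurable_random_marks], applied to the identity of the space of markings, shows that [A]
    pulls back to such an event. *)
Lemma ep_law_iso Z A : measurable A -> iso_invariant (fun X => ep_law Z X A).
Proof.
move=> mA X Y [rho [rhoi rhoP _]]; rewrite /ep_law /= /pushforward.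
pose G := \bigcup_(v in [set: ps_space X])
        preimage_set_system [set: ps_space X -> R] (fun m => m v) (@measurable _ (measurableTypeR R)).
have mB : marking_measurable [set m | A (pt1m (ps_root X) m)].
  have := @measurable_random_marks R 0 1 (ps_space X) (fun=> ps_root X) _ (g_sigma_algebraType G)
    (fun m _ => m).
  move=> /(_ _ measurableT A mA); rewrite setTI; apply => _ v.
  move=> _ B mB; apply: sub_gen_smallest; exists v => //.
  by exists B.
transitivity (ep_prob Z (ps_space Y) [set s | [set m | A (pt1m (ps_root X) m)] (ep_val s \o rho)]).
  exact/esym/(@ep_equivariant R Z _ _ _ rhoi _ mB).
congr (ep_prob _ _ _); apply/seteqP.
have E s : pt1m (ps_root X) (ep_val s \o rho) = pt1m (ps_root Y) (@ep_val R Z _ s).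
  by apply/to_classP; exists rho; split => // i; exact: rhoP.
by split=> s /=; rewrite E.
Qed.

Definition marked (D : discrete_space R) (v : D) (m : D -> R) : pspace R 0 1 :=
  PSpace D (fun=> v) (fun=> m).

(** The conditional expectation of [F] given the unmarked pointed space. *)
Definition ep_int Z (F : pspace R 0 1 -> \bar R) (X : pspace R 0 0) : \bar R :=
  \int[ep_prob Z (ps_space X)]_s F (marked (ps_root X) (ep_val s)).

Lemma measurable_marked Z (D : discrete_space R) (v : D) d (T : measurableType d)
    (F : pspace R 0 1 -> T) : ps_measurable F ->
  measurable_fun [set: ep_sample Z D] (fun s => F (marked v (ep_val s))).
Proof.
move=> mF; rewrite (_ : (fun s => _) = (fun x => F (repr x)) \o (fun s => pt1m v (@ep_val R Z D s))).
  by apply: measurableT_comp; [exact: mF.2|exact: measurable_pt1m].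
by apply/funext => s /=; rewrite ps_measurable_repr.
Qed.

Lemma ep_intE Z F X : (forall Y, 0 <= F Y) -> ps_measurable F ->
  \int[ep_law Z X]_y F (repr y) = ep_int Z F X.
Proof.
move=> F0 mF; rewrite ge0_integral_pushforward //; [|exact: measurable_pt1m|exact: mF.2].
by rewrite preimage_setT; apply: eq_integral => s _ /=; rewrite ps_measurable_repr.
Qed.

Lemma ps_measurable_ep_int Z F : (forall Y, 0 <= F Y) -> ps_measurable F ->
  ps_measurable (ep_int Z F).
Proof.
move=> F0 mF; split.
  move=> X Y XY; rewrite -!ep_intE //; apply: eq_measure_integral => A mA _.
  exact: ep_law_iso.
under eq_fun do rewrite -ep_intE //.
apply: measurable_fun_integral_kernel => //; last exact: mF.2.
move=> U mU; exact: ep_measurable_law.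
Qed.

Lemma ep_int_ge0 Z F X : (forall Y, 0 <= F Y) -> 0 <= ep_int Z F X.
Proof. by move=> F0; apply: integral_ge0. Qed.

Definition unmarked (D : discrete_space R) (v : D) : pspace R 0 0 :=
  PSpace D (fun=> v) (fun _ _ => 0%R).

Definition unmarked2 (D : discrete_space R) (u v : D) : pspace R 1 0 :=
  PSpace D (fun i => if i == ord0 then u else v) (fun _ _ => 0%R).

Lemma unmarked_root (X : pspace R 0 0) : ps_isometric (unmarked (ps_root X)) X.
Proof.
exists id; split => [|i|[]] //; first by split=> //; exists id.
by rewrite /= (ord1 i).
Qed.

Lemma ps_extend1_unmarked2 (X : pspace R 0 0) (v : ps_space X) :
  ps_isometric (ps_extend (fun _ : 'I_1 => v)) (unmarked2 (ps_root X) v).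
Proof.
exists id; split => [|i|[]] //; first by split=> //; exists id.
rewrite -[LHS]/(ps_point (ps_extend (fun _ : 'I_1 => v)) i).
move: i; apply: extend_pointP => i.
  by rewrite ps_extend_old (ord1 i).
by rewrite ps_extend_new.
Qed.

Lemma ps_sum1 n k (G : pspace R (n + 1) k -> \bar R) X :
  ps_sum G X = \esum_(v in [set: ps_space X]) G (ps_extend (fun _ : 'I_1 => v)).
Proof.
rewrite /ps_sum (@reindex_esum R _ _ [set: ps_space X] _ (fun v (_ : 'I_1) => v)) //.
split => // [u v _ _ uv|v _]; first exact: (congr1 (fun f => f ord0) uv).
by exists (v ord0) => //; apply/funext => i; rewrite (ord1 i).
Qed.

Lemma ps_measurable_sum1 n k (G : pspace R (n + 1) k -> \bar R) :
  (forall Y, 0 <= G Y) -> ps_measurable G ->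
  ps_measurable (fun X => \esum_(v in [set: ps_space X]) G (ps_extend (fun _ : 'I_1 => v))).
Proof.
move=> G0 mG; have := ps_measurable_sum G0 mG.
by apply: ps_measurable_eq => X; rewrite ps_sum1.
Qed.

Lemma ps_measurable_sum_unmarked2 (g : pspace R 1 0 -> \bar R) :
  (forall Y, 0 <= g Y) -> ps_measurable g ->
  ps_measurable (fun X : pspace R 0 0 => \esum_(v in [set: ps_space X]) g (unmarked2 (ps_root X) v)).
Proof.
move=> g0 mg; have := @ps_measurable_sum1 0 0 g g0 mg.
by apply: ps_measurable_eq => X; apply: eq_esum => v _; exact: mg.1 _ _ (ps_extend1_unmarked2 v).
Qed.

Definition swap2 (i : 'I_2) : 'I_2 := if i == ord0 then ord_max else ord0.

Lemma ps_measurable_sum_unmarked2_swap (g : pspace R 1 0 -> \bar R) :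
  (forall Y, 0 <= g Y) -> ps_measurable g ->
  ps_measurable (fun X : pspace R 0 0 => \esum_(v in [set: ps_space X]) g (unmarked2 v (ps_root X))).
Proof.
move=> g0 mg.
have mg' : ps_measurable (fun X => g (ps_select swap2 X)).
  by apply: ps_measurable_map => //; exact: ps_measurable_select.
have := ps_measurable_sum_unmarked2 (fun Y => g0 (ps_select swap2 Y)) mg'.
apply: ps_measurable_eq => X; apply: eq_esum => v _; congr g.
rewrite /ps_select /unmarked2 /=; congr PSpace; apply/funext => i.
by rewrite /swap2; case: (i == ord0).
Qed.

Section mass_transport.
Variables (mu : probability (pclass R 0 0) R) (muU : unimodular mu).

Lemma mass_transport (g : pspace R 1 0 -> \bar R) :
  (forall Y, 0 <= g Y) -> ps_measurable g ->
  \int[mu]_x (\esum_(v in [set: ps_space (repr x)]) g (unmarked2 (ps_root (repr x)) v)) =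
  \int[mu]_x (\esum_(v in [set: ps_space (repr x)]) g (unmarked2 v (ps_root (repr x)))).
Proof.
move=> g0 mg; have := muU mg.2 (fun x => g0 (repr x)).
under eq_integral => x _.
  under eq_esum => v _ do rewrite ps_measurable_repr //.
  over.
under [in RHS]eq_integral => x _.
  under eq_esum => v _ do rewrite ps_measurable_repr //.
  over.
by [].
Qed.

(* Everything that may happen somewhere may happen at the root. *)
Lemma ae_all_points (h : pspace R 0 0 -> \bar R) : (forall X, 0 <= h X) ->
  ps_measurable h -> \int[mu]_x h (repr x) = 0 ->
  {ae mu, forall x, forall v : ps_space (repr x), h (unmarked v) = 0}.
Proof.
move=> h0 mh hI.
have ae0 (f : pclass R 0 0 -> \bar R) : (forall x, 0 <= f x) -> measurable_fun setT f ->
    \int[mu]_x f x = 0 -> {ae mu, forall x, f x = 0}.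
  move=> f0 mf fI; have : \int[mu]_x `|f x| = 0.
    by rewrite -fI; apply: eq_integral => x _; rewrite gee0_abs.
  move/(ae_eq_integral_abs mu measurableT mf); apply: filterS => x; exact.
have mh1 : ps_measurable (fun Y : pspace R 1 0 => h (ps_select (fun _ : 'I_1 => ord_max) Y)).
  by apply: ps_measurable_map => //; exact: ps_measurable_select.
have sel2 (D : discrete_space R) (u v : D) :
    h (ps_select (fun _ : 'I_1 => ord_max) (unmarked2 u v)) = h (unmarked v) by [].
have mh1s := ps_measurable_sum_unmarked2_swap (fun Y => h0 _) mh1.
have mh1s' := ps_measurable_sum_unmarked2 (fun Y => h0 _) mh1.
(* Every point sends mass [h v] to every [v]. What the root receives is then a sum of copies of [h]
   at the root, almost surely 0, so what it sends vanishes almost surely as well. *)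
have h1I := mass_transport (fun Y => h0 _) mh1.
have rhs0 : \int[mu]_x (\esum_(v in [set: ps_space (repr x)]) h (ps_select (fun _ : 'I_1 => ord_max) (unmarked2 v (ps_root (repr x))))) = 0.
  rewrite (ae_eq_integral (cst 0)) ?integral0 //; first exact: mh1s.2.
  have := ae0 _ (fun x => h0 (repr x)) mh.2 hI; apply: filterS => x hx _ /=.
  by apply: esum1 => v _; rewrite sel2 (mh.1 _ _ (unmarked_root (repr x))) hx.
rewrite rhs0 in h1I; have := ae0 _ _ mh1s'.2 h1I.
move=> /(_ (fun x => esum_ge0 (fun v _ => h0 _))); apply: filterS => x hx v.
apply/eqP; rewrite eq_le h0 andbT -hx; apply: esum_ge; exists [set v].
  by split => //; exact: finite_set1.
by rewrite fsbig_set1.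
Qed.

End mass_transport.
End laws.

(** * Growth rates *)

Section growth.
Variable R : realType.
Implicit Types (f : R -> \bar R) (a C r : R).
Local Open Scope ereal_scope.

Lemma expR_mul_ln a r : (0 < r)%R -> expR (a * ln r) = (r `^ a)%R.
Proof. by move=> r0; rewrite mulrC expRM lnK. Qed.

Lemma upper_growth_lt f a : upper_growth f < a%:E ->
  exists2 r0 : R, (1 < r0)%R & forall r, (r0 <= r)%R -> f r <= (r `^ a)%:E.
Proof.
move=> /ereal_inf_lt[_ [V [M [_ MV]] <-] supV].
exists (Num.max M 1 + 1)%R; first by rewrite ltr_pwDr // le_max lexx orbT.
move=> r Mr; have [Mr' r1] : (M < r)%R /\ (1 < r)%R.
  have h1 : (M <= Num.max M 1)%R by rewrite le_max lexx.
  have h2 : (1 <= Num.max M 1)%R by rewrite le_max lexx orbT.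
  by split; lra.
have r0 : (0 < r)%R by rewrite (lt_trans _ r1).
have lr0 : (0 < ln r)%R by rewrite ln_gt0.
have : lne (f r) * ((ln r)^-1)%:E < a%:E.
  by apply: le_lt_trans supV; apply: ereal_sup_ubound; exists r => //; exact: MV.
rewrite lte_pdivrMr // => fr.
(* [expeR (lne x) = x] requires [x] nonnegative; negative values are below the power anyway. *)
have [fr0|fr0] := leP 0 (f r); last first.
  by rewrite (le_trans (ltW fr0)) // lee_fin powR_ge0.
have /eqP <- : expeR (lne (f r)) == f r by rewrite lneK_eq.
rewrite -expR_mul_ln //= -[leRHS]/(expeR (a * ln r)%:E) lee_expeR EFinM.
exact: ltW.
Qed.

Lemma upper_growth_le f a C (r0 : R) : (0 < C)%R ->
  (forall r, (r0 <= r)%R -> f r <= (C * r `^ a)%:E) -> upper_growth f <= a%:E.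
Proof.
move=> C0 fC; apply/lee_addgt0Pr => e e0.
(* Beyond [expR (ln C / e)] the constant [C] costs at most [e] in the exponent. *)
pose M := Num.max (Num.max r0 1%R) (expR (ln C / e)).
apply: ereal_inf_le; exists (ereal_sup ((fun r => lne (f r) * ((ln r)^-1)%:E) @` [set r | (M < r)%R])).
  by exists [set r | (M < r)%R] => //; exists M; split => //; exact: num_real.
apply: ge_ereal_sup => _ [r /= Mr <-].
have [[r0r r1] rC] : (((r0 <= r) /\ (1 < r)) /\ (expR (ln C / e) < r))%R.
  by move: Mr; rewrite /M !gt_max => /andP[/andP[h1 h2] h3]; rewrite ltW.
have rp : (0 < r)%R by rewrite (lt_trans _ r1).
have lr0 : (0 < ln r)%R by rewrite ln_gt0.
rewrite lee_pdivrMr // -EFinD -EFinM.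
have lC : (ln C <= e * ln r)%R.
  rewrite mulrC -ler_pdivrMr // -[leLHS]expRK ler_ln ?posrE ?expR_gt0 //; exact: ltW.
have [fr0|fr0] := leP (f r) 0; first by rewrite le0_lneNy // leNye.
apply: (@le_trans _ _ (lne (C * r `^ a)%:E)).
  rewrite lee_lne ?fC // ?in_itv /= ?leey ?andbT ?(ltW fr0) //.
  by rewrite lee_fin mulr_ge0 ?powR_ge0 // ltW.
rewrite lne_EFin ?mulr_gt0 ?powR_gt0 // lnM ?posrE ?powR_gt0 // ln_powR lee_fin.
by rewrite mulrDl addrC lerD2l.
Qed.

Lemma lower_growth_gt f a : (forall r, 0 <= f r) -> a%:E < lower_growth f ->
  exists2 r0 : R, (1 < r0)%R & forall r, (r0 <= r)%R -> (r `^ a)%:E <= f r.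
Proof.
move=> f0; rewrite /lower_growth limf_einfE => /ereal_sup_gt[_ [V [M [_ MV]] <-] infV].
exists (Num.max M 1 + 1)%R; first by rewrite ltr_pwDr // le_max lexx orbT.
move=> r Mr; have [Mr' r1] : (M < r)%R /\ (1 < r)%R.
  have h1 : (M <= Num.max M 1)%R by rewrite le_max lexx.
  have h2 : (1 <= Num.max M 1)%R by rewrite le_max lexx orbT.
  by split; lra.
have r0 : (0 < r)%R by rewrite (lt_trans _ r1).
have lr0 : (0 < ln r)%R by rewrite ln_gt0.
have : a%:E < lne (f r) * ((ln r)^-1)%:E.
  by apply: (lt_le_trans infV); apply: ereal_inf_lbound; exists r => //; exact: MV.
rewrite lte_pdivlMr // => fr.
have /eqP <- : expeR (lne (f r)) == f r by rewrite lneK_eq.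
rewrite -expR_mul_ln //= -[leLHS]/(expeR (a * ln r)%:E) lee_expeR EFinM.
exact: ltW.
Qed.

Lemma ereal_between (x y : \bar R) : x < y -> exists r : R, x < r%:E /\ r%:E < y.
Proof.
move: x y => [x| |] [y| |] //=; rewrite ?lte_fin ?ltNge ?leey ?leNye //= => xy.
- by exists ((x + y) / 2)%R; rewrite !lte_fin; split; move: xy; rewrite -ltNge; lra.
- by exists (x + 1)%R; rewrite lte_fin ltry; split => //; lra.
- by exists (y - 1)%R; rewrite lte_fin ltNyr; split => //; lra.
- by exists 0%R; rewrite ltry ltNyr.
Qed.

Lemma upper_growth_ge0 f (c r0 : R) : (0 < c)%R ->
  (forall r, (r0 <= r)%R -> c%:E <= f r) -> 0 <= upper_growth f.
Proof.
move=> c0 fc; rewrite leNgt; apply/negP => /ereal_between[a [fa]]; rewrite lte_fin => a0.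
have [r1 r11 Hr1] := upper_growth_lt fa.
pose r := Num.max (Num.max r0 r1) (expR (ln c / a) + 1)%R.
have [[r0r r1r] rc] : (((r0 <= r) /\ (r1 <= r)) /\ (expR (ln c / a) + 1 <= r))%R.
  by rewrite /r !le_max !lexx !orbT.
have rp : (0 < r)%R by rewrite (lt_le_trans _ r1r) // (lt_trans _ r11).
have := le_trans (fc r r0r) (Hr1 r r1r); apply/negP; rewrite -ltNge lte_fin.
rewrite -expR_mul_ln // -[ltRHS]lnK ?posrE // ltr_expR -ltr_ndivrMl // mulrC.
by rewrite -[ltLHS]expRK ltr_ln ?posrE ?expR_gt0 //; lra.
Qed.

(** Some [2 ^+ n] lies between [r] and [2 * r]; monotonicity of [f] then costs a factor at most [2]^
    [|a|], the absolute value covering negative [a]. *)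
Lemma upper_growth_le_pow2 f a C (n0 : nat) : (0 < C)%R ->
  {homo f : r s / (r <= s)%R >-> r <= s} ->
  (forall n, (n0 <= n)%N -> f (2 ^+ n)%R <= (C * (2 ^+ n) `^ a)%:E) ->
  upper_growth f <= a%:E.
Proof.
move=> C0 fnd fC.
apply: (@upper_growth_le _ _ (C * 2 `^ `|a|)%R (2 ^+ n0)%R).
  by rewrite mulr_gt0 // powR_gt0.
move=> r r0.
have r1 : (1 <= r)%R by apply: le_trans r0; rewrite exprn_ege1 // ler1n.
have rp : (0 < r)%R by rewrite (lt_le_trans _ r1).
have [n [n0n rn nr]] : exists n, [/\ (n0 <= n)%N, (r <= 2 ^+ n)%R & (2 ^+ n <= 2 * r)%R].
  pose m := Num.truncn r.
  have m0 : (0 < m)%N by rewrite truncn_gt0.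
  have /andP[lo hi] := trunc_log_bounds (isT : 1 < 2)%N m0.
  exists (trunc_log 2 m).+1.
  have hi' : (r <= 2 ^+ (trunc_log 2 m).+1)%R.
    by apply: (le_trans (ltW (truncnS_gt r))); rewrite -natrX ler_nat.
  split => //.
    by have := le_trans r0 hi'; rewrite ler_eXn2l // ltr1n.
  rewrite exprS ler_pM2l // -natrX; apply: (@le_trans _ _ m%:R); first by rewrite ler_nat.
  by rewrite truncn_le // ltW.
apply: (le_trans (fnd _ _ rn)); apply: (le_trans (fC n n0n)); rewrite lee_fin.
rewrite -mulrA ler_pM2l //.
have [a0|a0] := leP 0%R a.
  rewrite ger0_norm // -powRM ?(ltW rp) //.
  by rewrite ge0_ler_powR // nnegrE ?mulr_ge0 ?exprn_ge0 // ltW.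
rewrite ltr0_norm //; apply: (@le_trans _ _ (r `^ a)%R).
  rewrite -[a]opprK !(powRN _ (- a)) lef_pV2 ?posrE ?powR_gt0 ?exprn_gt0 //.
  by rewrite ge0_ler_powR // ?nnegrE ?exprn_ge0 ?(ltW rp) // oppr_ge0 ltW.
rewrite ler_peMl ?powR_ge0 // -[leLHS](powRr0 2) .
by rewrite ler_powR ?ler1n // oppr_ge0 ltW.
Qed.

End growth.

Section almost_everywhere.
Context d (T : measurableType d) (R : realType).
Local Open Scope ereal_scope.

Lemma ae_lt_pinfty (mu : {measure set T -> \bar R}) (f : T -> \bar R) :
  (forall x, 0 <= f x) -> measurable_fun setT f -> \int[mu]_x f x < +oo ->
  {ae mu, forall x, f x < +oo}.
Proof.
move=> f0 mf fI; have fi : mu.-integrable setT f.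
  apply/integrableP; split => //; rewrite (le_lt_trans _ fI) // le_eqVlt.
  by apply/orP; left; apply/eqP/eq_integral => x _; rewrite gee0_abs.
have := integrable_ae measurableT fi; apply: filterS => x /(_ Logic.I).
by rewrite fin_numElt => /andP[].
Qed.

Lemma ae_witness (P : probability T R) (Q : T -> Prop) :
  {ae P, forall x, Q x} -> exists x, Q x.
Proof.
move=> [N [mN PN QN]]; apply: contrapT => /forallNP nQ.
have NT : N = setT by apply/seteqP; split => // x _; apply: QN; exact: nQ.
have := probability_setT P; rewrite -NT PN => /eqP.
by rewrite eqe eq_sym oner_eq0.
Qed.

End almost_everywhere.

Lemma geometric_nneseries_lt_pinfty (R : realType) (q : R) : 0 <= q -> q < 1 ->
  (\sum_(0 <= n <oo) (q ^+ n)%:E < +oo)%E.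
Proof.
move=> q0 q1; apply: (@le_lt_trans _ _ ((1 - q)^-1)%:E); last exact: ltry.
apply: lime_le; first by apply: is_cvg_nneseries => n _ _; rewrite lee_fin exprn_ge0.
apply: nearW => n; rewrite big_mkord sumEFin lee_fin.
rewrite -[leRHS]mul1r ler_pdivlMr ?subr_gt0 // mulrC.
rewrite -opprB mulNr -subrX1 opprB gerBl.
exact: exprn_ge0.
Qed.

Lemma nneseries_term_le (R : realType) (f : nat -> \bar R) : (forall i, 0 <= f i)%E ->
  forall k, (f k <= \sum_(0 <= i <oo) f i)%E.
Proof.
move=> f0 k; rewrite nneseries_esumT //; apply: esum_ge; exists [set k].
  by split => //; exact: finite_set1.
by rewrite fsbig_set1.
Qed.

(** * Weights of balls and the third inequality *)

Section weights.
Variable R : realType.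
Local Open Scope ereal_scope.
Implicit Types (D : discrete_space R) (r : R).

(** Marks are cut off at 0 so that the functional is nonnegative on every marked space, not only on
    samples of [w]. The guard [0 < r] is that of [nball]. *)
Definition ball_weight (r : R) (X : pspace R 0 1) : \bar R :=
  \esum_(u in [set: ps_space X])
    (if ((0 < r) && (mdist (ps_root X) u <= r))%R then (Num.max 0 (ps_mark X ord0 u))%:E else 0).

Lemma ball_weight_ge0 r X : 0 <= ball_weight r X.
Proof. by apply: esum_ge0 => u _; case: ifP => // _; rewrite lee_fin le_max lexx. Qed.

Lemma ps_measurable_ball_weight r : ps_measurable (ball_weight r).
Proof.
pose G (Y : pspace R (0 + 1) 1) : \bar R :=
  if ((0 < r) && (ps_dist (oldpt 1 ord0) (newpt 0 ord0) Y <= r))%R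
  then (Num.max 0 (ps_label ord0 (newpt 0 ord0) Y))%:E else 0.
have G0 Y : 0 <= G Y by rewrite /G; case: ifP => // _; rewrite lee_fin le_max lexx.
have mG : ps_measurable G.
  apply: ps_measurable_if; last exact: ps_measurable_cst.
    apply: ps_measurable_and; first exact: ps_measurable_cst.
    by apply: ps_measurable_le; [exact: ps_measurable_dist|exact: ps_measurable_cst].
  apply: (ps_measurable_comp (g := fun x : R => (Num.max 0 x)%:E)); last exact: ps_measurable_label.
  by apply/measurable_EFinP; apply: measurable_maxr.
have := ps_measurable_sum1 G0 mG; apply: ps_measurable_eq => X.
apply: eq_esum => v _; rewrite /G /ps_dist /ps_label.
by rewrite ps_extend_old ps_extend_new.
Qed.

Lemma ball_weightE D (v : D) (m : D -> R) r : (forall u, 0 <= m u)%R ->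
  ball_weight r (marked v m) = total_weight m (nball r v).
Proof.
move=> m0; rewrite /total_weight esum_mkcond; apply: eq_esum => u _ /=.
rewrite (max_idPr (m0 u)) /nball /ps_root /=.
case: (boolP (_ && _)) => [/andP[h1 h2]|h]; first by rewrite mem_set.
by rewrite memNset // => -[h1 h2]; rewrite h1 h2 in h.
Qed.

Lemma total_weight_le D (m : D -> R) (A B : set D) : (forall u, 0 <= m u)%R ->
  A `<=` B -> total_weight m A <= total_weight m B.
Proof.
move=> m0 AB; rewrite /total_weight (esum_mkcond A) (esum_mkcond B); apply: le_esum => u _.
case: ifPn => [/set_mem/AB uB|_]; first by rewrite mem_set.
by case: ifP => // _; rewrite lee_fin.
Qed.

Lemma nball_le D (v : D) r s : (r <= s)%R -> nball r v `<=` nball s v.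
Proof. by move=> rs u [r0 ur]; split; [exact: lt_le_trans rs|exact: le_trans rs]. Qed.

Lemma nball_sub D (u v : D) r s : (mdist u v + r <= s)%R -> nball r v `<=` nball s u.
Proof.
move=> rs x [r0 vx]; split.
  by apply: lt_le_trans rs; rewrite ltr_wpDl ?mdist_ge0.
by apply: le_trans rs; apply: (le_trans (metric_triangle u v x)); rewrite lerD2l.
Qed.

Lemma total_weight_nball_lt_pinfty D (m : D -> R) (v : D) r :
  (forall u, 0 <= m u)%R -> total_weight m (nball r v) < +oo.
Proof.
move=> m0; rewrite /total_weight esum_fset //; last by move=> u _; rewrite lee_fin.
  have fb : finite_set (nball r v).
    by apply: (sub_finite_set _ (finite_closed_ball v r)) => u [].
  by rewrite fsbig_finite //= lte_sum_pinfty // => i _; rewrite ltry.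
by apply: (sub_finite_set _ (finite_closed_ball v r)) => u [].
Qed.

Variables (mu : probability (pclass R 0 0) R) (w : equivariant_process R).
Hypothesis w0 : nonneg_process w.

Lemma expectation_total_weight r :
  ep_expectation mu w (fun D o m => total_weight m (nball r o)) =
  \int[mu]_x ep_int w (ball_weight r) (repr x).
Proof.
apply: eq_integral => x _; apply: eq_integral => s _.
by rewrite ball_weightE.
Qed.

Lemma ep_as_lt_pinfty (F : pspace R 0 1 -> \bar R) :
  (forall X, 0 <= F X) -> ps_measurable F -> \int[mu]_x ep_int w F (repr x) < +oo ->
  ep_as mu w (fun D v m => F (marked v m) < +oo).
Proof.
move=> F0 mF FI; have mFE := @ps_measurable_ep_int R w F F0 mF.
have FE0 (x : pclass R 0 0) : 0 <= ep_int w F (repr x) by exact: ep_int_ge0.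
have H := ae_lt_pinfty FE0 mFE.2 FI.
move: H; apply: filterS => x Fx; apply: ae_lt_pinfty Fx; first by move=> s; exact: F0.
exact: (measurable_marked _ mF).
Qed.

Lemma ep_as_witness (Q Q' : forall D : discrete_space R, D -> (D -> R) -> Prop) :
  ep_as mu w Q -> ep_as mu w Q' -> exists (x : pclass R 0 0) (s : ep_sample w (ps_space (repr x))),
    Q _ (ps_root (repr x)) (ep_val s) /\ Q' _ (ps_root (repr x)) (ep_val s).
Proof.
move=> h h'; have [x [hx hx']] := ae_witness (filterI h h').
by have [s sQ] := ae_witness (filterI hx hx'); exists x, s.
Qed.

Lemma ess_inf_growth_le_expectation :
  ep_ess_inf mu w (fun D o m =>
    upper_growth (fun r => total_weight m (nball r o))) <=
  upper_growth (fun r =>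
    ep_expectation mu w (fun D o m => total_weight m (nball r o))).
Proof.
apply: ge_ereal_sup => y /= yas; rewrite leNgt; apply/negP.
move=> /ereal_between[a [/ereal_between[a' [La' a'a]] ay]].
rewrite lte_fin in a'a.
have [r0 r01 Er0] := upper_growth_lt La'.
pose q : R := (2 `^ (a' - a))%R.
have q0 : (0 <= q)%R by exact: powR_ge0.
have q1 : (q < 1)%R by rewrite /q -expR_mul_ln // expR_lt1 nmulr_rlt0 ?subr_lt0 // ln_gt0 // ltr1n.
have [n0 n0r] : exists n0, (r0 <= 2 ^+ n0)%R.
  exists (Num.truncn r0).+1; apply: (le_trans (ltW (truncnS_gt r0))).
  by rewrite -natrX ler_nat ltnW // ltn_expl.
(* The series starts at scale [2 ^+ n0], from which on the bound on the mean weights is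
   available. *)
pose S (X : pspace R 0 1) := \sum_(0 <= n <oo)
  ((2 ^+ (n + n0)) `^ (- a))%:E * ball_weight (2 ^+ (n + n0))%R X.
have t0 n X : 0 <= ((2 ^+ (n + n0)) `^ (- a))%:E * ball_weight (2 ^+ (n + n0))%R X.
  by rewrite mule_ge0 ?lee_fin ?powR_ge0 // ball_weight_ge0.
have S0 X : 0 <= S X by apply: nneseries_ge0.
have mt n : ps_measurable (fun X => ((2 ^+ (n + n0)) `^ (- a))%:E * ball_weight (2 ^+ (n + n0))%R X).
  apply: (ps_measurable_comp (g := fun x => ((2 ^+ (n + n0)) `^ (- a))%:E * x)).
    exact: measurable_funeM.
  exact: ps_measurable_ball_weight.
have mS : ps_measurable S.
  split; last by apply: ge0_emeasurable_sum => [n x _ _|n _]; [exact: t0|exact: (mt n).2].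
  by move=> X Y XY; apply: eq_eseriesr => n _; exact: (mt n).1.
have SE : \int[mu]_x ep_int w S (repr x) = \sum_(0 <= n <oo)
    ((2 ^+ (n + n0)) `^ (- a))%:E * ep_expectation mu w (fun D o m => total_weight m (nball (2 ^+ (n + n0)) o)).
  transitivity (\int[mu]_x \sum_(0 <= n <oo) (((2 ^+ (n + n0)) `^ (- a))%:E * ep_int w (ball_weight (2 ^+ (n + n0))%R) (repr x))).
    apply: eq_integral => x _; rewrite /ep_int /S integral_nneseries //.
      apply: eq_eseriesr => n _; rewrite ge0_integralZl_EFin ?powR_ge0 //.
        by move=> s _; exact: ball_weight_ge0.
      by apply: measurable_marked; exact: ps_measurable_ball_weight.
    by move=> n; exact: (measurable_marked _ (mt n)).
  have mE n := ps_measurable_ep_int w (@ball_weight_ge0 (2 ^+ n)%R) (ps_measurable_ball_weight (2 ^+ n)%R).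
  rewrite integral_nneseries //.
  - apply: eq_eseriesr => n _; rewrite expectation_total_weight.
    apply: ge0_integralZl_EFin.
    + exact: measurableT.
    + by move=> x _; apply: ep_int_ge0 => X; exact: ball_weight_ge0.
    + exact: (mE _).2.
    + exact: powR_ge0.
  - by move=> n; apply: measurable_funeM; exact: (mE _).2.
  - by move=> n x _; rewrite mule_ge0 ?lee_fin ?powR_ge0 // ep_int_ge0 // => X; exact: ball_weight_ge0.
have Sfin : \int[mu]_x ep_int w S (repr x) < +oo.
  rewrite SE; apply: le_lt_trans (geometric_nneseries_lt_pinfty q0 q1).
  apply: lee_nneseries => [n _ _|n _].
    rewrite mule_ge0 ?lee_fin ?powR_ge0 // expectation_total_weight.
    by apply: integral_ge0 => x _; apply: ep_int_ge0 => X; exact: ball_weight_ge0.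
  apply: (@le_trans _ _ (((2 ^+ (n + n0)) `^ (- a))%:E * ((2 ^+ (n + n0)) `^ a')%:E)).
    rewrite lee_wpmul2l ?lee_fin ?powR_ge0 // Er0 // (le_trans n0r) //.
    by rewrite ler_eXn2l ?ltr1n // leq_addl.
  rewrite -EFinM lee_fin -powRD; last first.
    by apply/implyP => _; rewrite expf_neq0 // pnatr_eq0.
  rewrite addrC -[(2 ^+ _)%R]powR_mulrn // -powRrM mulrC powRrM powR_mulrn //.
  by rewrite exprD ler_piMr ?exprn_ge0 // exprn_ile1 // ltW.
have aeS : ep_as mu w (fun D v m => S (marked v m) < +oo) by exact: ep_as_lt_pinfty.
(* One sample at which both almost sure statements hold suffices for the contradiction. *)
have [x [s [sy]]] := ep_as_witness yas aeS.
set m := ep_val s; set v := ps_root _ => Sm.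
suff ga : upper_growth (fun r => total_weight m (nball r v)) <= a%:E.
  by have := lt_le_trans ay (le_trans sy ga); rewrite ltxx.
move: Sm (S0 (marked v m)); case E : (S (marked v m)) => [c| |] // _ c0.
rewrite lee_fin in c0.
apply: (@upper_growth_le_pow2 _ _ _ (c + 1)%R n0); first by rewrite ltr_wpDl.
  by move=> r t rt; apply: total_weight_le; [exact: w0|exact: nball_le].
move=> n n0n; rewrite -(subnK n0n); set k := (n - n0)%N.
have Sk : ((2 ^+ (k + n0)) `^ (- a))%:E * ball_weight (2 ^+ (k + n0))%R (marked v m) <= c%:E.
  by rewrite -E; exact: (nneseries_term_le (fun i => t0 i (marked v m)) k).
rewrite ball_weightE in Sk; last exact: w0.
have p0 : (0 < (2 ^+ (k + n0)) `^ a :> R)%R by rewrite powR_gt0 // exprn_gt0.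
have tfin : total_weight m (nball (2 ^+ (k + n0))%R v) \is a fin_num.
  rewrite ge0_fin_numE; first by apply: total_weight_nball_lt_pinfty; exact: w0.
  by apply: esum_ge0 => u _; rewrite lee_fin; exact: w0.
move: Sk; rewrite -(fineK tfin) -EFinM !lee_fin powRN mulrC ler_pdivrMr // => h.
by apply: le_trans h _; rewrite ler_pM2r // lerDl.
Qed.

End weights.

(** * Mass distribution principle *)

Section countable_interchange.
Context d (S : measurableType d) (R : realType) (mu : {measure set S -> \bar R}).
Context (T : choiceType) (cT : countable [set: T]).
Local Open Scope ereal_scope.

Lemma integral_esum (f : T -> S -> \bar R) : (forall t s, 0 <= f t s) ->
  (forall t, measurable_fun setT (f t)) ->
  \int[mu]_s (\esum_(t in setT) f t s) = \esum_(t in setT) \int[mu]_s f t s.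
Proof.
move=> f0 mf; rewrite (esum_cnt cT); last by move=> t; apply: integral_ge0.
under eq_integral do rewrite (esum_cnt cT) //.
rewrite integral_nneseries //.
- by apply: eq_eseriesr => i _; case: cnt_unindex => [t|] //; rewrite integral0.
- by move=> i; case: cnt_unindex => [t|]; [exact: mf|exact: measurable_cst].
- by move=> i s _; case: cnt_unindex.
Qed.

Lemma measurable_esum (f : T -> S -> \bar R) : (forall t s, 0 <= f t s) ->
  (forall t, measurable_fun setT (f t)) ->
  measurable_fun setT (fun s => \esum_(t in setT) f t s).
Proof.
move=> f0 mf; under eq_fun do rewrite (esum_cnt cT) //.
apply: ge0_emeasurable_sum => [i s _ _|i _]; first by case: cnt_unindex.
by case: cnt_unindex => [t|]; [exact: mf|exact: measurable_cst].
Qed.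

Lemma ae_countable (Q : T -> S -> Prop) : (forall t, {ae mu, forall s, Q t s}) ->
  {ae mu, forall s, forall t, Q t s}.
Proof.
move=> h.
have H : {ae mu, forall s, forall i, if cnt_unindex cT i is Some t then Q t s else True}.
  by apply: ae_foralln => i; case: cnt_unindex => [t|]; [exact: h|exact: aeW].
by move: H; apply: filterS => s Hs t; have := Hs (cnt_index cT t); rewrite cnt_indexK.
Qed.

Lemma esum_term_le (f : T -> \bar R) (t : T) : (forall t, 0 <= f t) ->
  f t <= \esum_(t in setT) f t.
Proof.
move=> f0; apply: esum_ge; exists [set t]; last by rewrite fsbig_set1.
by split => //; exact: finite_set1.
Qed.

End countable_interchange.

(** Serves to insert the integer part of a distance as a parameter of a conditional expectation:
    only countably many values have to be glued. *)
Lemma ps_measurable_nat_index (R : realType) n k d (T : measurableType d)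
    (N : pspace R n k -> nat) (K : nat -> pspace R n k -> T) :
  (forall i, ps_measurable (K i)) -> (forall i, ps_measurable (fun X => N X == i)) ->
  ps_measurable (fun X => K (N X) X).
Proof.
move=> mK mN; split=> [X Y XY|_ B mB].
  rewrite ((mK _).1 _ _ XY); congr (K _ Y).
  by apply/eqP; have /= := (mN (N Y)).1 _ _ XY; rewrite eqxx => ->.
rewrite setTI (_ : _ @^-1` _ = \bigcup_i
   ([set x | N (repr x) == i] `&` (fun x : pclass R n k => K i (repr x)) @^-1` B)).
  apply: bigcup_measurable => i _; apply: measurableI.
    exact: ((ps_measurable_boolP _).1 (mN i)).2.
  by rewrite -[X in measurable X]setTI; exact: (mK i).2.
apply/seteqP; split=> x /=; first by move=> Bx; exists (N (repr x)) => //; split => /=.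
by move=> [i _ [/eqP <-]].
Qed.

Section mass_distribution.
Variable R : realType.
Local Open Scope ereal_scope.
Implicit Types (D : discrete_space R) (a c r : R).

(** Restricting to positive integer radii makes the condition a countable intersection; passing to
    real radii costs a factor in [esum_bounded_growth_mark]. *)
Definition bounded_growth (c a : R) (X : pspace R 0 1) : bool :=
  `[< forall j : nat, ball_weight j.+1%:R X <= (c * j.+1%:R `^ a)%:E >].

Lemma ps_measurable_bounded_growth c a : ps_measurable (bounded_growth c a).
Proof.
apply: ps_measurable_eq (ps_measurable_countable_forall
   (P := fun j X => ball_weight j.+1%:R X <= (c * j.+1%:R `^ a)%:E) _) => [X|j].
  by apply: asbool_equiv_eq.
by apply: ps_measurable_lee; [exact: ps_measurable_ball_weight|exact: ps_measurable_cst].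
Qed.

Definition bounded_growth_mark c a (X : pspace R 0 1) : \bar R :=
  if bounded_growth c a X then (Num.max 0 (ps_mark X ord0 (ps_root X)))%:E else 0.

Lemma bounded_growth_mark_ge0 c a X : 0 <= bounded_growth_mark c a X.
Proof. by rewrite /bounded_growth_mark; case: ifP => // _; rewrite lee_fin le_max lexx. Qed.

Lemma ps_measurable_root_mark :
  ps_measurable (fun X : pspace R 0 1 => ps_mark X ord0 (ps_root X)).
Proof. exact: (@ps_measurable_label R 0 1 ord0 ord0). Qed.

Lemma ps_measurable_root_weight :
  ps_measurable (fun X : pspace R 0 1 => (Num.max 0 (ps_mark X ord0 (ps_root X)))%:E).
Proof.
apply: (ps_measurable_comp (g := fun x : R => (Num.max 0 x)%:E)) ps_measurable_root_mark.
by apply/measurable_EFinP; apply: measurable_maxr.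
Qed.

Lemma ps_measurable_bounded_growth_mark c a : ps_measurable (bounded_growth_mark c a).
Proof.
apply: ps_measurable_if; last exact: ps_measurable_cst.
  exact: ps_measurable_bounded_growth.
exact: ps_measurable_root_weight.
Qed.

(** If some point [v0] of the ball is kept, the whole ball lies within [2 * r] of [v0], and the
    growth condition at [v0] bounds all its weight. If none is kept, the sum is 0. *)
Lemma esum_bounded_growth_mark D (m : D -> R) (u : D) c a r :
  (forall v, 0 <= m v)%R -> (0 <= c)%R -> (0 <= a)%R -> (1 <= r)%R ->
  \esum_(v in [set: D]) (if (mdist u v <= r)%R then bounded_growth_mark c a (marked v m) else 0)
    <= (c * (3 * r) `^ a)%:E.
Proof.
move=> m0 c0 a0 r1.
have [[v0 [uv0 gv0]]|none] := pselect (exists v, (mdist u v <= r)%R /\ bounded_growth c a (marked v m)); last first.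
  rewrite esum1 ?lee_fin ?mulr_ge0 ?powR_ge0 // => v _.
  case: ifP => // uv; rewrite /bounded_growth_mark; case: ifP => // gv.
  by case: none; exists v.
(* [j.+1] is an integer radius above the diameter bound [2 * r]; it is at most [2 * r + 1], hence at
   most [3 * r] because [1 <= r]. *)
pose j := Num.truncn (2 * r).
have jr : (2 * r < j.+1%:R)%R by exact: truncnS_gt.
have jr' : (j.+1%:R <= 3 * r)%R.
  have : (j%:R <= 2 * r)%R by rewrite truncn_le // mulr_ge0 // (le_trans _ r1).
  by rewrite -[j.+1]addn1 natrD; lra.
apply: (@le_trans _ _ (total_weight m (nball j.+1%:R v0))); last first.
  rewrite -ball_weightE //; move/asboolP: gv0 => /(_ j)/le_trans; apply.
  rewrite lee_fin ler_wpM2l // ge0_ler_powR // ?nnegrE ?ler0n //.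
  by rewrite mulr_ge0 // (le_trans _ r1).
rewrite /total_weight [leRHS]esum_mkcond; apply: le_esum => v _.
case: ifP => [uv|_]; last by case: ifP => // _; rewrite lee_fin.
rewrite mem_set; last first.
  split; first exact: ltr0Sn.
  apply: (le_trans (metric_triangle v0 u v)); rewrite metric_sym; lra.
rewrite /bounded_growth_mark; case: ifP => _; last by rewrite lee_fin.
by rewrite lee_fin /= (max_idPr (m0 v)).
Qed.

Variable w : equivariant_process R.
Hypothesis w0 : nonneg_process w.
Variables (c a : R) (c0 : (0 < c)%R) (a0 : (0 <= a)%R).

Let W := ep_int w (bounded_growth_mark c a).

Let W_ge0 X : 0 <= W X.
Proof. by apply: ep_int_ge0 => Y; exact: bounded_growth_mark_ge0. Qed.

Let mW : ps_measurable W.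
Proof.
apply: ps_measurable_ep_int => [Y|]; first exact: bounded_growth_mark_ge0.
exact: ps_measurable_bounded_growth_mark.
Qed.

Let W_ball D (u : D) r : (1 <= r)%R ->
  \esum_(v in [set: D]) (if (mdist u v <= r)%R then W (unmarked v) else 0) <= (c * (3 * r) `^ a)%:E.
Proof.
move=> r1.
have mb v : measurable_fun setT (fun s : ep_sample w D => bounded_growth_mark c a (marked v (ep_val s))).
  exact: (measurable_marked v (ps_measurable_bounded_growth_mark c a)).
have -> : \esum_(v in [set: D]) (if (mdist u v <= r)%R then W (unmarked v) else 0) =
  \int[ep_prob w D]_s \esum_(v in [set: D])
     (if (mdist u v <= r)%R then bounded_growth_mark c a (marked v (ep_val s)) else 0).
  rewrite (integral_esum _ (countable_discrete_space D)).
  - by apply: eq_esum => v _; case: ifP => // _; rewrite integral0.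
  - by move=> v s; case: ifP => // _; exact: bounded_growth_mark_ge0.
  - by move=> v; case: (mdist u v <= r)%R; [exact: mb|exact: measurable_cst].
apply: (@le_trans _ _ (\int[ep_prob w D]_s cst (c * (3 * r) `^ a)%:E s)).
  apply: ge0_le_integral => //.
  - by move=> s _; apply: esum_ge0 => v _; case: ifP => // _; exact: bounded_growth_mark_ge0.
  - apply: (measurable_esum (countable_discrete_space D)).
      by move=> v s; case: ifP => // _; exact: bounded_growth_mark_ge0.
    by move=> v; case: (mdist u v <= r)%R; [exact: mb|exact: measurable_cst].
  - by move=> s _; apply: esum_bounded_growth_mark => //; exact: ltW.
by rewrite integral_cst //= probability_setT mule1.
Qed.

Variables (mu : probability (pclass R 0 0) R) (muU : unimodular mu).
Variable Z : equivariant_process R.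

(** Tests whether the ball at the root reaches a point whose distance has integer part [n]. The
    maximum with 1 excludes the radius 0, which stands for no ball. *)
Let H (n : nat) (Y : pspace R 0 1) : \bar R :=
  if (Num.max 1 n%:R <= ps_mark Y ord0 (ps_root Y))%R then 1 else 0.

Let H_ge0 n Y : 0 <= H n Y. Proof. by rewrite /H; case: ifP. Qed.

Let mH n : ps_measurable (H n).
Proof.
apply: ps_measurable_if; [|exact: ps_measurable_cst|exact: ps_measurable_cst].
apply: ps_measurable_le; first exact: ps_measurable_cst.
exact: ps_measurable_root_mark.
Qed.

(** The mass that the second point sends to the first one, seen as a centre: the mean kept weight of
    the second times the probability that the ball at the first reaches it. *)
Let g (Y : pspace R 1 0) : \bar R :=
  W (ps_select (fun _ : 'I_1 => ord_max) Y) *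
  ep_int Z (H (Num.truncn (ps_dist ord0 ord_max Y))) (ps_select (fun _ : 'I_1 => ord0) Y).

Let g_ge0 Y : 0 <= g Y.
Proof. by rewrite /g mule_ge0 // ep_int_ge0. Qed.

Let mg : ps_measurable g.
Proof.
apply: (ps_measurable_lift2 (op := fun x y : \bar R => x * y)).
- by move=> u v mu' mv; exact: emeasurable_funM.
- apply: ps_measurable_map => //; exact: ps_measurable_select.
- apply: (ps_measurable_nat_index (N := fun Y : pspace R 1 0 => Num.truncn (ps_dist ord0 ord_max Y))
    (K := fun n Y => ep_int Z (H n) (ps_select (fun _ : 'I_1 => ord0) Y))) => n.
    apply: ps_measurable_map; first exact: ps_measurable_select.
    by apply: ps_measurable_ep_int => [Y|]; [exact: H_ge0|exact: mH].
  apply: (@ps_measurable_eq _ _ _ _ _ (fun Y : pspace R 1 0 => (n%:R <= ps_dist ord0 ord_max Y) && (ps_dist ord0 ord_max Y < n.+1%:R))%R).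
    by move=> Y; rewrite truncn_eq // mdist_ge0.
  apply: ps_measurable_and.
    by apply: ps_measurable_le; [exact: ps_measurable_cst|exact: ps_measurable_dist].
  by apply: ps_measurable_lt; [exact: ps_measurable_dist|exact: ps_measurable_cst].
Qed.

Let gE D (u v : D) : g (unmarked2 u v) =
  \int[ep_prob Z D]_s (W (unmarked v) * H (Num.truncn (mdist u v)) (marked u (ep_val s))).
Proof.
rewrite ge0_integralZl //.
exact: (measurable_marked u (mH _)).
Qed.

Definition powR_root (Y : pspace R 0 1) : \bar R := (Num.max 0 (powR00 (ps_mark Y ord0 (ps_root Y)) a))%:E.

Lemma powR_root_ge0 Y : 0 <= powR_root Y.
Proof. by rewrite lee_fin le_max lexx. Qed.

Lemma ps_measurable_powR_root : ps_measurable powR_root.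
Proof.
apply: (ps_measurable_comp (g := fun x : R => (Num.max 0 (powR00 x a))%:E)) ps_measurable_root_mark.
apply/measurable_EFinP; apply: measurable_maxr => //.
rewrite /powR00; apply: measurable_fun_ifT => //.
exact: measurable_fun_eqr.
Qed.

Let out_mass D (o : D) : \esum_(v in [set: D]) g (unmarked2 o v) <=
  (c * 6 `^ a)%:E * ep_int Z powR_root (unmarked o).
Proof.
have mS v : measurable_fun setT (fun s : ep_sample Z D =>
    W (unmarked v) * H (Num.truncn (mdist o v)) (marked o (ep_val s))).
  by apply: measurable_funeM; exact: (measurable_marked o (mH _)).
have S0 v (s : ep_sample Z D) : 0 <= W (unmarked v) * H (Num.truncn (mdist o v)) (marked o (ep_val s)).
  by rewrite mule_ge0.
under eq_esum do rewrite gE.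
rewrite -(integral_esum _ (countable_discrete_space D)) // /ep_int -ge0_integralZl_EFin //; first last.
- by rewrite mulr_ge0 ?powR_ge0 // ltW.
- exact: (measurable_marked o ps_measurable_powR_root).
- by move=> s _; exact: powR_root_ge0.
apply: ge0_le_integral => //.
- by move=> s _; apply: esum_ge0 => v _.
- exact: (measurable_esum (countable_discrete_space D)).
- by apply: measurable_funeM; exact: (measurable_marked o ps_measurable_powR_root).
move=> s _; set m := ep_val s.
have [m1|m1] := leP 1%R (m o); last first.
  rewrite esum1; first by rewrite mule_ge0 ?powR_root_ge0 // lee_fin mulr_ge0 ?powR_ge0 // ltW.
  move=> v _; rewrite /H ifF ?mule0 //; apply/negP; rewrite /= /ps_root /=.
  by rewrite ge_max => /andP[/le_lt_trans/(_ m1)]; rewrite ltxx.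
have m0 : (0 <= m o)%R by rewrite (le_trans _ m1).
apply: (@le_trans _ _ (\esum_(v in [set: D]) (if (mdist o v <= 2 * m o)%R then W (unmarked v) else 0))).
  apply: le_esum => v _; rewrite /H /= /ps_root /= ge_max m1 /=.
  case: ifP => [tm|_]; last by rewrite mule0; case: ifP.
  rewrite mule1 ifT //; have := truncnS_gt (mdist o v).
  by rewrite -addn1 natrD; lra.
apply: (le_trans (W_ball o _)); first by lra.
rewrite /powR_root /= /ps_root /= /powR00 gt_eqF ?(lt_le_trans _ m1) //.
rewrite (max_idPr (powR_ge0 _ _)) -EFinM lee_fin -mulrA ler_pM2l // -powRM // mulrA.
by rewrite -natrM.
Qed.

(** Almost surely a ball covers the root, and the term of its centre alone already equals the mean
    kept weight of the root. *)
Let in_mass (x : pclass R 0 0) : nonneg_process Z ->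
  (\forall s \ae ep_prob Z (ps_space (repr x)),
     \bigcup_(v in [set: ps_space (repr x)]) nball (ep_val s v) v = [set: ps_space (repr x)]) ->
  (\forall s \ae ep_prob Z (ps_space (repr x)), forall v, ep_val s v = 0%R \/ (1 <= ep_val s v)%R) ->
  W (repr x) <= \esum_(v in [set: ps_space (repr x)]) g (unmarked2 v (ps_root (repr x))).
Proof.
set D := ps_space (repr x); set o := ps_root (repr x) => Z0 cov val.
have mS v : measurable_fun setT (fun s : ep_sample Z D =>
    W (unmarked o) * H (Num.truncn (mdist v o)) (marked v (ep_val s))).
  by apply: measurable_funeM; exact: (measurable_marked v (mH _)).
have S0 v (s : ep_sample Z D) : 0 <= W (unmarked o) * H (Num.truncn (mdist v o)) (marked v (ep_val s)).
  by rewrite mule_ge0.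
under eq_esum do rewrite gE.
rewrite -(integral_esum _ (countable_discrete_space D)) //.
have -> : W (repr x) = \int[ep_prob Z D]_s cst (W (unmarked o)) s.
  by rewrite integral_cst //= probability_setT mule1; apply: mW.1; apply: ps_isometric_sym; exact: unmarked_root.
apply: ae_ge0_le_integral => //.
- by move=> s _; exact: W_ge0.
- by move=> s _; apply: esum_ge0 => v _.
- exact: (measurable_esum (countable_discrete_space D)).
move: val; apply: filterS2 cov => s covs vals _.
have [v _ [Rv ov]] : (\bigcup_(v in [set: D]) nball (ep_val s v) v) o by rewrite covs.
apply: le_trans (esum_term_le v (S0^~ s)); rewrite /H ifT ?mule1 //=.
have v1 : (1 <= ep_val s v)%R by case: (vals v) Rv => // ->; rewrite ltxx.
rewrite ge_max v1 /=; apply: le_trans ov; by rewrite truncn_le // mdist_ge0.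
Qed.

Lemma covering_lower_bound : equivariant_covering mu Z ->
  ep_as mu Z (fun D _ m => forall v, m v = 0%R \/ (1 <= m v)%R) ->
  \int[mu]_x W (repr x) <=
  (c * 6 `^ a)%:E * ep_expectation mu Z (fun D o m => (powR00 (m o) a)%:E).
Proof.
move=> [Z0 cov] val.
have mE := ps_measurable_ep_int Z powR_root_ge0 ps_measurable_powR_root.
have C0 : (0 <= c * 6 `^ a)%R by rewrite mulr_ge0 ?powR_ge0 // ltW.
have -> : ep_expectation mu Z (fun D o m => (powR00 (m o) a)%:E) =
    \int[mu]_x ep_int Z powR_root (repr x).
  apply: eq_integral => x _; apply: eq_integral => s _; rewrite /powR_root /=.
  rewrite (max_idPr _) //= /powR00; case: ifP => // _; exact: powR_ge0.
rewrite -ge0_integralZl_EFin //; last 2 first.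
- by move=> x _; apply: ep_int_ge0; exact: powR_root_ge0.
- exact: mE.2.
apply: (@le_trans _ _ (\int[mu]_x (\esum_(v in [set: ps_space (repr x)]) g (unmarked2 v (ps_root (repr x)))))).
  apply: ae_ge0_le_integral => //.
  - exact: mW.2.
  - by move=> x _; apply: esum_ge0.
  - exact: (ps_measurable_sum_unmarked2_swap g_ge0 mg).2.
  - by move: val; apply: filterS2 cov => x hc hv _; exact: in_mass.
rewrite -(mass_transport muU g_ge0 mg); apply: ge0_le_integral => //.
- by move=> x _; apply: esum_ge0.
- exact: (ps_measurable_sum_unmarked2 g_ge0 mg).2.
- by apply: measurable_funeM; exact: mE.2.
Qed.

End mass_distribution.

(** * The second inequality *)

Section upper_bound.
Variable R : realType.
Local Open Scope ereal_scope.

(** Growth at one point controls growth at every other one: the ball of radius [j] about [v] lies in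
    the ball of radius [j + d + r1] about [o]. Any [v] of positive weight is thus kept for a
    suitable constant. *)
Lemma bounded_growth_witness (D : discrete_space R) (m : D -> R) (o : D) (a : R) :
  (forall v, 0 <= m v)%R -> (0 <= a)%R -> 0 < total_weight m [set: D] ->
  upper_growth (fun r => total_weight m (nball r o)) < a%:E ->
  exists (c : nat) (v : D), 0 < bounded_growth_mark c.+1%:R a (marked v m).
Proof.
move=> m0 a0 mD /upper_growth_lt[r1 r11 Hr1].
have [v mv] : exists v, (0 < m v)%R.
  apply: contrapT => /forallNP h; move: mD; rewrite /total_weight esum1 ?ltxx // => v _.
  by congr (_%:E); apply/eqP; rewrite eq_le m0 andbT leNgt; apply/negP; exact: h.
pose d := mdist o v; have d0 : (0 <= d)%R by exact: mdist_ge0.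
(* For [1 <= j] one has [j + d + r1 <= (1 + d + r1) * j], and [C] is the power of this factor. *)
pose C := ((1 + d + r1) `^ a)%R.
exists (Num.truncn C), v; rewrite /bounded_growth_mark ifT.
  by rewrite lte_fin /= (max_idPr (m0 v)).
apply/asboolP => j; rewrite ball_weightE //.
have j1 : (1 <= j.+1%:R :> R)%R by rewrite ler1n.
apply: (@le_trans _ _ (total_weight m (nball (j.+1%:R + d + r1) o))).
  by apply: total_weight_le => //; apply: nball_sub; rewrite -/d; lra.
apply: (le_trans (Hr1 _ _)); first by lra.
rewrite lee_fin; apply: (@le_trans _ _ (C * j.+1%:R `^ a)%R); last first.
  by rewrite ler_wpM2r ?powR_ge0 // ltW // truncnS_gt.
rewrite /C -powRM //; last by lra.
apply: ge0_ler_powR => //; rewrite ?nnegrE; [lra|by rewrite mulr_ge0 //; lra|].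
rewrite -subr_ge0 (_ : _ - _ = (j.+1%:R - 1) * (d + r1))%R; last first.
  by rewrite mulrDl mulrBl mul1r !mulrDl mul1r !mulrDr !(mulrC j.+1%:R); lra.
by rewrite mulr_ge0 //; lra.
Qed.

Variables (mu : probability (pclass R 0 0) R) (w : equivariant_process R).
Hypotheses (muU : unimodular mu) (w0 : nonneg_process w).

Lemma expectation_bounded_growth_eq0 (c a : R) : (0 < c)%R -> (0 <= a)%R ->
  hausdorff_content mu 1 a = 0 ->
  \int[mu]_x ep_int w (bounded_growth_mark c a) (repr x) = 0.
Proof.
move=> c0 a0 h0; apply/eqP; rewrite eq_le; apply/andP; split; last first.
  by apply: integral_ge0 => x _; apply: ep_int_ge0 => Y; exact: bounded_growth_mark_ge0.
have C0 : (0 < c * 6 `^ a)%R by rewrite mulr_gt0 // powR_gt0.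
rewrite -[leRHS](mule0 (c * 6 `^ a)%:E) -lee_pdivrMl // -h0.
apply: le_ereal_inf_tmp => _ [Z [Zcov Zval ->]].
by rewrite lee_pdivrMl //; exact: covering_lower_bound.
Qed.

Lemma udimH_le_ess_inf :
  ep_as mu w (fun D o m => 0 < total_weight m [set: D]) ->
  udimH mu <= ep_ess_inf mu w (fun D o m =>
    upper_growth (fun r => total_weight m (nball r o))).
Proof.
move=> wpos; apply: ge_ereal_sup => _ [->|[a [a0 ha] <-]]; apply: ereal_sup_ubound => /=.
  (* The value 0 added to the set in [udimH]: a point of positive weight lies in all large balls,
     which makes the upper growth nonnegative. *)
  move: wpos; apply: filterS => x; apply: filterS => s; set m := ep_val s; set o := ps_root _ => mD.
  have m0 : (forall v, 0 <= m v)%R by exact: w0.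
  have [v mv] : exists v, (0 < m v)%R.
    apply: contrapT => /forallNP h; move: mD; rewrite /total_weight esum1 ?ltxx // => v _.
    by congr (_%:E); apply/eqP; rewrite eq_le m0 andbT leNgt; apply/negP; exact: h.
  apply: (upper_growth_ge0 (r0 := mdist o v + 1) mv) => r rv.
  rewrite /total_weight; apply: esum_ge; exists [set v]; last by rewrite fsbig_set1.
  split; first exact: finite_set1.
  by have := mdist_ge0 o v; move=> d0 _ ->; split; lra.
(* Integer constants are enough, since [bounded_growth_witness] rounds its constant up; the
   exceptional sets thus stay countable in number. *)
have Wae : {ae mu, forall x, forall (c : nat) (v : ps_space (repr x)),
    ep_int w (bounded_growth_mark c.+1%:R a) (unmarked v) = 0}.
  apply: ae_foralln => c; apply: ae_all_points => //.
  - by move=> X; apply: ep_int_ge0 => Y; exact: bounded_growth_mark_ge0.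
  - apply: ps_measurable_ep_int => [Y|]; first exact: bounded_growth_mark_ge0.
    exact: ps_measurable_bounded_growth_mark.
  - by apply: expectation_bounded_growth_eq0.
apply: filterS2 Wae wpos => x Wx wx.
have Fae : {ae ep_prob w (ps_space (repr x)), forall s, forall (c : nat) (v : ps_space (repr x)),
    bounded_growth_mark c.+1%:R a (marked v (ep_val s)) = 0}.
  apply: ae_foralln => c; apply: (ae_countable (countable_discrete_space _)) => v.
  have mF := measurable_marked v (ps_measurable_bounded_growth_mark c.+1%:R a).
  have F0 s : 0 <= bounded_growth_mark c.+1%:R a (marked v (@ep_val R w _ s)).
    exact: bounded_growth_mark_ge0.
  have := Wx c v; rewrite /ep_int => FI.
  have : \int[ep_prob w (ps_space (repr x))]_s `|bounded_growth_mark c.+1%:R a (marked v (ep_val s))| = 0.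
    by rewrite -FI; apply: eq_integral => s _; rewrite gee0_abs.
  by move/(ae_eq_integral_abs _ measurableT (mF _)); apply: filterS => s; exact.
apply: filterS2 Fae wx => s Fs mD; rewrite leNgt; apply/negP => ug.
have [c [v]] := bounded_growth_witness (w0 s) a0 mD ug.
by rewrite Fs ltxx.
Qed.

End upper_bound.

(** * Bernoulli selections of points *)

Section bernoulli_digits.
Variable R : realType.
Variables (q : nat -> R) (q01 : forall n, 0 <= q n <= 1).

(* The n-th digit tells in which part of the current interval [[a, a + l[ the
   number s lies, that interval being split in the ratio [q n : 1 - q n]. *)
Fixpoint digit_cell (n : nat) (s : R) : R * R :=
  if n is n'.+1 then
    let: (a, l) := digit_cell n' s in
    if s < a + q n' * l then (a, q n' * l) else (a + q n' * l, (1 - q n') * l)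
  else (0, 1).

Definition digit (n : nat) (s : R) : bool :=
  s < (digit_cell n s).1 + q n * (digit_cell n s).2.

Fixpoint word_cell (b : nat -> bool) (n : nat) : R * R :=
  if n is n'.+1 then
    let: (a, l) := word_cell b n' in
    if b n' then (a, q n' * l) else (a + q n' * l, (1 - q n') * l)
  else (0, 1).

Lemma word_cell_ge0 b n : 0 <= (word_cell b n).2.
Proof.
elim: n => [|n] //=; case: word_cell => a l /= l0.
by case/andP: (q01 n) => q0 q1; case: ifP => _ /=; rewrite mulr_ge0 // subr_ge0.
Qed.

Lemma digit_cellE (b : nat -> bool) n s : (forall i, (i < n)%N -> digit i s = b i) ->
  digit_cell n s = word_cell b n.
Proof.
elim: n => [//|n IH] h /=; rewrite -IH; last by move=> i /ltnW; exact: h.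
by have := h n (ltnSn n); rewrite /digit; case: digit_cell => a l /= ->.
Qed.

(** The cells are half-open, so those of one level are disjoint and cover [[0, 1[]: prescribing the
    first [n] digits of a number in [[0, 1[] amounts to placing it in one interval. *)
Lemma word_cellP (b : nat -> bool) n s :
  (0 <= s < 1 /\ forall i, (i < n)%N -> digit i s = b i) <->
  (word_cell b n).1 <= s < (word_cell b n).1 + (word_cell b n).2.
Proof.
elim: n => [|n IH]; first by rewrite /= add0r; split=> [[]|].
have wle0 := word_cell_ge0 b n; have /andP[q0 q1] := q01 n.
have h1 : 0 <= q n * (word_cell b n).2 by rewrite mulr_ge0.
have h2 : q n * (word_cell b n).2 + (1 - q n) * (word_cell b n).2 = (word_cell b n).2.
  by rewrite -mulrDl addrC subrK mul1r.
have h3 : 0 <= (1 - q n) * (word_cell b n).2 by rewrite mulr_ge0 // subr_ge0.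
split.
  move=> [s01 h].
  have hn : 0 <= s < 1 /\ forall i, (i < n)%N -> digit i s = b i.
    by split => // i /ltnW; exact: h.
  have := h n (ltnSn n); rewrite /digit (digit_cellE hn.2) /=.
  have /IH := hn; case: (word_cell b n) h1 h2 h3 => a l /= h1 h2 h3 /andP[as1 sal] <-.
  by case: ifP => /= [sa|/negbT]; [rewrite as1 sa|rewrite -leNgt => sa; rewrite sa /=; lra].
move=> sw.
have hn : 0 <= s < 1 /\ forall i, (i < n)%N -> digit i s = b i.
  apply/IH; move: sw => /=; case: (word_cell b n) h1 h2 h3 => a l /= h1 h2 h3.
  by case: ifP => _ /= /andP[s1 s2]; apply/andP; split; lra.
split; first exact: hn.1.
move=> i; rewrite ltnS leq_eqVlt => /orP[/eqP ->|]; last exact: hn.2.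
rewrite /digit (digit_cellE hn.2); move: sw => /=.
case: (word_cell b n) => a l /=; case: ifP => _ /= /andP[s1 s2] //.
by apply/negbTE; rewrite -leNgt.
Qed.

Lemma measurable_digit_cell n :
  measurable_fun setT (fun s : measurableTypeR R => (digit_cell n s).1) /\
  measurable_fun setT (fun s : measurableTypeR R => (digit_cell n s).2).
Proof.
elim: n => [|n [IH1 IH2]] /=; first by split; exact: measurable_cst.
have mq : measurable_fun setT (fun s : measurableTypeR R => q n * (digit_cell n s).2).
  exact: measurable_funM.
have md : measurable_fun setT (fun s : measurableTypeR R => s < (digit_cell n s).1 + q n * (digit_cell n s).2).
  by apply: measurable_fun_ltr => //; exact: measurable_funD.
split.
  rewrite (_ : (fun s => _) = (fun s => if s < (digit_cell n s).1 + q n * (digit_cell n s).2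
    then (digit_cell n s).1 else (digit_cell n s).1 + q n * (digit_cell n s).2)); last first.
    by apply/funext => s; case: (digit_cell n s) => a l /=; case: ifP.
  by apply: measurable_fun_ifT => //; exact: measurable_funD.
rewrite (_ : (fun s => _) = (fun s => if s < (digit_cell n s).1 + q n * (digit_cell n s).2
  then q n * (digit_cell n s).2 else (1 - q n) * (digit_cell n s).2)); last first.
  by apply/funext => s; case: (digit_cell n s) => a l /=; case: ifP.
by apply: measurable_fun_ifT => //; exact: measurable_funM.
Qed.

Lemma measurable_digit n : measurable_fun setT (digit n : measurableTypeR R -> bool).
Proof.
have [h1 h2] := measurable_digit_cell n.
by apply: measurable_fun_ltr => //; apply: measurable_funD => //; exact: measurable_funM.
Qed.

Local Open Scope ereal_scope.

Definition unit_measure : {measure set (measurableTypeR R) -> \bar R} :=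
  mrestr lebesgue_measure (measurable_itv `[0%R, 1%R[).

Definition digits_prob (F : seq nat) (b : nat -> bool) : R :=
  (\prod_(i <- F) (if b i then q i else 1 - q i))%R.

Definition digits_set (F : seq nat) (b : nat -> bool) : set (measurableTypeR R) :=
  [set s | forall i, i \in F -> digit i s = b i].

Lemma measurable_digits_set F b : measurable (digits_set F b).
Proof.
rewrite (_ : digits_set F b = \bigcap_(i in [set` F]) [set s | digit i s = b i]); last first.
  by apply/seteqP; split=> s h i; exact: h.
apply: fin_bigcap_measurable => [|i _]; first exact: finite_seq.
have mi := measurable_digit i; rewrite -[X in measurable X]setTI.
exact: (mi measurableT [set b i]).
Qed.

Lemma unit_measure_iota n b : unit_measure (digits_set (iota 0 n) b) = (digits_prob (iota 0 n) b)%:E.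
Proof.
rewrite /unit_measure /= /mrestr.
have -> : digits_set (iota 0 n) b `&` `[0%R, 1%R[%classic =
    `[(word_cell b n).1, ((word_cell b n).1 + (word_cell b n).2)%R[%classic.
  apply/seteqP; split=> s /=; rewrite !in_itv /=.
    by move=> [h s01]; apply/word_cellP; split => // i ilt; apply: h; rewrite mem_iota.
  move=> /word_cellP[s01 h]; split => // i; rewrite mem_iota /= add0n; exact: h.
rewrite lebesgue_measure_itv /= lte_fin ltrDl.
have -> : digits_prob (iota 0 n) b = (word_cell b n).2.
  rewrite /digits_prob; elim: n => [|n IH]; first by rewrite big_nil.
  rewrite -{1}addn1 iotaD big_cat IH /= big_seq1 add0n.
  by case: word_cell => a l /=; case: ifP => _ /=; rewrite mulrC.
case: ltP => h; first by rewrite -EFinB addrC addKr.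
by congr (_%:E); apply/eqP; rewrite eq_le h word_cell_ge0.
Qed.

(** Known for initial segments of indices. An index is removed by adding the probabilities of the
    two values of its digit, which sum to the weight of the others. *)
Lemma unit_measure_digits F b : uniq F -> unit_measure (digits_set F b) = (digits_prob F b)%:E.
Proof.
pose Phi F := forall b, unit_measure (digits_set F b) = (digits_prob F b)%:E.
have Phi_cons i F' : i \notin F' -> Phi (i :: F') -> Phi F'.
  move=> iF h b'.
  pose bb c j := if j == i then c else b' j.
  have -> : digits_set F' b' = digits_set (i :: F') (bb true) `|` digits_set (i :: F') (bb false).
    have FE c s : (forall j, j \in F' -> digit j s = b' j) -> digit i s = c ->
        forall j, j \in i :: F' -> digit j s = bb c j.
      move=> hs ic j; rewrite inE /bb; case: eqP => [-> //|_ /=]; exact: hs.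
    apply/seteqP; split=> s /=.
      by move=> hs; case E : (digit i s); [left|right]; apply: FE.
    by case=> hs j jF; rewrite hs ?inE ?jF ?orbT // /bb; case: eqP jF iF => // -> ->.
  rewrite measureU //; [|exact: measurable_digits_set|exact: measurable_digits_set|]; last first.
    apply/seteqP; split => // s [h1 h2].
    by have := h1 i (mem_head _ _); rewrite h2 ?mem_head // /bb eqxx.
  transitivity ((digits_prob (i :: F') (bb true))%:E + (digits_prob (i :: F') (bb false))%:E).
    by congr (_ + _); exact: h.
  rewrite -EFinD; congr (_%:E).
  have pe c : (\prod_(j <- F') (if bb c j then q j else 1 - q j))%R = digits_prob F' b'.
    apply: eq_big_seq => j jF; rewrite /bb; case: eqP jF iF => // -> ->.
    by [].
  by rewrite /digits_prob !big_cons !pe /bb eqxx -mulrDl addrC subrK mul1r.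
have Phi_cat A F' : uniq (A ++ F') -> Phi (A ++ F') -> Phi F'.
  elim: A => [//|i A IH] /= /andP[iA uA] h; apply: IH => //.
  exact: Phi_cons h.
move=> uF; move: b; change (Phi F).
pose n := (\max_(i <- F) i).+1.
have Fn i : i \in F -> (i < n)%N by move=> iF; rewrite ltnS; exact: leq_bigmax_seq.
apply: (@Phi_cat [seq i <- iota 0 n | i \notin F]).
  rewrite cat_uniq filter_uniq ?iota_uniq // uF andTb andbT; apply/hasPn => i iF.
  by rewrite mem_filter iF.
have pe : perm_eq (iota 0 n) ([seq i <- iota 0 n | i \notin F] ++ F).
  apply: uniq_perm; first exact: iota_uniq.
    rewrite cat_uniq filter_uniq ?iota_uniq // uF andTb andbT; apply/hasPn => i iF.
    by rewrite mem_filter iF.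
  move=> i; rewrite mem_cat mem_filter mem_iota /= add0n.
  by case: (boolP (i \in F)) => [/Fn ->|_] //=; rewrite orbF.
move=> b; have <- : digits_prob (iota 0 n) b = digits_prob ([seq i <- iota 0 n | i \notin F] ++ F) b.
  exact: perm_big.
rewrite -unit_measure_iota; congr (unit_measure _).
by apply/seteqP; split=> s h i iF; apply: h; rewrite ?(perm_mem pe) // -(perm_mem pe).
Qed.

End bernoulli_digits.

Section bernoulli_product.
Context (R : realType) (T : choiceType).

Definition coordinate_sets : set (set (T -> bool)) :=
  [set C | exists t, C = [set sigma : T -> bool | sigma t]].

Definition selection := g_sigma_algebraType coordinate_sets.

Lemma measurable_selection_at (t : T) : measurable_fun [set: selection] (fun sigma : selection => sigma t).
Proof.
apply: (@measurable_fun_bool _ _ _ _ true); rewrite setTI.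
by apply: sub_gen_smallest; exists t.
Qed.

(** All coins are read off one uniform number: the coin of [t] is the digit of index
    [cnt_index cT t]. Indices without a point get success probability 0. *)
Lemma bernoulli_product (p : T -> R) : countable [set: T] -> (forall t, 0 <= p t <= 1) ->
  exists beta : probability selection R, forall (F : seq T) (b : T -> bool), uniq F ->
    beta [set sigma | forall t, t \in F -> sigma t = b t] =
    (\prod_(t <- F) (if b t then p t else 1 - p t))%:E.
Proof.
move=> cT p01.
pose q n := if cnt_unindex cT n is Some t then p t else 0.
have q01 n : 0 <= q n <= 1 by rewrite /q; case: cnt_unindex => [t|]; [exact: p01|rewrite lexx ler01].
pose f (s : measurableTypeR R) : selection := fun t => digit q (cnt_index cT t) s.
have mf : measurable_fun setT f.
  apply: measurability => // _ [_ [t ->] <-]; rewrite setTI.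
  have mi := measurable_digit q (cnt_index cT t); rewrite -[X in measurable X]setTI.
  exact: (mi measurableT [set true]).
pose nu : {measure set selection -> \bar R} :=
  measure_function_pushforward__canonical__measure_function_Measure (unit_measure R) mf.
have nuE (F : seq T) (b : T -> bool) : uniq F ->
    nu [set sigma | forall t, t \in F -> sigma t = b t] =
    (\prod_(t <- F) (if b t then p t else 1 - p t))%:E.
  move=> uF; pose b' n := if cnt_unindex cT n is Some t then b t else false.
  have := @unit_measure_digits R q q01 (map (cnt_index cT) F) b'.
  rewrite map_inj_uniq; last exact: cnt_index_inj.
  move=> /(_ uF) H; rewrite /nu /= /pushforward.
  rewrite (_ : _ @^-1` _ = digits_set q (map (cnt_index cT) F) b').
    rewrite [LHS]H /digits_prob big_map; congr (_%:E); apply: eq_bigr => t _.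
    by rewrite /b' /q cnt_indexK.
  apply/seteqP; split=> s h.
    by move=> _ /mapP[t tF ->]; rewrite /b' cnt_indexK; exact: h.
  by move=> t tF; have := h _ (map_f (cnt_index cT) tF); rewrite /b' cnt_indexK.
have nu1 : nu setT = 1%E.
  have := nuE [::] (fun=> true) isT; rewrite big_nil => <-; congr (nu _).
  by apply/seteqP; split.
exists (HB.pack_for (probability selection R) (Measure.sort nu) (Measure.class nu)
   (Measure_isProbability.Build _ _ _ nu nu1)).
exact: nuE.
Qed.

End bernoulli_product.

(** * Random coverings *)

Section selection_laws.
Context (R : realType) (T : choiceType).

Definition all_selected (F : seq T) : set (selection T) :=
  [set sigma | forall t, t \in F -> sigma t].

Lemma measurable_word (F : seq T) (b : T -> bool) :
  measurable ([set sigma | forall t, t \in F -> sigma t = b t] : set (selection T)).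
Proof.
rewrite (_ : mkset _ = \bigcap_(t in [set` F]) [set sigma : selection T | sigma t = b t]); last first.
  by apply/seteqP; split=> s h t; exact: h.
apply: fin_bigcap_measurable => [|t _]; first exact: finite_seq.
have mt := measurable_selection_at t; rewrite -[X in measurable X]setTI.
exact: (mt measurableT [set b t]).
Qed.

(** The events [all_selected F] generate the sigma-algebra and are stable under intersection, which
    corresponds to the union of the lists. *)
Lemma selection_measure_unique (m1 m2 : {measure set (selection T) -> \bar R}) :
  (m1 setT < +oo)%E -> (forall F : seq T, uniq F -> m1 (all_selected F) = m2 (all_selected F)) ->
  forall A, measurable A -> m1 A = m2 A.
Proof.
move=> m1T m12.
pose G : set (set (selection T)) := [set C | exists2 F : seq T, uniq F & C = all_selected F].
have GI : setI_closed G.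
  move=> _ _ [F _ ->] [F' _ ->]; exists (undup (F ++ F')); first exact: undup_uniq.
  apply/seteqP; split=> s /=.
    by move=> [h h'] t; rewrite mem_undup mem_cat => /orP[/h|/h'].
  by move=> h; split=> t tF; apply: h; rewrite mem_undup mem_cat tF ?orbT.
have T0 : all_selected [::] = setT by apply/seteqP; split.
move=> A mA; apply: (@g_sigma_algebra_measure_unique _ _ _ G _ (fun=> setT)) => //.
- by move=> _ [F _ ->]; exact: (measurable_word F (fun=> true)).
- by move=> i; exists [::].
- by rewrite bigcup_const //; exists 0%N.
- by move=> _ [F uF ->]; exact: m12.
- move: A mA; apply: sub_sigma_algebra2 => _ [t ->].
  exists [:: t] => //; apply/seteqP; split=> s /=.
    by move=> st u; rewrite inE => /eqP ->.
  by move=> h; apply: h; rewrite mem_head.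
Qed.

End selection_laws.

Section bernoulli_covering.
Variable R : realType.
Variables (a : pspace R 0 0 -> R) (ma : ps_measurable a) (a0 : forall X, 0 <= a X).
Variables (r0 : R) (r01 : 1 <= r0).
Implicit Types D : discrete_space R.

(** Chosen so that the probability of selecting nobody in a finite set is the exponential of minus
    the sum of [a] over it. *)
Definition select_prob D (v : D) : R := 1 - expR (- a (unmarked v)).

Lemma select_prob01 D (v : D) : 0 <= select_prob v <= 1.
Proof.
by rewrite /select_prob subr_ge0 gerBl expR_ge0 andbT -[leRHS]expR0 ler_expR oppr_le0.
Qed.

Definition select_law D : probability (selection D) R :=
  sval (cid (bernoulli_product (countable_discrete_space D) (@select_prob01 D))).

Lemma select_lawE D (F : seq D) (b : D -> bool) : uniq F ->
  select_law D [set sigma | forall t, t \in F -> sigma t = b t] =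
    (\prod_(t <- F) (if b t then select_prob t else 1 - select_prob t))%:E.
Proof. by move: F b; rewrite /select_law; case: cid. Qed.

(* Selected points carry balls of radius [r0]; the points which are not covered
   by these balls carry balls of radius 1. *)
Definition cover_radius D (sigma : D -> bool) (v : D) : R :=
  if sigma v then r0 else
  if `[< exists u, sigma u /\ mdist v u <= r0 >] then 0 else 1.

(** This finite range of dependence is what makes the law of the covering computable on local
    events. *)
Lemma cover_radius_local D (sigma sigma' : D -> bool) (v : D) :
  (forall u, mdist v u <= r0 -> sigma u = sigma' u) ->
  cover_radius sigma v = cover_radius sigma' v.
Proof.
move=> h; rewrite /cover_radius h; last by rewrite mdistxx (le_trans _ r01).
case: ifP => // _; congr (if _ then _ else _); apply: asbool_equiv_eq.
by split=> -[u [su vu]]; exists u; rewrite ?h // -h.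
Qed.

Lemma measurable_cover_radius D (v : D) :
  measurable_fun [set: selection D] (fun sigma : selection D => cover_radius sigma v).
Proof.
apply: measurable_fun_ifT; [exact: measurable_selection_at|exact: measurable_cst|].
apply: measurable_fun_ifT; [|exact: measurable_cst|exact: measurable_cst].
apply: (@measurable_fun_bool _ _ _ _ true); rewrite setTI.
rewrite (_ : _ @^-1` _ = \bigcup_(u : D) [set sigma : selection D | sigma u /\ mdist v u <= r0]); last first.
  by apply/seteqP; split=> s /= => [/asboolP[u su]|[u _ su]]; [exists u|apply/asboolP; exists u].
apply: countable_bigcupT_measurable; first exact: countable_discrete_space.
move=> u; have [vu|vu] := boolP (mdist v u <= r0); last first.
  by rewrite (_ : mkset _ = set0) //; apply/seteqP; split => // s [].
rewrite (_ : mkset _ = [set sigma : selection D | sigma u]).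
  by have mt := measurable_selection_at u; rewrite -[X in measurable X]setTI; exact: (mt measurableT [set true]).
by apply/seteqP; split=> s; [case|].
Qed.

Lemma cover_radius_comp D1 D2 (rho : D1 -> D2) (sigma : D2 -> bool) :
  ds_isometry rho -> cover_radius sigma \o rho = cover_radius (sigma \o rho).
Proof.
move=> [[tau rhoK tauK] rhoD]; apply/funext => v; rewrite /cover_radius /=.
case: ifP => // _; congr (if _ then _ else _); apply: asbool_equiv_eq.
split=> -[u [su vu]]; last by exists (rho u); rewrite rhoD.
by exists (tau u); rewrite tauK -rhoD tauK.
Qed.

Lemma select_law_iso D1 D2 (rho : D1 -> D2) (S : set (selection D1)) :
  ds_isometry rho -> measurable S ->
  select_law D2 [set sigma : selection D2 | S ((sigma : D2 -> bool) \o rho)] = select_law D1 S.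
Proof.
move=> rhoi mS.
pose f (sigma : selection D2) : selection D1 := (sigma : D2 -> bool) \o rho.
have mf : measurable_fun setT f.
  apply: measurability => // _ [_ [t ->] <-]; rewrite setTI.
  have mt := measurable_selection_at (rho t); rewrite -[X in measurable X]setTI.
  exact: (mt measurableT [set true]).
pose nu : {measure set (selection D1) -> \bar R} :=
  measure_function_pushforward__canonical__measure_function_Measure (select_law D2) mf.
apply: esym; apply: (@selection_measure_unique _ _ (select_law D1) nu) mS => [|F uF].
  by have := ltry (1%R : R); rewrite -(probability_setT (select_law D1)).
have rhoinj : injective rho by exact: bij_inj rhoi.1.
transitivity (\prod_(t <- F) select_prob t)%:E; first exact: (@select_lawE D1 F (fun=> true) uF).
have -> : nu (all_selected F) =
    select_law D2 [set sigma | forall t, t \in map rho F -> sigma t = true].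
  congr (select_law D2 _); apply/seteqP; split=> s h t.
    by move=> /mapP[u uF' ->]; exact: h.
  by move=> tF; apply: (h (rho t)); exact: map_f.
have uF2 : uniq (map rho F) by rewrite map_inj_uniq.
apply: esym; apply: (etrans (@select_lawE D2 (map rho F) (fun=> true) uF2)).
rewrite big_map; congr (_%:E); apply: eq_bigr => t _; rewrite /select_prob; congr (1 - expR (- _)).
by apply: esym; apply: ma.1; exists rho; split.
Qed.

Lemma cover_equivariant D1 D2 (rho : D1 -> D2) : ds_isometry rho ->
  forall B, marking_measurable B ->
  select_law D2 [set sigma : selection D2 | B (cover_radius (sigma : D2 -> bool) \o rho)] =
  select_law D1 [set sigma : selection D1 | B (cover_radius (sigma : D1 -> bool))].
Proof.
move=> rhoi B mB; rewrite -(select_law_iso rhoi); last first.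
  pose f (sigma : selection D1) : g_sigma_algebraType (\bigcup_(v in [set: D1])
        preimage_set_system [set: D1 -> R] (fun m => m v) (@measurable _ (measurableTypeR R))) := cover_radius sigma.
  have mf : measurable_fun setT f.
    apply: measurability => // _ [_ [v _ [C mC <-]] <-]; rewrite !setTI.
    have mv := measurable_cover_radius v; rewrite -[X in measurable X]setTI.
    exact: (mv measurableT C).
  by rewrite -[X in measurable X]setTI; exact: (mf measurableT B).
congr (select_law D2 _); apply/seteqP; split=> s /=; by rewrite cover_radius_comp.
Qed.

Lemma measurable_cover D (v : D) :
  measurable_fun [set: selection D] (fun sigma : selection D => pt1m v (cover_radius sigma)).
Proof.
apply: (@measurable_random_marks _ _ _ D (fun=> v) _ _ (fun (s : selection D) _ => cover_radius s)) => _ u.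
exact: measurable_cover_radius.
Qed.

Definition cover_law (X : pspace R 0 0) : {measure set (pclass R 0 1) -> \bar R} :=
  measure_function_pushforward__canonical__measure_function_Measure
    (select_law (ps_space X)) (@measurable_cover (ps_space X) (ps_root X)).

Definition mark_local (r : R) (A : set (pclass R 0 1)) :=
  forall D (o : D) (m m' : D -> R), (forall v, mdist o v <= r -> m v = m' v) ->
    A (pt1m o m) -> A (pt1m o m').

Definition word_selection D N (v : 'I_N -> D) (b : {ffun 'I_N -> bool}) : selection D :=
  fun u => [exists i, b i && (u == v i)].

Definition enumerates_ball (r : R) D (o : D) N (v : 'I_N -> D) :=
  [/\ injective v, forall i, mdist o (v i) <= r & forall x, mdist o x <= r -> exists i, x = v i].

Lemma ball_enumeration (r : R) D (o : D) : exists N (v : 'I_N -> D), enumerates_ball r o v.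
Proof.
have /finite_seqP[s sE] := @finite_closed_ball R D o r.
have sP x : (x \in undup s) = (mdist o x <= r).
  rewrite mem_undup; apply/idP/idP => xs; first by have : [set` s] x by []; rewrite -sE.
  by have : [set` s] x by rewrite -sE.
exists (size (undup s)), (tnth (in_tuple (undup s))); split.
- by apply/tuple_uniqP; exact: undup_uniq.
- by move=> i; rewrite -sP; exact: mem_tnth.
- move=> x; rewrite -sP => /(nthP x)[i si xi]; exists (Ordinal si).
  by rewrite (tnth_nth x).
Qed.

Definition word_weight D N (v : 'I_N -> D) (b : {ffun 'I_N -> bool}) : R :=
  \prod_i (if b i then select_prob (v i) else 1 - select_prob (v i)).

Lemma word_selectionE D N (v : 'I_N -> D) (b : {ffun 'I_N -> bool}) i :
  injective v -> word_selection v b (v i) = b i.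
Proof.
move=> vi; apply/existsP/idP => [[j /andP[bj /eqP/vi ->]] //|bi].
by exists i; rewrite bi eqxx.
Qed.

(** Marks within [r] of the root are decided by the selection within [r + r0]. Splitting along the
    finitely many selections of that ball turns the law into a finite sum. *)
Lemma cover_law_local r A (o : pspace R 0 0) N (v : 'I_N -> ps_space o) :
  measurable A -> mark_local r A -> enumerates_ball (r + r0) (ps_root o) v ->
  cover_law o A = (\sum_(b : {ffun 'I_N -> bool})
    word_weight v b * \1_A (pt1m (ps_root o) (cover_radius (word_selection v b))))%:E.
Proof.
move=> mA lA [vi vr rv].
pose S : set (selection (ps_space o)) := [set s | A (pt1m (ps_root o) (cover_radius s))].
have -> : cover_law o A = select_law (ps_space o) S by [].
have mS : measurable S.
  by have := measurable_cover (ps_root o) measurableT mA; rewrite setTI.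
pose C (b : {ffun 'I_N -> bool}) : set (selection (ps_space o)) :=
  [set s | forall t, t \in codom v -> s t = word_selection v b t].
have mC b : measurable (C b) by exact: measurable_word.
have CE b s : C b s <-> forall i, s (v i) = b i.
  split=> [h i|h t /codomP[i ->]]; first by rewrite h ?codom_f // word_selectionE.
  by rewrite h word_selectionE.
have SE : S = \bigcup_(b in [set: {ffun 'I_N -> bool}]) (S `&` C b).
  apply/seteqP; split=> [s Ss|s [b _ []] //].
  by exists [ffun i => s (v i)] => //; split => //; apply/CE => i; rewrite ffunE.
have finT : finite_set [set: {ffun 'I_N -> bool}] by exact: finite_finset.
rewrite SE measure_fin_bigcup //; last 2 first.
- move=> b b' _ _ [s [[_ /CE sb] [_ /CE sb']]].
  by apply/ffunP => i; rewrite -sb -sb'.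
- by move=> b _; exact: measurableI.
rewrite (_ : setT = [set` enum {: {ffun 'I_N -> bool}}]); last first.
  by apply/seteqP; split => // b _; rewrite /= mem_enum.
rewrite -fsbig_seq ?enum_uniq // big_enum -sumEFin; apply: eq_bigr => b _.
have agree s : C b s -> forall u, mdist (ps_root o) u <= r -> cover_radius s u = cover_radius (word_selection v b) u.
  move=> /CE sb u ur; apply: cover_radius_local => u' uu'.
  have [|i ->] := rv u'; last by rewrite sb word_selectionE.
  by apply: (le_trans (metric_triangle _ u _)); exact: lerD.
have CbE : select_law (ps_space o) (C b) = (word_weight v b)%:E.
  have uv : uniq (codom v) by exact/injectiveP.
  apply: (etrans (@select_lawE _ (codom v) (word_selection v b) uv)); congr (_%:E).
  rewrite /codom big_image /word_weight; apply: eq_bigr => i _.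
  by rewrite word_selectionE.
rewrite indicE; have [/set_mem Ab|/negP nAb] := boolP (_ \in A).
  rewrite mulr1 -CbE; congr (select_law _ _); apply/seteqP; split=> s; first by case.
  move=> Cs; split => //; apply: lA Ab => u ur; exact/esym/agree.
rewrite mulr0 (_ : S `&` C b = set0) ?measure0 //.
apply/seteqP; split => // s [As Cs]; apply: nAb; apply: mem_set.
by apply: lA As => u; exact: agree.
Qed.

Definition ps_enumerates N (r : R) (Y : pspace R N 0) (st : 'I_N -> 'I_N.+1) : bool :=
  [&& [forall i, [forall j, (i != j) ==> (0 < ps_dist (st i) (st j) Y)]],
      [forall i, ps_dist ord0 (st i) Y <= r] &
      `[< forall v : 'I_1 -> ps_space Y, mdist (ps_root Y) (v ord0) <= r ->
          exists i, v ord0 = ps_point Y (st i) >]].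

Lemma ps_enumeratesP N r (X : pspace R 0 0) (v : 'I_N -> ps_space X) :
  ps_enumerates r (ps_extend v : pspace R N 0) (newpt 0 (N := N)) <-> enumerates_ball r (ps_root X) v.
Proof.
have root : ps_point (ps_extend v) ord0 = ps_root X by exact: ps_root_extend.
split.
  move=> /and3P[/forallP h1 /forallP h2 /asboolP h3]; split.
  - move=> i j vij; apply/eqP; apply: contraT => ij.
    by have := implyP (forallP (h1 i) j) ij; rewrite /ps_dist !ps_extend_new vij mdistxx ltxx.
  - by move=> i; have := h2 i; rewrite /ps_dist ps_extend_new root.
  - move=> x xr; have := h3 (fun=> x); rewrite /ps_root root => /(_ xr)[i ->].
    by exists i; rewrite ps_extend_new.
move=> [vi vr rv]; apply/and3P; split.
- apply/forallP => i; apply/forallP => j; apply/implyP => ij.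
  by rewrite /ps_dist !ps_extend_new mdist_gt0; apply: contra ij => /eqP/vi ->.
- by apply/forallP => i; rewrite /ps_dist ps_extend_new root.
- apply/asboolP => u; rewrite /ps_root root => /rv[i ->].
  by exists i; rewrite ps_extend_new.
Qed.

Lemma ps_measurable_enumerates N r st : ps_measurable (fun Y : pspace R N 0 => ps_enumerates r Y st).
Proof.
apply: ps_measurable_and.
  apply: ps_measurable_forallb => i; apply: ps_measurable_forallb => j.
  case: (i != j) => /=; last exact: ps_measurable_cst.
  by apply: ps_measurable_lt; [exact: ps_measurable_cst|exact: ps_measurable_dist].
apply: ps_measurable_and.
  apply: ps_measurable_forallb => i.
  by apply: ps_measurable_le; [exact: ps_measurable_dist|exact: ps_measurable_cst].
pose P (Z : pspace R (N + 1) 0) := (r < ps_dist (oldpt 1 ord0) (newpt N ord0) Z) ||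
   [exists i, ps_dist (oldpt 1 (st i)) (newpt N ord0) Z <= 0].
apply: (@ps_measurable_eq _ _ _ _ _ (fun Z => `[< forall v : 'I_1 -> ps_space Z, P (ps_extend v) >])).
  move=> Z; apply: asbool_equiv_eq; split=> h v.
    move=> vl; have /orP[|/existsP[i]] := h v; rewrite /ps_dist ps_extend_new ps_extend_old.
      by rewrite ltNge => /negP[].
    by move=> h0; exists i; apply/esym/mdist_positivity/le_anti; rewrite h0 mdist_ge0.
  rewrite /P /ps_dist ps_extend_new ps_extend_old ltNge; case: (boolP (_ <= _)) => // vl.
  have [i vi] := h v vl; apply/existsP; exists i.
  by rewrite ps_extend_old vi mdistxx.
apply: ps_measurable_forall; apply: ps_measurable_or.
  by apply: ps_measurable_lt; [exact: ps_measurable_cst|exact: ps_measurable_dist].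
apply: ps_measurable_existsb => i.
by apply: ps_measurable_le; [exact: ps_measurable_dist|exact: ps_measurable_cst].
Qed.

(** [cover_radius] rewritten through distances to the listed points, as a functional of the extended
    space; [d i <= 0] says that the point is the [i]-th listed one. *)
Definition word_radius N (b : {ffun 'I_N -> bool}) (Z : pspace R (N + 1) 0) : R :=
  let d i := ps_dist (newpt N ord0) (oldpt 1 (newpt 0 i)) Z in
  if [exists i, b i && (d i <= 0)] then r0 else
  if [exists i, b i && (d i <= r0)] then 0 else 1.

Lemma ps_measurable_word_radius N b : ps_measurable (@word_radius N b).
Proof.
have md c : ps_measurable (fun Z : pspace R (N + 1) 0 =>
    [exists i, b i && (ps_dist (newpt N ord0) (oldpt 1 (newpt 0 i)) Z <= c)]).
  apply: ps_measurable_existsb => i; case: (b i) => /=; last exact: ps_measurable_cst.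
  by apply: ps_measurable_le; [exact: ps_measurable_dist|exact: ps_measurable_cst].
apply: (ps_measurable_if (md 0)); first exact: ps_measurable_cst.
by apply: (ps_measurable_if (md r0)); exact: ps_measurable_cst.
Qed.

Lemma word_radiusE N (b : {ffun 'I_N -> bool}) (X : pspace R 0 0) (v : 'I_N -> ps_space X) :
  to_class (@ps_remark R N 0 0 1 (fun _ => ord0) (fun _ => word_radius b) (ps_extend v)) =
  pt1m (ps_root X) (cover_radius (word_selection v b)).
Proof.
congr to_class; rewrite /ps_remark /=; congr PSpace.
  by apply/funext => i; exact: (ps_root_extend v).
apply/funext => j; apply/funext => x; rewrite /word_radius /cover_radius /ps_dist.
have E i : ps_point (ps_extend (fun _ : 'I_1 => x : ps_space (ps_extend v))) (oldpt 1 (newpt 0 i)) = v i.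
  by rewrite ps_extend_old ps_extend_new.
rewrite (_ : [exists i, _] = word_selection v b x).
  case: ifP => // _; rewrite (_ : [exists i, _] = `[< exists u, word_selection v b u /\ mdist x u <= r0 >]) //.
  apply/existsP/asboolP => [[i /andP[bi]]|[u [/existsP[i /andP[bi /eqP ->]] xv]]].
    rewrite ps_extend_new E => xv; exists (v i); split => //.
    by apply/existsP; exists i; rewrite bi eqxx.
  by exists i; rewrite bi ps_extend_new E.
apply: eq_existsb => i; congr andb; rewrite ps_extend_new E.
apply/idP/eqP => [h|->]; last by rewrite mdistxx.
by apply: mdist_positivity; apply/le_anti; rewrite h mdist_ge0.
Qed.

Definition word_sum N A (Y : pspace R N 0) : R :=
  \sum_(b : {ffun 'I_N -> bool})
    (\prod_i (if b i then 1 - expR (- a (ps_select (fun _ : 'I_1 => newpt 0 i) Y))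
              else 1 - (1 - expR (- a (ps_select (fun _ : 'I_1 => newpt 0 i) Y))))) *
    \1_A (to_class (@ps_remark R N 0 0 1 (fun _ => ord0) (fun _ => word_radius b) Y)).

Lemma ps_measurable_sumr n k (I : Type) (s : seq I) (f : I -> pspace R n k -> R) :
  (forall i, ps_measurable (f i)) -> ps_measurable (fun X => \sum_(i <- s) f i X).
Proof.
move=> mf; split=> [X Y XY|]; first by apply: eq_bigr => i _; exact: (mf i).1.
by apply: measurable_sum => i; exact: (mf i).2.
Qed.

Lemma ps_measurable_prodr n k (I : eqType) (s : seq I) (f : I -> pspace R n k -> R) :
  (forall i, ps_measurable (f i)) -> ps_measurable (fun X => \prod_(i <- s) f i X).
Proof.
move=> mf; split=> [X Y XY|]; first by apply: eq_bigr => i _; exact: (mf i).1.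
by apply: measurable_prod => i _; exact: (mf i).2.
Qed.

Lemma ps_measurable_word_sum N A : measurable A -> ps_measurable (@word_sum N A).
Proof.
move=> mA; apply: ps_measurable_sumr => b.
apply: (ps_measurable_lift2 (op := fun x y : R => x * y)).
- by move=> u v mu mv; exact: measurable_funM.
- apply: ps_measurable_prodr => i.
  have mp : ps_measurable (fun Y : pspace R N 0 => 1 - expR (- a (ps_select (fun _ : 'I_1 => newpt 0 i) Y))).
    apply: (ps_measurable_comp (g := fun x : R => 1 - expR (- x))).
      apply: measurable_funB => //; apply: (@measurableT_comp _ _ _ _ _ _ (@expR R)) => //.
    by apply: ps_measurable_map => //; exact: ps_measurable_select.
  case: (b i) => //.
  apply: (ps_measurable_comp (g := fun x : R => 1 - x)) mp.
  exact: measurable_funB.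
- apply: (ps_measurable_comp (g := \1_A : pclass R 0 1 -> R)); first exact: measurable_indic.
  by apply: ps_measurable_remark => j; exact: ps_measurable_word_radius.
Qed.

(** No enumeration of the ball is chosen measurably. Since every enumeration yields the same value,
    the law exceeds [c] exactly when some tuple enumerates the ball and has its word sum above [c],
    and such existence is measurable. *)
Lemma measurable_cover_law_local r A : measurable A -> mark_local r A ->
  measurable_fun [set: pclass R 0 0] (fun x : pclass R 0 0 => cover_law (repr x) A).
Proof.
move=> mA lA.
have lawE (X : pspace R 0 0) N (v : 'I_N -> ps_space X) : enumerates_ball (r + r0) (ps_root X) v ->
    cover_law X A = (word_sum A (ps_extend v : pspace R N 0))%:E.
  move=> /(cover_law_local mA lA) ->; congr (_%:E); apply: eq_bigr => b _.
  rewrite word_radiusE; congr (_ * _); apply: eq_bigr => i _.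
  rewrite /select_prob; have -> : unmarked (v i) = ps_select (fun=> newpt 0 i) (ps_extend v : pspace R N 0).
    rewrite /unmarked /ps_select /=; congr PSpace; last by apply/funext => -[].
    by apply/funext => j; rewrite -[RHS]/(ps_point (ps_extend v) (newpt 0 i)) ps_extend_new.
  by [].
apply: measurability (ErealGenOInfty.measurableE R) _.
move=> _ [_ [c ->] <-]; rewrite setTI.
pose P N (X : pspace R 0 0) := `[< exists v : 'I_N -> ps_space X,
  ps_enumerates (r + r0) (ps_extend v : pspace R N 0) (newpt 0 (N := N)) &&
  (c < word_sum A (ps_extend v : pspace R N 0)) >].
have mP N : ps_measurable (P N).
  apply: (@ps_measurable_exists R 0 0 N (fun Y => ps_enumerates (r + r0) Y (newpt 0 (N := N)) && (c < word_sum A Y))).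
  apply: ps_measurable_and; first exact: ps_measurable_enumerates.
  by apply: ps_measurable_lt; [exact: ps_measurable_cst|exact: ps_measurable_word_sum].
rewrite (_ : _ @^-1` _ = \bigcup_N [set x | P N (repr x)]).
  by apply: bigcup_measurable => N _; exact: ((ps_measurable_boolP _).1 (mP N)).2.
apply/seteqP; split=> x /=; rewrite in_itv /= andbT.
  have [N [v ev]] := ball_enumeration (r + r0) (ps_root (repr x)).
  rewrite (lawE _ _ v ev) lte_fin => cx; exists N => //; apply/asboolP; exists v.
  by rewrite cx andbT; apply/ps_enumeratesP.
move=> [N _ /asboolP[v /andP[/ps_enumeratesP ev cx]]].
by rewrite (lawE _ _ v ev) lte_fin.
Qed.

Lemma mark_local_pattern (q : ps_pattern 0 1) :
  mark_local (projT2 q).2.+1%:R [set x : pclass R 0 1 | has_pattern q (repr x)].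
Proof.
move=> D o m m' mm' /=; rewrite !((@has_pattern_measurable R _ _ q).1 _ _ (repr_to_class _)).
case: q mm' => N [[dq mq] l] /= mm' /asboolP[/= v /and4P[h1 /forallP h2 h3 h4]].
apply/asboolP; exists v; apply/and4P; split => //.
apply/forallP => j; apply/forallP => i; have := forallP (h2 j) i.
rewrite /ps_label /= -mm' //; move: i; apply: extend_pointP => i.
  by rewrite /oldpt (unsplitK (inl i)) mdistxx.
have := forallP h3 i; rewrite /ps_dist ps_extend_old ps_extend_new /= /newpt (unsplitK (inr i)).
exact.
Qed.

(** Pattern events are local and generate the Borel sets. Local events are stable under
    intersection, with the larger of the two radii, so Dynkin induction extends the local case. *)
Lemma measurable_cover_law A : measurable A ->
  measurable_fun [set: pclass R 0 0] (fun x : pclass R 0 0 => cover_law (repr x) A).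
Proof.
pose G : set (set (pclass R 0 1)) := [set A | measurable A /\ exists r, mark_local r A].
have lawT X : cover_law X setT = 1%E by exact: (probability_setT (select_law (ps_space X))).
have mG : @measurable _ (pclass R 0 1) = <<s G >>.
  apply/seteqP; split.
    apply: smallest_sub; first exact: smallest_sigma_algebra.
    move=> U oU.
    pose Q := [set q : ps_pattern 0 1 | forall Y, has_pattern q Y -> U (to_class Y)].
    have -> : U = \bigcup_(q in Q) [set x : pclass R 0 1 | has_pattern q (repr x)].
      apply/seteqP; split=> [x Ux|x [q Qq /= xq]]; last by rewrite -(to_class_repr x); exact: Qq.
      rewrite -(to_class_repr x) in Ux.
      by have [q qx qU] := GH_open_pattern oU Ux; exists q.
    rewrite bigcup_mkcond.
    apply: (@countable_bigcupT_measurable _ (g_sigma_algebraType G)); first exact: countableP.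
    move=> q; case: ifP => // _; apply: sub_gen_smallest; split.
      exact: ((ps_measurable_boolP _).1 (@has_pattern_measurable R _ _ q)).2.
    by exists (projT2 q).2.+1%:R; exact: mark_local_pattern.
  by apply: smallest_sub; [exact: sigma_algebra_measurable|move=> B []].
move=> mA; move: (mA); rewrite mG; move: A {mA}; apply: dynkin_induction => //.
- move=> B B' [mB [r rB]] [mB' [r' rB']]; split; first exact: measurableI.
  exists (Num.max r r') => D o m m' mm' [Bm B'm]; split.
    by apply: rB Bm => v vr; apply: mm'; rewrite le_max vr.
  by apply: rB' B'm => v vr; apply: mm'; rewrite le_max vr orbT.
- by under eq_fun do rewrite lawT; exact: measurable_cst.
- by move=> B [mB [r rB]]; exact: measurable_cover_law_local rB.
- move=> B mB mPB.
  have lawC X : cover_law X (~` B) = (1 - cover_law X B)%E.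
    have mB' : measurable ((fun s : selection (ps_space X) => pt1m (ps_root X) (cover_radius s)) @^-1` B).
      by rewrite -[X in measurable X]setTI; exact: (measurable_cover (ps_root X) measurableT).
    exact: (probability_setC (select_law (ps_space X)) mB').
  under eq_fun do rewrite lawC.
  by apply: emeasurable_funB => //; exact: measurable_cst.
- move=> F mF tF mPF.
  under eq_fun => x.
    rewrite measure_semi_bigcup //; last exact: bigcupT_measurable.
    over.
  by apply: ge0_emeasurable_sum.
Qed.

Definition covering_process : equivariant_process R :=
  @EquivariantProcess R (fun D => (sigma_display (@coordinate_sets D)))
    (fun D => selection D) (fun D => select_law D) (fun D sigma => cover_radius sigma)
    measurable_cover_radius cover_equivariant measurable_cover_law.

Lemma covering_process_ge0 : nonneg_process covering_process.
Proof.
move=> D s v /=; rewrite /cover_radius; case: ifP => _; first by rewrite (le_trans _ r01).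
by case: ifP.
Qed.

Lemma covering_process_val D (s : ep_sample covering_process D) v :
  ep_val s v = 0 \/ 1 <= ep_val s v.
Proof.
rewrite /= /cover_radius; case: ifP => _; first by right.
by case: ifP => _; [left|right].
Qed.

Lemma covering_process_covers D (s : ep_sample covering_process D) :
  \bigcup_(v in [set: D]) nball (ep_val s v) v = [set: D].
Proof.
apply/seteqP; split => // x _.
have r00 : 0 < r0 by rewrite (lt_le_trans _ r01).
have [[u [su xu]]|nx] := pselect (exists u, s u /\ mdist x u <= r0).
  by exists u => //; rewrite /= /cover_radius su; split => //; rewrite metric_sym.
exists x => //; rewrite /= /cover_radius ifF; last first.
  by apply/negP => sx; apply: nx; exists x; rewrite mdistxx ltW.
by rewrite ifF; [split => //; rewrite mdistxx|apply/asboolP].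
Qed.

Local Open Scope ereal_scope.

Lemma covering_process_expectation D (o : D) (b : R) : (0 <= b)%R ->
  \int[ep_prob covering_process D]_s (powR00 (ep_val s o) b)%:E <=
  (r0 `^ b * (1 - expR (- a (unmarked o))))%:E +
  expeR (- \esum_(v in [set v | (mdist o v <= r0)%R]) (a (unmarked v))%:E).
Proof.
move=> b0.
pose E1 : set (selection D) := [set s | forall t, t \in [:: o] -> s t = true].
have /finite_seqP[s0 s0E] := @finite_closed_ball R D o r0.
pose s := undup s0.
have sP x : (x \in s) = (mdist o x <= r0)%R.
  rewrite mem_undup; apply/idP/idP => xs; first by have : [set` s0] x by []; rewrite -s0E.
  by have : [set` s0] x by rewrite -s0E.
pose E2 : set (selection D) := [set sigma | forall t, t \in s -> sigma t = false].
have mE1 : measurable E1 by exact: measurable_word.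
have mE2 : measurable E2 by exact: measurable_word.
have E1E : select_law D E1 = (1 - expR (- a (unmarked o)))%:E.
  by apply: (etrans (@select_lawE D [:: o] (fun=> true) isT)); rewrite big_seq1.
have E2E : select_law D E2 = expeR (- \esum_(v in [set v | (mdist o v <= r0)%R]) (a (unmarked v))%:E).
  apply: (etrans (@select_lawE D s (fun=> false) (undup_uniq _))).
  rewrite esum_fset; [|exact: finite_closed_ball|by move=> i _; rewrite lee_fin].
  have -> : [set v | (mdist o v <= r0)%R] = [set` s].
    by apply/seteqP; split=> x /=; rewrite sP.
  rewrite -fsbig_seq ?undup_uniq // sumEFin /= -sumrN expR_sum; congr (_%:E).
  by apply: eq_bigr => t _; rewrite /select_prob opprB addrC subrK.
have c0 : (0 <= r0 `^ b)%R by exact: powR_ge0.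
(* The radius at [o] is [r0] if [o] is selected ([E1]), and 1 only if no point within [r0] is
   selected ([E2]). *)
apply: (@le_trans _ _ (\int[select_law D]_s ((r0 `^ b)%:E * (\1_E1 s)%:E + (\1_E2 s)%:E))).
  apply: ge0_le_integral => //.
  - by move=> sigma _; rewrite lee_fin /powR00; case: ifP => // _; exact: powR_ge0.
  - apply/measurable_EFinP; apply: (@measurableT_comp _ _ _ _ _ _ (fun x : R => powR00 x b)).
      by apply: measurable_fun_ifT => //; exact: measurable_fun_eqr.
    exact: measurable_cover_radius.
  - by apply: emeasurable_funD; [apply: measurable_funeM|]; apply/measurable_EFinP; exact: measurable_indic.
  - move=> sigma _; rewrite -EFinM -EFinD lee_fin /= /cover_radius !indicE.
    have [so|so] := boolP (sigma o).
      rewrite mem_set ?mulr1; last by move=> t; rewrite inE => /eqP ->.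
      by rewrite /powR00 gt_eqF ?(lt_le_trans _ r01) // lerDl.
    rewrite memNset ?mulr0 ?add0r; last by move=> /(_ o (mem_head _ _)); exact/negP.
    case: asboolP => h; first by rewrite /powR00 eqxx.
    rewrite mem_set; first by rewrite /powR00 oner_eq0 powR1.
    by move=> t; rewrite sP => ot; apply/negP => st; apply: h; exists t.
rewrite ge0_integralD //; first last.
- by apply/measurable_EFinP; exact: measurable_indic.
- by apply: measurable_funeM; apply/measurable_EFinP; exact: measurable_indic.
- by move=> x _; rewrite mule_ge0 ?lee_fin.
rewrite ge0_integralZl_EFin //; last by apply/measurable_EFinP; exact: measurable_indic.
have I1 : \int[select_law D]_x (\1_E1 x)%:E = (1 - expR (- a (unmarked o)))%:E.
  by rewrite integral_indic // setIT; exact: E1E.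
have I2 : \int[select_law D]_x (\1_E2 x)%:E =
    expeR (- \esum_(v in [set v | (mdist o v <= r0)%R]) (a (unmarked v))%:E).
  by rewrite integral_indic // setIT; exact: E2E.
by rewrite I1 I2 -EFinM.
Qed.

End bernoulli_covering.

(** * Coverings guided by the weights *)

Lemma cvg_powRN (R : realType) (a : R) : 0 < a ->
  (fun n => n.+1%:R `^ (- a)) @ \oo --> (0 : R).
Proof.
move=> a0; apply/cvgrPdist_lt => e e0.
exists (Num.truncn (e `^ (- a^-1))).+1 => // n /= hn.
rewrite sub0r normrN ger0_norm ?powR_ge0 // powRN.
have en : e `^ (- a^-1) < n.+1%:R.
  by apply: (lt_trans (truncnS_gt _)); rewrite ltr_nat.
rewrite -[ltRHS]invrK ltf_pV2 ?posrE ?powR_gt0 ?invr_gt0 //.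
have -> : e^-1 = (e `^ (- a^-1)) `^ a.
  by rewrite -powRrM mulNr mulVf ?gt_eqF // powRN powRr1 // ltW.
by rewrite gt0_ltr_powR // ?nnegrE ?powR_ge0.
Qed.

Section truncated_sums.
Variables (R : realType) (T : choiceType).
Local Open Scope ereal_scope.

(** Either one term alone reaches [c], or no term is changed by the truncation. *)
Lemma esum_mine (P : set T) (f : T -> \bar R) (c : \bar R) :
  (forall t, 0 <= f t) -> 0 <= c ->
  mine (\esum_(t in P) f t) c <= \esum_(t in P) mine (f t) c.
Proof.
move=> f0 c0; have g0 t : 0 <= mine (f t) c by rewrite le_min f0.
have [[t [Pt ct]]|none] := pselect (exists t, P t /\ c <= f t).
  rewrite ge_min; apply/orP; right; apply: esum_ge; exists [set t].
    by split; [exact: finite_set1|move=> _ ->].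
  by rewrite fsbig_set1 le_min ct /=.
rewrite ge_min; apply/orP; left; apply: le_esum => t Pt.
by rewrite le_min lexx /= leNgt; apply/negP => /ltW fc; apply: none; exists t.
Qed.

End truncated_sums.

Section covering_by_weights.
Variable R : realType.
Local Open Scope ereal_scope.
Variables (mu : probability (pclass R 0 0) R) (w : equivariant_process R).
Hypothesis w0 : nonneg_process w.

Lemma in_closed_ball (D : discrete_space R) (o v : D) r :
  (v \in [set v | (mdist o v <= r)%R]) = (mdist o v <= r)%R.
Proof. by apply/idP/idP => [/set_mem|/mem_set]. Qed.

Definition root_weight (X : pspace R 0 1) : \bar R :=
  (Num.max 0 (ps_mark X ord0 (ps_root X)))%:E.

Definition mean_weight (X : pspace R 0 0) : \bar R := ep_int w root_weight X.

Lemma root_weight_ge0 X : 0 <= root_weight X.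
Proof. by rewrite lee_fin le_max lexx. Qed.

Lemma mean_weight_ge0 X : 0 <= mean_weight X.
Proof. by apply: ep_int_ge0; exact: root_weight_ge0. Qed.

Lemma ps_measurable_mean_weight : ps_measurable mean_weight.
Proof.
apply: ps_measurable_ep_int; first exact: root_weight_ge0.
exact: ps_measurable_root_weight.
Qed.

Lemma integral_mean_weight :
  \int[mu]_x mean_weight (repr x) = ep_expectation mu w (fun D o m => (m o)%:E).
Proof.
apply: eq_integral => x _; apply: eq_integral => s _.
by rewrite /root_weight /= (max_idPr (w0 _ _)).
Qed.

Lemma esum_mean_weight (D : discrete_space R) (o : D) r : (0 < r)%R ->
  \esum_(v in [set v | (mdist o v <= r)%R]) mean_weight (unmarked v) =
  \int[ep_prob w D]_s ball_weight r (marked o (ep_val s)).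
Proof.
move=> r0; rewrite /ball_weight (integral_esum _ (countable_discrete_space D)); first last.
- move=> v; rewrite r0 /= /ps_root /=; case: (mdist o v <= r)%R; last exact: measurable_cst.
  exact: (measurable_marked (Z := w) v (@ps_measurable_root_weight R)).
- by move=> v s; case: ifP => // _; rewrite lee_fin le_max lexx.
rewrite esum_mkcond; apply: eq_esum => v _; rewrite in_closed_ball r0 /ps_root /=.
by case: ifP => // _; rewrite integral0.
Qed.

(** The truncation also makes the value real, as required of an exponent, since [mean_weight] may be
    infinite at some spaces. *)
Definition intensity (t r : R) (X : pspace R 0 0) : R := fine (mine (t%:E * mean_weight X) r%:E).

Section intensity.
Variables (t r : R) (t0 : (0 <= t)%R) (r1 : (1 <= r)%R).

Lemma intensityE X : (intensity t r X)%:E = mine (t%:E * mean_weight X) r%:E.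
Proof.
rewrite /intensity fineK // ge0_fin_numE; first by rewrite gt_min ltry orbT.
by rewrite le_min mule_ge0 ?mean_weight_ge0 //= lee_fin (le_trans _ r1).
Qed.

Lemma intensity_ge0 X : (0 <= intensity t r X)%R.
Proof.
by rewrite -lee_fin intensityE le_min mule_ge0 ?mean_weight_ge0 //= lee_fin (le_trans _ r1).
Qed.

Lemma ps_measurable_intensity : ps_measurable (intensity t r).
Proof.
apply: (ps_measurable_comp (g := fun x : \bar R => fine (mine (t%:E * x) r%:E))).
  apply: measurableT_comp; first exact: fine_measurable.
  by apply: measurable_mine => //; exact: measurable_funeM.
exact: ps_measurable_mean_weight.
Qed.

Definition ball_intensity (X : pspace R 0 0) : \bar R :=
  \esum_(v in [set v | (mdist (ps_root X) v <= r)%R]) (intensity t r (unmarked v))%:E.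

Lemma ball_intensity_ge0 X : 0 <= ball_intensity X.
Proof. by apply: esum_ge0 => v _; rewrite lee_fin intensity_ge0. Qed.

Lemma ps_measurable_ball_intensity : ps_measurable ball_intensity.
Proof.
pose g (Y : pspace R 1 0) : \bar R := if (ps_dist ord0 ord_max Y <= r)%R
  then (intensity t r (ps_select (fun _ : 'I_1 => ord_max) Y))%:E else 0.
have g0 Y : 0 <= g Y by rewrite /g; case: ifP => // _; rewrite lee_fin intensity_ge0.
have mg : ps_measurable g.
  apply: ps_measurable_if; last exact: ps_measurable_cst.
    by apply: ps_measurable_le; [exact: ps_measurable_dist|exact: ps_measurable_cst].
  apply: (ps_measurable_comp (g := fun x : R => x%:E)); first exact: EFin_measurable.
  apply: ps_measurable_map; first exact: ps_measurable_select.
  exact: ps_measurable_intensity.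
have := ps_measurable_sum_unmarked2 g0 mg.
apply: ps_measurable_eq => X; rewrite /ball_intensity [RHS]esum_mkcond; apply: eq_esum => v _.
by rewrite in_closed_ball.
Qed.

Lemma ball_intensity_fin X : ball_intensity X \is a fin_num.
Proof.
rewrite ge0_fin_numE ?ball_intensity_ge0 // /ball_intensity esum_fset.
- rewrite fsbig_finite //=; last exact: finite_closed_ball.
  by rewrite lte_sum_pinfty // => i _; rewrite ltry.
- exact: finite_closed_ball.
- by move=> v _; rewrite lee_fin intensity_ge0.
Qed.

Lemma measurable_uncovered :
  measurable_fun setT (fun x : pclass R 0 0 => expeR (- ball_intensity (repr x))).
Proof.
rewrite (_ : (fun x => _) = (fun x => (expR (- fine (ball_intensity (repr x))))%:E)); last first.
  by apply/funext => x; rewrite -{1}(fineK (ball_intensity_fin (repr x))).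
apply/measurable_EFinP; apply: measurableT_comp; first exact: measurable_expR.
apply: measurableT_comp; first exact: oppr_measurable.
by apply: measurableT_comp; [exact: fine_measurable|exact: ps_measurable_ball_intensity.2].
Qed.

Lemma hausdorff_content_le (b : R) : (0 <= b)%R ->
  hausdorff_content mu 1 b <=
  (r `^ b * t)%:E * \int[mu]_x mean_weight (repr x) +
  \int[mu]_x expeR (- ball_intensity (repr x)).
Proof.
move=> b0; pose Z := covering_process ps_measurable_intensity intensity_ge0 r1.
have mE := ps_measurable_ep_int Z (powR_root_ge0 b) (@ps_measurable_powR_root R b).
have Zval D (s : ep_sample Z D) v : ep_val s v = 0%R \/ (1 <= ep_val s v)%R.
  exact: covering_process_val.
apply: (@le_trans _ _ (\int[mu]_x ep_int Z (powR_root b) (repr x))).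
  apply: ereal_inf_lbound; exists Z; split.
  - split; first exact: covering_process_ge0.
    by apply: aeW => x; apply: aeW => s; exact: covering_process_covers.
  - by apply: aeW => x; apply: aeW => s v; exact: Zval.
  - apply: eq_integral => x _; apply: eq_integral => s _; rewrite /powR_root /=.
    rewrite (max_idPr _) // /powR00; case: ifP => // _; exact: powR_ge0.
have rt0 : (0 <= r `^ b * t)%R by rewrite mulr_ge0 ?powR_ge0.
rewrite -ge0_integralZl_EFin //; first last.
- exact: ps_measurable_mean_weight.2.
- by move=> x _; exact: mean_weight_ge0.
rewrite -ge0_integralD //; first last.
- exact: measurable_uncovered.
- by move=> x _; exact: expeR_ge0.
- by apply: measurable_funeM; exact: ps_measurable_mean_weight.2.
- by move=> x _; rewrite mule_ge0 ?mean_weight_ge0.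
apply: ge0_le_integral => //.
- by move=> x _; apply: ep_int_ge0; exact: powR_root_ge0.
- exact: mE.2.
- apply: emeasurable_funD; last exact: measurable_uncovered.
  by apply: measurable_funeM; exact: ps_measurable_mean_weight.2.
move=> x _; apply: (@le_trans _ _ (\int[ep_prob Z (ps_space (repr x))]_s (powR00 (ep_val s (ps_root (repr x))) b)%:E)).
  rewrite le_eqVlt; apply/orP; left; apply/eqP; apply: eq_integral => s _; rewrite /powR_root /=.
  rewrite (max_idPr _) // /powR00; case: ifP => // _; exact: powR_ge0.
apply: (le_trans (covering_process_expectation _ _ _ _ b0)); apply: leeD2r.
rewrite EFinM EFinM -muleA lee_wpmul2l ?lee_fin ?powR_ge0 //.
(* By [1 - exp(-x) <= x], the root is selected with probability at most [t] times its mean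
   weight. *)
apply: (@le_trans _ _ (intensity t r (unmarked (ps_root (repr x))))%:E).
  rewrite lee_fin lerBlDr -lerBlDl; have := expR_ge1Dx (- intensity t r (unmarked (ps_root (repr x)))).
  by move=> h; lra.
rewrite intensityE (ps_measurable_mean_weight.1 _ _ (unmarked_root (repr x))).
by rewrite ge_min lexx.
Qed.

End intensity.

Lemma ball_intensity_ge t r X : (0 <= t)%R -> (1 <= r)%R ->
  mine (t%:E * \int[ep_prob w (ps_space X)]_s ball_weight r (marked (ps_root X) (ep_val s))) r%:E
    <= ball_intensity t r X.
Proof.
move=> t0 r1; rewrite -esum_mean_weight ?(lt_le_trans _ r1) //.
have fb := @finite_closed_ball R _ (ps_root X) r.
rewrite esum_fset //; last by move=> v _; exact: mean_weight_ge0.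
rewrite ge0_mule_fsumr; last by move=> v; exact: mean_weight_ge0.
rewrite -esum_fset //; last by move=> v _; rewrite mule_ge0 ?mean_weight_ge0.
apply: le_trans (esum_mine _ _ _) _ => //.
- by move=> v; rewrite mule_ge0 ?mean_weight_ge0.
- by rewrite lee_fin (le_trans _ r1).
by rewrite le_eqVlt; apply/orP; left; apply/eqP; apply: eq_esum => v _; rewrite intensityE.
Qed.

(** [E k] asks the lower bound at all integer radii above [k]. If every [E k] were null, almost
    every sample would contradict the assumed growth; [p] is the probability of one that is not.
    Coverings see conditional means only, hence this transfer. *)
Lemma mean_weight_growth (D : discrete_space R) (o : D) (c : R) :
  (\forall s \ae ep_prob w D, c%:E < lower_growth (fun r => total_weight (ep_val s) (nball r o))) ->
  exists (p : R) (k : nat), (0 < p)%R /\ forall n, (k <= n)%N ->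
    (p * n.+1%:R `^ c)%:E <= \int[ep_prob w D]_s ball_weight n.+1%:R (marked o (ep_val s)).
Proof.
move=> gw.
pose F n : set (ep_sample w D) :=
  [set s | (n.+1%:R `^ c)%:E <= ball_weight n.+1%:R (marked o (ep_val s))].
have mB n : measurable_fun setT (fun s : ep_sample w D => ball_weight n.+1%:R (marked o (ep_val s))).
  exact: (measurable_marked o (ps_measurable_ball_weight _)).
have mF n : measurable (F n).
  have := emeasurable_fun_c_infty measurableT (mB n) (n.+1%:R `^ c)%:E.
  by rewrite setTI.
pose E k := \bigcap_n F (k + n)%N.
have mE k : measurable (E k) by apply: bigcapT_measurable => n.
have [k Ek] : exists k, 0 < ep_prob w D (E k).
  apply: contrapT => /forallNP none.
  have nE : \forall s \ae ep_prob w D, forall k, ~ E k s.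
    apply: ae_foralln => k; exists (E k); split => //; last by move=> s /contrapT.
    by apply/eqP; rewrite eq_le measure_ge0 andbT leNgt; apply/negP; exact: none.
  have [s [ns gs]] := ae_witness (filterI nE gw).
  have [//|r0 r01 Hr0] := lower_growth_gt _ gs.
    by move=> r; apply: esum_ge0 => v _; rewrite lee_fin w0.
  apply: (ns (Num.truncn r0)) => n _; rewrite /F /= ball_weightE; last exact: w0.
  apply: Hr0; apply: (le_trans (ltW (truncnS_gt r0))).
  by rewrite ler_nat ltnS leq_addr.
exists (fine (ep_prob w D (E k))), k.
have Efin : ep_prob w D (E k) \is a fin_num by exact: fin_num_measure.
split; first by rewrite -lte_fin fineK.
move=> n kn; rewrite mulrC EFinM fineK //.
have mI : measurable_fun setT (fun s : ep_sample w D => (\1_(E k) s)%:E : \bar R).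
  by apply/measurable_EFinP; exact: measurable_indic.
have -> : (n.+1%:R `^ c)%:E * ep_prob w D (E k) =
    \int[ep_prob w D]_s ((n.+1%:R `^ c)%:E * (\1_(E k) s)%:E).
  by rewrite ge0_integralZl_EFin ?powR_ge0 // integral_indic // setIT.
apply: ge0_le_integral => //.
- exact: measurable_funeM.
- move=> s _; rewrite indicE; have [sE|sE] := boolP (s \in E k); last by rewrite mule0 ball_weight_ge0.
  by rewrite mule1; have := set_mem sE (n - k)%N Logic.I; rewrite /F subnKC.
Qed.

Lemma expRN_le_inv (x : R) : (0 < x -> expR (- x) <= x^-1)%R.
Proof.
move=> x0; rewrite expRN lef_pV2 ?posrE ?expR_gt0 //.
by apply: le_trans (expR_ge1Dx x); rewrite lerDr.
Qed.

Lemma uncovered_cvg0 (X : pspace R 0 0) (b c : R) : (0 < c)%R -> (b < c)%R ->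
  (\forall s \ae ep_prob w (ps_space X),
     c%:E < lower_growth (fun r => total_weight (ep_val s) (nball r (ps_root X)))) ->
  (fun n => expeR (- ball_intensity (n.+1%:R `^ (- b)) n.+1%:R X)) @ \oo --> 0.
Proof.
move=> c0 bc /mean_weight_growth[p [k [p0 Hk]]].
(* The bound [exp(-min(u, r)) <= 1/u + 1/r], where [r] is [n.+1] and [u] is [p] times [r] to the
   power [c - b], the lower bound on the intensity before truncation. *)
pose h n : R := (p^-1 * n.+1%:R `^ (- (c - b)) + n.+1%:R `^ (- 1))%R.
have hcvg : (EFin \o h) @ \oo --> 0.
  apply/cvg_EFin; first exact: nearW.
  have : h @ \oo --> (p^-1 * 0 + 0)%R.
    by apply: cvgD; [apply: cvgMr; apply: cvg_powRN; rewrite subr_gt0|exact: cvg_powRN].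
  by rewrite mulr0 addr0.
apply: (squeeze_cvge _ (cvg_cst 0) hcvg).
exists k => // n /= kn; rewrite expeR_ge0 /=.
have n1 : (1 <= n.+1%:R :> R)%R by rewrite ler1n.
have n0 : (0 < n.+1%:R :> R)%R by [].
set u := (p * n.+1%:R `^ (c - b))%R.
have u0 : (0 < u)%R by rewrite mulr_gt0 // powR_gt0.
have uL : (Num.min u n.+1%:R)%:E <= ball_intensity (n.+1%:R `^ (- b)) n.+1%:R X.
  apply: le_trans (ball_intensity_ge _ (powR_ge0 _ _) n1).
  rewrite EFin_min; apply: (@le_min2 _ (\bar R)) => //.
  apply: (@le_trans _ _ ((n.+1%:R `^ (- b))%:E * (p * n.+1%:R `^ c)%:E)).
    rewrite -EFinM lee_fin mulrCA -powRD; last by rewrite pnatr_eq0 implybT.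
    by rewrite /u addrC.
  by rewrite lee_wpmul2l ?lee_fin ?powR_ge0 // Hk.
apply: (@le_trans _ _ (expR (- Num.min u n.+1%:R))%:E).
  rewrite -[leRHS]/(expeR (- (Num.min u n.+1%:R)%:E)) lee_expeR.
  by rewrite leeN2.
rewrite lee_fin /h.
have ue : (p^-1 * n.+1%:R `^ (- (c - b)) = u^-1)%R by rewrite powRN invfM.
rewrite ue powRN powRr1 //.
have ui : (0 <= u^-1)%R by rewrite invr_ge0 ltW.
have ni : (0 <= n.+1%:R^-1 :> R)%R by rewrite invr_ge0 ltW.
have [un|un] := leP u n.+1%:R.
  by apply: le_trans (expRN_le_inv u0) _; rewrite lerDl.
by apply: le_trans (expRN_le_inv n0) _; rewrite lerDr.
Qed.

Lemma hausdorff_content_eq0 (b c : R) : (0 <= b)%R -> (b < c)%R ->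
  ep_expectation mu w (fun D o m => (m o)%:E) < +oo ->
  ep_as mu w (fun D o m => c%:E < lower_growth (fun r => total_weight m (nball r o))) ->
  hausdorff_content mu 1 b = 0.
Proof.
move=> b0 bc wfin gw; pose b' := ((b + c) / 2)%R.
(* Strictness on the left kills the selected term, of order [r] to the power [b - b']; strictness on
   the right kills the uncovered term. *)
have [bb' b'c] : (b < b')%R /\ (b' < c)%R by rewrite /b'; split; lra.
have c0 : (0 < c)%R by exact: le_lt_trans bc.
apply/eqP; rewrite eq_le; apply/andP; split; last first.
  apply: le_ereal_inf_tmp => _ [Z [_ _ ->]]; apply: integral_ge0 => x _.
  apply: integral_ge0 => s _; rewrite lee_fin /powR00; case: ifP => // _; exact: powR_ge0.
pose I n := \int[mu]_x expeR (- ball_intensity (n.+1%:R `^ (- b')) n.+1%:R (repr x)).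
pose u n := (n.+1%:R `^ (- (b' - b)))%:E * ep_expectation mu w (fun D o m => (m o)%:E) + I n.
have t0 n : (0 <= n.+1%:R `^ (- b') :> R)%R by exact: powR_ge0.
have n1 n : (1 <= n.+1%:R :> R)%R by rewrite ler1n.
have hu n : hausdorff_content mu 1 b <= u n.
  apply: (le_trans (hausdorff_content_le (t0 n) (n1 n) b0)).
  by rewrite /u integral_mean_weight -powRD ?pnatr_eq0 ?implybT // opprB.
have I0 : I @ \oo --> 0.
  have mG n := measurable_uncovered (t0 n) (n1 n).
  have G1 n X : expeR (- ball_intensity (n.+1%:R `^ (- b')) n.+1%:R X) <= 1.
    by rewrite -expeR0 lee_expeR oppe_le0 ball_intensity_ge0.
  have cvg0 : {ae mu, forall x : pclass R 0 0, setT x ->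
      (fun n => expeR (- ball_intensity (n.+1%:R `^ (- b')) n.+1%:R (repr x))) @ \oo --> cst 0 x}.
    (* Pointwise convergence of the uncovered probabilities; being at most 1, they converge in mean
       by domination. *)
    by move: gw; apply: filterS => x gx _; exact: uncovered_cvg0 c0 b'c gx.
  have int1 : mu.-integrable setT (cst 1 : pclass R 0 0 -> \bar R).
    exact: finite_measure_integrable_cst.
  have dom : {ae mu, forall (x : pclass R 0 0) n, setT x ->
      `|expeR (- ball_intensity (n.+1%:R `^ (- b')) n.+1%:R (repr x))| <= cst 1 x}.
    by apply: aeW => x n _; rewrite gee0_abs ?expeR_ge0.
  have [_ _] := dominated_convergence measurableT mG (@measurable_cst _ _ _ _ setT 0) cvg0 int1 dom.
  by rewrite integral0.
have u0 : u @ \oo --> 0.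
  have E0 : 0 <= ep_expectation mu w (fun D o m => (m o)%:E).
    by rewrite -integral_mean_weight; apply: integral_ge0 => x _; exact: mean_weight_ge0.
  rewrite -[X in _ --> X]adde0 -{1}[X in X + _](mul0e (ep_expectation mu w (fun D o m => (m o)%:E))).
  apply: cvgeD => //; first by rewrite mul0e.
  apply: cvgeZr; first by rewrite ge0_fin_numE.
  apply/cvg_EFin; first exact: nearW.
  by apply: cvg_powRN; rewrite subr_gt0.
rewrite -(cvg_lim _ u0) //; apply: lime_ge; first by apply: cvgP u0.
exact: nearW.
Qed.

Lemma ess_inf_le_udimH : ep_expectation mu w (fun D o m => (m o)%:E) < +oo ->
  ep_ess_inf mu w (fun D o m => lower_growth (fun r => total_weight m (nball r o))) <= udimH mu.
Proof.
move=> wfin; apply: ge_ereal_sup => y /= gy.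
rewrite leNgt; apply/negP => /ereal_between[b [ub /ereal_between[c [bc cy]]]].
rewrite lte_fin in bc.
have b0 : (0 <= b)%R.
  (* [udimH] is nonnegative by its definition, so [b] is an admissible exponent; its vanishing
     content then contradicts [udimH mu < b]. *)
  rewrite -lee_fin (le_trans _ (ltW ub)) //; apply: ereal_sup_ubound; by left.
move: ub; rewrite ltNge => /negP; apply; apply: ereal_sup_ubound; right.
exists b => //; split => //; apply: (hausdorff_content_eq0 b0 bc wfin).
by move: gy; apply: filterS => x; apply: filterS => s; exact: lt_le_trans.
Qed.

End covering_by_weights.

Unset Implicit Arguments.
Set Printing Implicit Defensive.
Local Open Scope ereal_scope.

(* The second inequality carries the proviso that w(D) > 0 almost surely, i.e.
   that w(N_r(o)) is eventually positive, so that log w(N_r(o)) is meaningful.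
   Without it the inequality is false: for D = Z and w = 0 or w = 1 according
   to a fair coin, the essential infimum is -oo. *)
Theorem theorem2p6 (R : realType) (mu : probability (pclass R 0 0) R)
    (w : equivariant_process R) :
  unimodular mu ->
  nonneg_process w ->
  0 < ep_expectation mu w (fun D o m => (m o)%:E) < +oo ->
  [/\ ep_ess_inf mu w (fun D o m =>
        lower_growth (fun r => total_weight m (nball r o))) <= udimH mu,
      ep_as mu w (fun D o m => 0 < total_weight m [set: D]) ->
      udimH mu <= ep_ess_inf mu w (fun D o m =>
        upper_growth (fun r => total_weight m (nball r o))) &
      ep_ess_inf mu w (fun D o m =>
        upper_growth (fun r => total_weight m (nball r o))) <=
      upper_growth (fun r =>
        ep_expectation mu w (fun D o m => total_weight m (nball r o)))].
Proof.
move=> muU w0 /andP[_ wfin]; split.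
- exact: ess_inf_le_udimH.
- exact: udimH_le_ess_inf.
- exact: ess_inf_growth_le_expectation.
Qed.
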